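(* Let $\tau$ denote the Ramanujan tau function, defined by $\sum_{n\ge1}\tau(n)X^n = X\prod_{n\ge1}(1-X^n)^{24}$. Let $n\ge 1$ be an integer and $\epsilon>0$ a real number. Then for almost all primes $p$, $$P(\tau(p^{2n})) > (\log p)^{1/8}(\log\log p)^{3/8-\epsilon}.$$ Further, if $q = P(2n+1)$ is sufficiently large, then the set of primes $p$ such that $$P(\tau(p^{2n})) > q^{-\epsilon}(\log p)^{1/8}(\log\log p)^{3/8}$$ has positive lower density.
   Context: For an integer $m$, $P(m)$ denotes the largest prime factor of $m$, with the convention $P(0)=P(\pm1)=1$. For a set $S$ of primes, its lower density is $\liminf_{x\to\infty}\#\{p\le x: p\in S\}/\pi(x)$ and its upper density is the corresponding $\limsup$, where $\pi(x)$ is the number of primes $\le x$; $S$ has density $D$ if both equal $D$. A property holds for almost all primes if the set of primes having it has density $1$. *)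

(* Defs.v *)
From HB Require Import structures.
From mathcomp Require Import all_boot all_order all_algebra.
From mathcomp Require Import all_classical all_reals all_analysis.

Set Implicit Arguments.
Unset Strict Implicit.
Unset Printing Implicit Defensive.

Import Order.TTheory GRing.Theory Num.Theory.
Import numFieldNormedType.Exports.

Local Open Scope ring_scope.

Definition tau_partial (N : nat) : {poly int} :=
  'X * \prod_(1 <= k < N.+1) (1 - 'X^k) ^+ 24.

(* The coefficient of X^n in the infinite product X \prod_(k >= 1) (1 - X^k)^24
   is that of any partial product with at least n factors; see [tau_stable]. *)
Definition tau (n : nat) : int := (tau_partial n)`_n.

Lemma tau_stable (n N : nat) : (n <= N)%N -> (tau_partial N)`_n = tau n.
Proof.
elim: N => [|N IH]; first by rewrite leqn0 => /eqP ->.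
rewrite leq_eqVlt ltnS => /predU1P[-> //|ltnN]; rewrite -(IH ltnN) /tau_partial.
rewrite big_nat_recr //= mulrA.
set q := 'X * _.
have [r ->] : exists r : {poly int}, (1 - 'X^(N.+1)) ^+ 24 = 1 + r * 'X^(N.+1).
  exists (- \sum_(i < 24) (1 - 'X^(N.+1)) ^+ i).
  rewrite -[LHS](subrK 1) subrX1 [LHS]addrC; congr (1 + _).
  by rewrite addrAC subrr sub0r !mulNr mulrC.
by rewrite mulrDr mulr1 mulrA coefD coefMXn ltnS ltnN addr0.
Qed.

(* [max_pdiv k] is 1 for k = 0 and k = 1, so gpf 0 = gpf 1 = gpf (-1) = 1. *)
Definition gpf (m : int) : nat := max_pdiv `|m|%N.

Section PrimeDensity.
Variable R : realType.

Definition prime_count (S : set nat) (x : R) : nat :=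
  (\sum_(0 <= p < (Num.truncn x).+1 | prime p && (p \in S)) 1)%N.

Definition primepi (x : R) : nat :=
  (\sum_(0 <= p < (Num.truncn x).+1 | prime p) 1)%N.

Definition prime_ratio (S : set nat) (x : R) : \bar R :=
  ((prime_count S x)%:R / (primepi x)%:R)%:E.

Definition lower_density (S : set nat) : \bar R :=
  limf_einf (prime_ratio S) +oo%R.

Definition upper_density (S : set nat) : \bar R :=
  limf_esup (prime_ratio S) +oo%R.

Definition has_density (S : set nat) (D : R) : Prop :=
  lower_density S = D%:E /\ upper_density S = D%:E.

Definition almost_all_primes (A : nat -> Prop) : Prop :=
  has_density [set p | prime p /\ A p]%classic 1.

End PrimeDensity.

(* Main.v *)
(* By the Hecke relations, tau(p^(2n)) = F(tau(p)^2, p^11) for a fixed binary form F of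
   degree n.  If its largest prime factor is at most sqrt(log X), then it belongs to a set
   of X^o(1) smooth integers, so it suffices to show that a nonzero value N is taken for at
   most O(X^(1 - delta)) primes p <= X.  The points (u, v) = (p, tau(p)) lie on the curve
   F(v^2, u^11) = N.  Fix a prime l slightly smaller than X and a nonsingular point of the
   curve mod l: above it v is a polynomial in u modulo every power of l, so the
   determinants with rows 1, u, ..., u^(d-1), v at d + 1 points are divisible by a large
   power of l; being small, they vanish.  All these points are thus on one graph
   v = R(u) with deg R < d, which meets the curve in a bounded number of points.  The
   singular points mod l have boundedly many abscissae.  Hence both sets in the theorem
   have density 1.

   The Hecke relations are proved without modular forms.  By Jacobi's formula for
   prod (1 - q^m)^3, tau(n) is, up to a power of 2, the sum of x_0 ... x_7 over the vectors
   of norm n in the lattice E8.  In octonion coordinates the vectors of norm pn are reached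
   from those of norm n by left multiplication with the elements of norm p, and by the
   symmetries of E8 the sum of x_0 ... x_7 over the image of a shell under a similarity is a
   multiple of the sum over the shell. *)
From HB Require Import structures.
Require Import Defs.
From mathcomp Require Import all_boot all_order all_fingroup all_algebra.
From mathcomp Require Import all_classical all_reals all_analysis.
From mathcomp Require Import ring lra zify.
Set Implicit Arguments.
Unset Strict Implicit.
Unset Printing Implicit Defensive.
Import Order.TTheory GRing.Theory Num.Theory.
Import numFieldNormedType.Exports.
Local Open Scope ring_scope.

(** * Octonions and the lattice E8 *)

(** The elementary route to the Hecke relations leaves only the trivial estimate tau(m) = O(m^16),
    and the determinant argument is shaped to tolerate it. For d + 1 points of height X the
    determinant is O(X^(16 + C(d, 2))), and it is divisible by l^C(d + 1, 2). As C(d + 1, 2) - C(d,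
    2) = d, any d > 16 wins once l is close enough to X. The choice d = 24 sets 292 against 300,
    which allows l between about X^0.98 and X^0.99. Chebyshev's bound provides such a prime, and l
    staying below X^0.99 is what saves a power of X. Similarities act on the sum of x_0 ... x_7 by a
    scalar because the degree 8 moments of a shell depend on two parameters only, one of them
    multiplying the Gaussian moments. A product of eight linear forms, the first orthogonal to the
    others, kills the Gaussian part. The odd exponent 11 enters through parity: 2k differs from 11,
    so tau(p^(2n)) is nonzero, and 2 deg R differs from 11, so no graph v = R(u) lies on the curve.
    Both thresholds are at most sqrt(log p) for large p, since 1/8 + 3/8 = 1/2. *)

Definition oct (R : Type) : Type := (R * R * R * R * R * R * R * R)%type.
HB.instance Definition _ (R : choiceType) :=
  Choice.copy (oct R) (R * R * R * R * R * R * R * R)%type.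
HB.instance Definition _ (R : finType) :=
  Finite.copy (oct R) (R * R * R * R * R * R * R * R)%type.
HB.instance Definition _ (R : zmodType) :=
  GRing.Zmodule.copy (oct R) (R * R * R * R * R * R * R * R)%type.

(* Multiplication table of a maximal order in the rational octonions; its norm form is
   that of the root lattice E8. *)
Definition omul (R : comNzRingType) (a b : oct R) : oct R :=
  let: (a0, a1, a2, a3, a4, a5, a6, a7) := a in
  let: (b0, b1, b2, b3, b4, b5, b6, b7) := b in
  (a0 * b0 - a1 * b1 + a1 * b5 - a1 * b6 - a1 * b7 - a2 * b2 - a3 * b3 - a3 * b4 + a3 * b5
    + a3 * b7 - a4 * b2 - a4 * b4 - a5 * b2 - a5 * b5 - a6 * b2 - a6 * b6 - a7 * b7,
   a0 * b1 + a1 * b0 - a1 * b4 + a1 * b6 - a1 * b7 + a2 * b3 + a2 * b4 - a2 * b5 - a2 * b7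
     - a3 * b2 - a4 * b2 - a4 * b5 + a5 * b2 + a5 * b4 - a6 * b7 + a7 * b2 + a7 * b6,
   a0 * b2 - a1 * b3 + a2 * b0 + a3 * b1 - a4 * b2 - a4 * b6 + a5 * b7 + a6 * b2 + a6 * b4
     - a7 * b2 - a7 * b5,
   a0 * b3 + a1 * b2 - a2 * b1 + a2 * b5 - a2 * b6 - a2 * b7 + a3 * b0 - a3 * b4 + a3 * b6
     - a3 * b7 - a4 * b7 - a5 * b2 - a5 * b6 + a6 * b2 + a6 * b5 + a7 * b2 + a7 * b4,
   a0 * b4 + a1 * b5 + a2 * b6 + a3 * b7 + a4 * b0 - a4 * b4 + a4 * b6 - a5 * b1 - a5 * b7
     - a6 * b2 - a7 * b3 - a7 * b4 + a7 * b5,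
   a0 * b5 - a1 * b4 - a2 * b7 + a3 * b6 + a4 * b1 - a4 * b5 + a4 * b6 + a5 * b0 - a5 * b7
     - a6 * b3 - a6 * b4 + a6 * b5 + a7 * b2,
   a0 * b6 + a1 * b7 - a2 * b4 - a3 * b5 + a4 * b2 + a5 * b3 - a5 * b7 + a6 * b0 - a6 * b4
     + a6 * b6 - a7 * b1 + a7 * b5 - a7 * b6,
   a0 * b7 - a1 * b6 + a2 * b5 - a3 * b4 + a4 * b3 - a4 * b7 - a5 * b2 + a6 * b1 + a6 * b7
     + a7 * b0 - a7 * b7).

Definition onorm (R : comNzRingType) (a : oct R) : R :=
  let: (a0, a1, a2, a3, a4, a5, a6, a7) := a in
  a0 * a0 - a0 * a4 + a0 * a6 - a0 * a7 + a1 * a1 - a1 * a5 + a1 * a6 + a1 * a7 + a2 * a2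
    + a2 * a4 + a2 * a5 + a2 * a6 + a3 * a3 + a3 * a4 - a3 * a5 - a3 * a7 + a4 * a4 + a5 * a5
    + a6 * a6 + a7 * a7.

Definition obil (R : comNzRingType) (a b : oct R) : R :=
  let: (a0, a1, a2, a3, a4, a5, a6, a7) := a in
  let: (b0, b1, b2, b3, b4, b5, b6, b7) := b in
  (a0 * b0 *+ 2) - a0 * b4 + a0 * b6 - a0 * b7 + (a1 * b1 *+ 2) - a1 * b5 + a1 * b6 + a1 * b7
    + (a2 * b2 *+ 2) + a2 * b4 + a2 * b5 + a2 * b6 + (a3 * b3 *+ 2) + a3 * b4 - a3 * b5
    - a3 * b7 - a4 * b0 + a4 * b2 + a4 * b3 + (a4 * b4 *+ 2) - a5 * b1 + a5 * b2 - a5 * b3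
    + (a5 * b5 *+ 2) + a6 * b0 + a6 * b1 + a6 * b2 + (a6 * b6 *+ 2) - a7 * b0 + a7 * b1
    - a7 * b3 + (a7 * b7 *+ 2).

Definition oconj (R : comNzRingType) (a : oct R) : oct R :=
  let: (a0, a1, a2, a3, a4, a5, a6, a7) := a in
  (a0 - a4 + a6 - a7, - a1, - a2, - a3, - a4, - a5, - a6, - a7).

Definition oscale (R : comNzRingType) (k : R) (a : oct R) : oct R :=
  let: (a0, a1, a2, a3, a4, a5, a6, a7) := a in (k * a0, k * a1, k * a2, k * a3, k * a4, k * a5,
    k * a6, k * a7).

Definition oone (R : comNzRingType) : oct R := (1, 0, 0, 0, 0, 0, 0, 0).

Section OctIdentities.
Variable R : comNzRingType.
Implicit Types a b c : oct R.

Lemma oct_addE (a0 a1 a2 a3 a4 a5 a6 a7 b0 b1 b2 b3 b4 b5 b6 b7 : R) :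
  (a0, a1, a2, a3, a4, a5, a6, a7) + (b0, b1, b2, b3, b4, b5, b6, b7) =
  (a0 + b0, a1 + b1, a2 + b2, a3 + b3, a4 + b4, a5 + b5, a6 + b6, a7 + b7)
  :> oct R.
Proof. by []. Qed.

Lemma oct_zeroE : (0 : oct R) = (0, 0, 0, 0, 0, 0, 0, 0).
Proof. by []. Qed.

Ltac octring :=
  repeat match goal with x : oct _ |- _ =>
    move: x => [[[[[[[? ?] ?] ?] ?] ?] ?] ?] end;
  rewrite ?oct_addE ?oct_zeroE /omul /onorm /obil /oconj /oscale /oone /= ?oct_addE;
  first [ring | congr (_, _, _, _, _, _, _, _); ring].

Lemma onormM a b : onorm (omul a b) = onorm a * onorm b.
Proof. octring. Qed.

Lemma omulCl a b : omul (oconj a) (omul a b) = oscale (onorm a) b.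
Proof. octring. Qed.

Lemma omulCr a b : omul (omul b a) (oconj a) = oscale (onorm a) b.
Proof. octring. Qed.

Lemma oconjK : involutive (@oconj R).
Proof. move=> a; octring. Qed.

Lemma onorm_conj a : onorm (oconj a) = onorm a.
Proof. octring. Qed.

Lemma onormD a b : onorm (a + b) = onorm a + onorm b + obil a b.
Proof. octring. Qed.

Lemma onormZ k a : onorm (oscale k a) = k ^+ 2 * onorm a.
Proof. octring. Qed.

Lemma onorm1 : onorm (oone R) = 1.
Proof. octring. Qed.

Lemma onorm0 : onorm (0 : oct R) = 0.
Proof. octring. Qed.

Lemma omulDr a b c : omul a (b + c) = omul a b + omul a c.
Proof. octring. Qed.

Lemma omulZr k a b : omul a (oscale k b) = oscale k (omul a b).
Proof. octring. Qed.

Lemma omulZl k a b : omul (oscale k a) b = oscale k (omul a b).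
Proof. octring. Qed.

Lemma omul0r a : omul a 0 = 0.
Proof. octring. Qed.

Lemma omul0l a : omul 0 a = 0.
Proof. octring. Qed.

Lemma oscaleA k l a : oscale k (oscale l a) = oscale (k * l) a.
Proof. octring. Qed.

Lemma oscale1 a : oscale 1 a = a.
Proof. octring. Qed.

Lemma oscale0 k : oscale k (0 : oct R) = 0.
Proof. octring. Qed.

Lemma oscale0l a : oscale 0 a = 0.
Proof. octring. Qed.

Lemma oscaleDr k a b : oscale k (a + b) = oscale k a + oscale k b.
Proof. octring. Qed.

Lemma oscaleDl k l a : oscale (k + l) a = oscale k a + oscale l a.
Proof. octring. Qed.

Lemma obil_adj a b c : obil (omul a b) c = obil b (omul (oconj a) c).
Proof. octring. Qed.

Lemma obilDl a b c : obil (a + b) c = obil a c + obil b c.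
Proof. octring. Qed.

Lemma obilDr a b c : obil a (b + c) = obil a b + obil a c.
Proof. octring. Qed.

Lemma obilZr k a b : obil a (oscale k b) = k * obil a b.
Proof. octring. Qed.

Lemma obilZl k a b : obil (oscale k a) b = k * obil a b.
Proof. octring. Qed.

Lemma obilC a b : obil a b = obil b a.
Proof. octring. Qed.

Lemma obil0r a : obil a 0 = 0.
Proof. octring. Qed.

(* Unimodularity: the test vectors form the basis dual to the standard one. *)
Lemma obil_nondeg a : (forall b, obil a b = 0) -> a = 0.
Proof.
move=> H.
have := H (2, 0, 0, 0, 1, 0, -1, 1); have := H (0, 2, 0, 0, 0, 1, -1, -1).
have := H (0, 0, 2, 0, -1, -1, -1, 0); have := H (0, 0, 0, 2, -1, 1, 0, 1).
have := H (1, 0, -1, -1, 2, 0, 0, 0); have := H (0, 1, -1, 1, 0, 2, 0, 0).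
have := H (-1, -1, -1, 0, 0, 0, 2, 0); have := H (1, -1, 0, 1, 0, 0, 0, 2).
move: a {H} => [[[[[[[a0 a1] a2] a3] a4] a5] a6] a7]; rewrite /obil /=.
move=> H7 H6 H5 H4 H3 H2 H1 H0.
congr (_, _, _, _, _, _, _, _).
- by rewrite -[RHS]H0; ring.
- by rewrite -[RHS]H1; ring.
- by rewrite -[RHS]H2; ring.
- by rewrite -[RHS]H3; ring.
- by rewrite -[RHS]H4; ring.
- by rewrite -[RHS]H5; ring.
- by rewrite -[RHS]H6; ring.
- by rewrite -[RHS]H7; ring.
Qed.

End OctIdentities.

Notation "''i' k" := (@Ordinal 8 k isT) (at level 0, k at level 0, only parsing).

Lemma forall_ord8 (P : 'I_8 -> Prop) :
  P 'i 0 -> P 'i 1 -> P 'i 2 -> P 'i 3 -> P 'i 4 -> P 'i 5 -> P 'i 6 ->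
  P 'i 7 -> forall i, P i.
Proof.
move=> H0 H1 H2 H3 H4 H5 H6 H7 [[|[|[|[|[|[|[|[|//]]]]]]]] ilt];
  by rewrite (bool_irrelevance ilt isT).
Qed.

Lemma big_ord8 (R : Type) (idx : R) (op : Monoid.law idx) (F : 'I_8 -> R) :
  \big[op/idx]_(i < 8) F i =
  op (op (op (op (op (op (op (F 'i 0) (F 'i 1)) (F 'i 2)) (F 'i 3)) (F 'i 4))
    (F 'i 5)) (F 'i 6)) (F 'i 7).
Proof.
rewrite !big_ord_recr big_ord0 Monoid.mul1m.
do 7?[congr (op _ _)]; by congr F; apply: val_inj.
Qed.

(** Orthogonal coordinates, doubled so that the half-integral vectors of E8 become integral; norm
    [n] is then squared length [8 n]. *)
Definition toX (c : oct int) : {ffun 'I_8 -> int} :=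
  let: (a0, a1, a2, a3, a4, a5, a6, a7) := c in
  [ffun i : 'I_8 => nth 0
    [:: a0 *+ 2 + a6 - a7;
        a0 *+ 2 - a4 *+ 2 + a6 - a7;
        a1 *+ 2 + a6 + a7;
        a1 *+ 2 - a5 *+ 2 + a6 + a7;
        - a6 + a7;
        - a6 - a7;
        a2 *+ 2 + a3 *+ 2 + a4 *+ 2 + a6 - a7;
        a2 *+ 2 - a3 *+ 2 + a5 *+ 2 + a6 + a7] i].

Definition fromX (X : {ffun 'I_8 -> int}) : oct int :=
  let x i := X i in
  (((x 'i 0 + x 'i 4) %/ 2)%Z, ((x 'i 2 + x 'i 5) %/ 2)%Z,
   ((- x 'i 0 + x 'i 1 - x 'i 2 + x 'i 3 + x 'i 4 + x 'i 5 + x 'i 6 + x 'i 7) %/ 4)%Z,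
   ((- x 'i 0 + x 'i 1 + x 'i 2 - x 'i 3 + x 'i 4 - x 'i 5 + x 'i 6 - x 'i 7) %/ 4)%Z,
   ((x 'i 0 - x 'i 1) %/ 2)%Z, ((x 'i 2 - x 'i 3) %/ 2)%Z,
   ((- x 'i 4 - x 'i 5) %/ 2)%Z, ((x 'i 4 - x 'i 5) %/ 2)%Z).

(* The lattice [2 D8+], a copy of [2 E8]. *)
Definition inE8 (X : {ffun 'I_8 -> int}) : bool :=
  [forall i, (2 %| X i - X 'i 0)%Z] && (4 %| \sum_i X i)%Z.

Lemma toX_inE8 c : inE8 (toX c).
Proof.
move: c => [[[[[[[a0 a1] a2] a3] a4] a5] a6] a7].
apply/andP; split.
  by apply/forallP; apply: forall_ord8; rewrite !ffunE /=; lia.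
by rewrite big_ord8 !ffunE /=; lia.
Qed.

Lemma toXK : cancel toX fromX.
Proof.
move=> [[[[[[[a0 a1] a2] a3] a4] a5] a6] a7]; rewrite /fromX !ffunE /=.
by congr (_, _, _, _, _, _, _, _); lia.
Qed.

Lemma fromXK X : inE8 X -> toX (fromX X) = X.
Proof.
case/andP=> /forallP H; rewrite big_ord8 /= => H4.
move: (H 'i 1) (H 'i 2) (H 'i 3) (H 'i 4) (H 'i 5) (H 'i 6) (H 'i 7) => {}H *.
by apply/ffunP; apply: forall_ord8; rewrite /toX /fromX !ffunE /=; lia.
Qed.

Lemma sum_sqr_toX c : \sum_i toX c i ^+ 2 = 8 * onorm c.
Proof.
move: c => [[[[[[[a0 a1] a2] a3] a4] a5] a6] a7].
by rewrite big_ord8 /= !ffunE /= /onorm; ring.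
Qed.

Lemma onorm_ge0 (c : oct int) : 0 <= onorm c.
Proof.
have : 0 <= \sum_i toX c i ^+ 2 by apply: sumr_ge0 => i _; exact: sqr_ge0.
by rewrite sum_sqr_toX; lia.
Qed.

Lemma onorm_eq0 (c : oct int) : (onorm c == 0) = (c == 0).
Proof.
apply/eqP/eqP => [c0|->]; last exact: onorm0.
rewrite -(toXK c) -(toXK 0); congr fromX; apply/ffunP => i.
have /eqP : \sum_i toX c i ^+ 2 = 0 by rewrite sum_sqr_toX c0.
rewrite psumr_eq0 => [/allP/(_ i (mem_index_enum _))|j _]; last exact: sqr_ge0.
rewrite sqrf_eq0 => /eqP ->.
by move: i; apply: forall_ord8; rewrite !ffunE.
Qed.

Definition box (K : nat) : seq {ffun 'I_8 -> int} :=
  [seq [ffun i => (f i : nat)%:Z - K%:Z] | f : {ffun 'I_8 -> 'I_(2 * K).+1}].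

Lemma mem_box K X : (X \in box K) = [forall i, `|X i| <= K%:Z].
Proof.
apply/fintype.imageP/forallP => [[f _ ->] i|H].
  by rewrite ffunE; case: (f i) => m /=; lia.
have Hlt i : (absz (X i + K%:Z)%R < (2 * K).+1)%N by have := H i; lia.
exists [ffun i => Ordinal (Hlt i)] => //.
apply/ffunP => i; rewrite !ffunE /=; have := H i. move: (X i) => x; lia.
Qed.

Lemma uniq_box K : uniq (box K).
Proof.
rewrite map_inj_uniq ?enum_uniq // => f g /ffunP E.
by apply/ffunP => i; apply: val_inj; have := E i; rewrite !ffunE /=; lia.
Qed.

Lemma size_box K : size (box K) = ((2 * K).+1 ^ 8)%N.
Proof. by rewrite size_map -cardT card_ffun !card_ord. Qed.

Definition shellX (n : nat) : seq {ffun 'I_8 -> int} :=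
  [seq X <- box (8 * n) | inE8 X && (\sum_i X i ^+ 2 == (8 * n)%:Z)].

Lemma coord_le_norm (X : {ffun 'I_8 -> int}) (K : nat) i :
  \sum_i X i ^+ 2 = K%:Z -> `|X i| <= K%:Z.
Proof.
move=> <-; rewrite (bigD1 i) //=.
have : 0 <= \sum_(j | j != i) X j ^+ 2 by apply: sumr_ge0 => j _; exact: sqr_ge0.
move: (X i) (\sum_(j | _) _) => x S S0; have : `|x| <= x ^+ 2.
  by rewrite -(real_normK (num_real x)) expr2; have := normr_ge0 x; move: `|x| => y; nia.
by lra.
Qed.

Lemma mem_shellX n X :
  (X \in shellX n) = inE8 X && (\sum_i X i ^+ 2 == (8 * n)%:Z).
Proof.
rewrite mem_filter andb_idr // => /andP[_ /eqP E].
by rewrite mem_box; apply/forallP => i; exact: coord_le_norm.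
Qed.

Definition oshell (n : nat) : seq (oct int) := map fromX (shellX n).

Lemma mem_oshell n c : (c \in oshell n) = (onorm c == n%:Z).
Proof.
apply/mapP/eqP => [[X]|E].
  rewrite mem_shellX => /andP[HX /eqP E] ->.
  by have := sum_sqr_toX (fromX X); rewrite fromXK // E; lia.
exists (toX c); last by rewrite toXK.
by rewrite mem_shellX toX_inE8 sum_sqr_toX E -PoszM eqxx.
Qed.

Lemma uniq_oshell n : uniq (oshell n).
Proof.
rewrite map_inj_in_uniq; first exact/filter_uniq/uniq_box.
move=> X Y; rewrite !mem_shellX => /andP[HX _] /andP[HY _] E.
by rewrite -(fromXK HX) E fromXK.
Qed.

Lemma sum_oshell (V : nmodType) n (f : {ffun 'I_8 -> int} -> V) :
  \sum_(c <- oshell n) f (toX c) = \sum_(X <- shellX n) f X.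
Proof.
rewrite big_map; apply: eq_big_seq => X.
by rewrite mem_shellX => /andP[HX _]; rewrite fromXK.
Qed.

(** If the coordinate sum of [T] is 2 mod 4, moving one [T j] by 2 towards [X j / m] repairs it.
    With r the residual at [j], the squared distance changes by 4 m^2 - 4 m |r|, so choosing r
    nonzero keeps it strictly below 8 m^2. *)
Lemma E8_parity_fix (m : int) (X T : {ffun 'I_8 -> int}) : 0 < m ->
  (forall i, (2 %| T i - T 'i 0)%Z) ->
  \sum_i (X i - m * T i) ^+ 2 <= 4 * m ^+ 2 ->
  exists2 U, inE8 U & \sum_i (X i - m * U i) ^+ 2 < 8 * m ^+ 2.
Proof.
move=> m0 par le4.
have m2 : 0 < m ^+ 2 by rewrite exprn_gt0.
have even_sum : (2 %| \sum_i T i)%Z.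
  rewrite big_ord8 /=; move: (par 'i 1) (par 'i 2) (par 'i 3) (par 'i 4).
  by move: (par 'i 5) (par 'i 6) (par 'i 7); lia.
have [T4|nT4] := boolP (4 %| \sum_i T i)%Z.
  exists T; first by apply/andP; split => //; apply/forallP.
  by apply: le_lt_trans le4 _; lia.
have [j Hj] : exists j, \sum_i (X i - m * T i) ^+ 2 <
    4 * m ^+ 2 + 4 * m * `|X j - m * T j|.
  have [/existsP[j nz]|] := boolP [exists j, X j - m * T j != 0].
    exists j; apply: le_lt_trans le4 _; rewrite ltrDl.
    by rewrite !mulr_gt0 // normr_gt0.
  rewrite negb_exists => /forallP z; exists 'i 0; rewrite big1 => [|i _].
    by apply: ltr_pwDl; rewrite ?mulr_gt0 // !mulr_ge0 // ltW.
  by have := z i; rewrite negbK => /eqP ->; rewrite expr0n.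
pose s : int := if 0 <= X j - m * T j then 1 else -1.
have sE : s * (X j - m * T j) = `|X j - m * T j|.
  by rewrite /s; case: ifP => h; [rewrite mul1r ger0_norm | rewrite mulN1r ltr0_norm // ltNge h].
have s2 : s * s = 1 by rewrite /s; case: ifP.
exists [ffun i => T i + (i == j)%:R * (2 * s)].
  apply/andP; split.
    apply/forallP => i; rewrite !ffunE; have := par i.
    by case: (i == j); case: ('i 0 == j); rewrite /s; case: ifP; lia.
  under eq_bigr do rewrite ffunE.
  rewrite big_split /= [X in (_ %| _ + X)%Z](bigD1 j) //= eqxx.
  rewrite [X in true%:R * _ + X]big1; last by move=> i /negPf ->; rewrite mul0r.
  have {}nT4 : (4 %| \sum_i T i)%Z = false by exact: negbTE.
  move: (\sum_i T i) nT4 even_sum => S nT4 even_sum.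
  by rewrite /s; case: ifP => _; lia.
rewrite (bigD1 j) //= !ffunE eqxx.
rewrite (eq_bigr (fun i => (X i - m * T i) ^+ 2)); last first.
  by move=> i /negPf ij; rewrite ffunE ij mul0r addr0.
move: Hj; rewrite (bigD1 j) //= => Hj.
set S := \sum_(i < 8 | _) _ in Hj *.
have -> : (X j - m * (T j + 1 * (2 * s))) ^+ 2 =
  (X j - m * T j) ^+ 2 - 4 * m * (s * (X j - m * T j)) + 4 * m ^+ 2 * (s * s) by ring.
by rewrite sE s2; move: Hj; lra.
Qed.

Lemma E8_round (m : int) (X : {ffun 'I_8 -> int}) : 0 < m ->
  exists2 U, inE8 U & \sum_i (X i - m * U i) ^+ 2 < 8 * m ^+ 2.
Proof.
move=> m0.
have /fin_all_exists[k Hk] i : exists k, - m <= X i - m * (2 * k) <= m.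
  exists ((X i + m) %/ (2 * m))%Z.
  have m2 : 0 < 2 * m by lia.
  have := divz_eq (X i + m) (2 * m); have := ltz_pmod (X i + m) m2.
  have := modz_ge0 (X i + m) (lt0r_neq0 m2).
  move: (X i) (_ %/ _)%Z (_ %% _)%Z => x q r; lia.
pose d i := X i - m * (2 * k i); pose s i : int := if 0 <= d i then 1 else -1.
have s1 i : s i * d i = `|d i| /\ s i * s i = 1.
  rewrite /s; case: ifP => h; last by rewrite !mulN1r ltr0_norm ?opprK // ltNge h.
  by rewrite !mul1r ger0_norm.
(* One of the two roundings of [X / m], to even or to odd integer vectors, is
   good because [r ^ 2 + (m - r) ^ 2 <= m ^ 2]. *)
have [le4|gt4] := lerP (\sum_i d i ^+ 2) (4 * m ^+ 2).
  apply: (@E8_parity_fix m X [ffun i => 2 * k i]) => // [i|].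
    by rewrite !ffunE; lia.
  by under eq_bigr do rewrite ffunE.
apply: (@E8_parity_fix m X [ffun i => 2 * k i + s i]) => // [i|].
  by rewrite !ffunE /s; case: ifP; case: ifP; lia.
under eq_bigr do rewrite ffunE.
have : \sum_i (d i ^+ 2 + (X i - m * (2 * k i + s i)) ^+ 2) <= \sum_(i < 8) m ^+ 2.
  apply: ler_sum => i _; have [si1 si2] := s1 i.
  have -> : (X i - m * (2 * k i + s i)) ^+ 2 =
    d i ^+ 2 - 2 * m * (s i * d i) + m ^+ 2 * (s i * s i) by rewrite /d; ring.
  rewrite si1 si2 -(real_normK (num_real (d i))).
  have : `|d i| <= m by rewrite ler_norml; exact: Hk.
  have := normr_ge0 (d i); move: `|d i| => y; nra.
by rewrite big_split /= sumr_const card_ord -mulr_natl; move: gt4; lra.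
Qed.

Lemma toX_sub (m : int) (x t : oct int) i :
  toX (x + oscale (- m) t) i = toX x i - m * toX t i.
Proof.
move: t x => [[[[[[[a0 a1] a2] a3] a4] a5] a6] a7].
move=> [[[[[[[b0 b1] b2] b3] b4] b5] b6] b7].
rewrite /oscale oct_addE.
by move: i; apply: forall_ord8; rewrite !ffunE /=; ring.
Qed.

(** Rounding [x / m] to the lattice leaves squared length below 8 m^2, which is eight times the
    norm. Strictness makes the Euclidean descent on left ideals terminate. *)
Lemma oct_euclid (m : int) (x : oct int) : 0 < m ->
  exists t, onorm (x + oscale m t) < m ^+ 2.
Proof.
move=> m0; have [U HU lt8] := E8_round (toX x) m0.
exists (oscale (-1) (fromX U)); rewrite oscaleA mulrN1.
rewrite -(ltr_pM2l (ltr0n _ 8)) -sum_sqr_toX.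
by under eq_bigr do rewrite toX_sub fromXK //.
Qed.

Definition odvd (m : int) (x : oct int) : Prop := exists y, x = oscale m y.

Lemma oscale_inj (m : int) : m != 0 -> injective (@oscale int m).
Proof.
move=> /mulfI m0 [[[[[[[a0 a1] a2] a3] a4] a5] a6] a7].
by move=> [[[[[[[b0 b1] b2] b3] b4] b5] b6] b7] /= [] /m0-> /m0-> /m0-> /m0->
  /m0-> /m0-> /m0-> /m0->.
Qed.

Lemma odvdDr m x t : odvd m (x + oscale m t) <-> odvd m x.
Proof.
split=> [[y E]|[y ->]]; last by exists (y + t); rewrite oscaleDr.
exists (y + oscale (-1) t); rewrite oscaleDr -E oscaleA mulrN1 -addrA -oscaleDl.
by rewrite subrr oscale0l addr0.
Qed.

Lemma odvd_mulDr m b x t :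
  odvd m (omul b (x + oscale m t)) <-> odvd m (omul b x).
Proof. by rewrite omulDr omulZr; exact: odvdDr. Qed.

Definition ocount (k : nat) (P : oct int -> Prop) : nat :=
  \sum_(b <- oshell k | `[< P b >]) 1.

Lemma ocount_bij (k l : nat) (P Q : oct int -> Prop) (f g : oct int -> oct int) :
  (forall b, onorm b = k%:Z -> P b ->
     [/\ onorm (f b) = l%:Z, Q (f b) & g (f b) = b]) ->
  (forall b, onorm b = l%:Z -> Q b ->
     [/\ onorm (g b) = k%:Z, P (g b) & f (g b) = b]) ->
  ocount k P = ocount l Q.
Proof.
move=> Hf Hg; rewrite /ocount -[LHS]big_filter -[RHS]big_filter.
suff Hp : perm_eq (map f [seq b <- oshell k | `[< P b >]])
                  [seq b <- oshell l | `[< Q b >]].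
  by rewrite -(perm_big _ Hp) big_map.
apply: uniq_perm; rewrite ?filter_uniq ?uniq_oshell //.
  rewrite map_inj_in_uniq ?filter_uniq ?uniq_oshell // => a b.
  rewrite !mem_filter !mem_oshell => /andP[/asboolP Pa /eqP Na].
  move=> /andP[/asboolP Pb /eqP Nb] E.
  by have [_ _ <-] := Hf a Na Pa; have [_ _ <-] := Hf b Nb Pb; rewrite E.
move=> c; apply/mapP/idP => [[b]|].
  rewrite !mem_filter !mem_oshell => /andP[/asboolP Pb /eqP Nb] ->.
  by have [-> /asboolP -> _] := Hf b Nb Pb; rewrite eqxx.
rewrite mem_filter mem_oshell => /andP[/asboolP Qc /eqP Nc].
have [E1 E2 E3] := Hg c Nc Qc; exists (g c) => //.
by rewrite mem_filter mem_oshell E1 eqxx andbT; exact/asboolP.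
Qed.

Lemma ocount_eq (k : nat) (P Q : oct int -> Prop) :
  (forall b, onorm b = k%:Z -> P b <-> Q b) -> ocount k P = ocount k Q.
Proof.
by move=> H; apply: (@ocount_bij _ _ _ _ id id) => b Nb /(H b Nb).
Qed.

(* Dividing [b x] by [m], where [onorm x = m n], turns the left ideal attached
   to [(m, x)] into the one attached to [(n, oconj x)]; Euclidean reduction of [x]
   makes [n < m], so that iterating leads to the whole ring. *)
Lemma left_ideal_count (m : nat) (x : oct int) (k : nat) :
  (0 < m)%N -> (exists n, onorm x = m%:Z * n) ->
  (forall b, odvd m%:Z (omul b x) -> exists j, onorm b = m%:Z * j) ->
  ocount (m * k)%N (fun b => odvd m%:Z (omul b x)) = ocount k (fun=> True).
Proof.
elim/ltn_ind: m x => m IH x m0 [n0 Nx] Hx.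
have mz : m%:Z != 0 by rewrite eqz_nat -lt0n.
have [t Ht] := oct_euclid x (ltac:(lia) : 0 < m%:Z).
set x' := x + oscale m%:Z t in Ht.
have {}Hx b : odvd m%:Z (omul b x') -> exists j, onorm b = m%:Z * j.
  by move/odvd_mulDr/Hx.
have -> : ocount (m * k)%N (fun b => odvd m%:Z (omul b x)) =
          ocount (m * k)%N (fun b => odvd m%:Z (omul b x')).
  by apply: ocount_eq => b _; apply: iff_sym; exact: odvd_mulDr.
have [n Nx'] : exists n : nat, onorm x' = m%:Z * n%:Z.
  have := onorm_ge0 x'; rewrite /x' onormD onormZ obilZr Nx.
  have -> : m%:Z * n0 + m%:Z ^+ 2 * onorm t + m%:Z * obil x t =
    m%:Z * (n0 + m%:Z * onorm t + obil x t) by ring.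
  move: (_ + obil x t) => u mu; have : 0 <= u by move: mu; rewrite pmulr_rge0; lia.
  by case: u {mu} => // n _; exists n.
have lt_nm : (n < m)%N by move: Ht; rewrite Nx' expr2 ltr_pM2l; lia.
(* If the reduced element vanishes, the ideal contains 1 and the norm condition [Hx] forces m =
   1. *)
have [n_eq0|n0'] := posnP n.
  have x'0 : x' = 0 by apply/eqP; rewrite -onorm_eq0 Nx' n_eq0 mulr0.
  have [j] : exists j, onorm (oone int) = m%:Z * j.
    by apply: Hx; rewrite x'0 omul0r; exists 0; rewrite oscale0.
  rewrite onorm1 => j1; have m1 : m = 1%N.
    apply/eqP; rewrite -[m in m == _]/(absz m%:Z) -dvdz1.
    by apply/dvdzP; exists j; rewrite mulrC.
  rewrite m1 mul1n; apply: ocount_eq => b _; split => // _.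
  by exists (omul b x'); rewrite oscale1.
have nz : n%:Z != 0 by rewrite eqz_nat -lt0n.
have Nc : onorm (oconj x') = n%:Z * m%:Z by rewrite onorm_conj Nx' mulrC.
have Hc b : odvd n%:Z (omul b (oconj x')) -> exists j, onorm b = n%:Z * j.
  move=> [y Ey]; have Eb : omul y x' = oscale m%:Z b.
    apply: (oscale_inj nz); rewrite oscaleA -omulZl -Ey.
    by have := omulCr (oconj x') b; rewrite oconjK Nc.
  have [j Nj] := Hx y (ex_intro _ _ Eb).
  exists j; apply: (mulfI mz).
  have := congr1 (@onorm int) Eb; rewrite onormM onormZ Nj Nx' => E.
  by apply: (mulfI mz); rewrite !mulrA -expr2 -E; ring.
rewrite -[RHS](IH n lt_nm (oconj x') n0' (ex_intro _ _ Nc) Hc).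
(* [f] and [g] are the quotients of [b x'] by [m] and of [b (oconj x')] by [n]; the default 0 is
   never met where they are used. They are mutually inverse since right multiplication by [x'] and
   then by its conjugate is multiplication by [m n]. *)
pose f b := xget 0 [set y | omul b x' = oscale m%:Z y]%classic.
pose g b := xget 0 [set y | omul b (oconj x') = oscale n%:Z y]%classic.
have fE b y : omul b x' = oscale m%:Z y -> f b = y.
  move=> E; apply: (oscale_inj mz); rewrite -E; symmetry.
  by apply: (@xgetPex _ 0 [set y | omul b x' = oscale m%:Z y]%classic); exists y.
have gE b y : omul b (oconj x') = oscale n%:Z y -> g b = y.
  move=> E; apply: (oscale_inj nz); rewrite -E; symmetry.
  by apply: (@xgetPex _ 0 [set y | omul b (oconj x') = oscale n%:Z y]%classic); exists y.
have fwd b y : omul b x' = oscale m%:Z y -> omul y (oconj x') = oscale n%:Z b.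
  move=> E; apply: (oscale_inj mz); rewrite -omulZl -E omulCr Nx' oscaleA //.
have bwd' b y : omul b (oconj x') = oscale n%:Z y -> omul y x' = oscale m%:Z b.
  move=> E; apply: (oscale_inj nz); rewrite -omulZl -E.
  by have := omulCr (oconj x') b; rewrite oconjK Nc oscaleA.
apply: (@ocount_bij _ _ _ _ f g) => b Nb [y E].
  rewrite (fE _ _ E) (gE _ _ (fwd _ _ E)); split => //; last by exists b; exact: fwd.
  apply: (mulfI mz); apply: (mulfI mz); have := congr1 (@onorm int) E.
  by rewrite onormM onormZ Nb Nx' !PoszM => E'; rewrite mulrA -expr2 -E'; ring.
rewrite (gE _ _ E) (fE _ _ (bwd' _ _ E)); split => //; last by exists b; exact: bwd'.
apply: (mulfI nz); apply: (mulfI nz); have := congr1 (@onorm int) E.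
by rewrite onormM onormZ Nb Nc !PoszM => E'; rewrite mulrA -expr2 -E'; ring.
Qed.

Definition omap (R S : comNzRingType) (f : R -> S) (x : oct R) : oct S :=
  let: (a0, a1, a2, a3, a4, a5, a6, a7) := x in
  (f a0, f a1, f a2, f a3, f a4, f a5, f a6, f a7).

Section OctMorphism.
Variables (R S : comNzRingType) (f : {rmorphism R -> S}).

Ltac octmorph :=
  repeat match goal with x : oct _ |- _ =>
    move: x => [[[[[[[? ?] ?] ?] ?] ?] ?] ?] end;
  rewrite /omap ?oct_addE /omul /onorm /oscale /obil
    /=; first [ring | congr (_, _, _, _, _, _, _, _); ring].

Lemma omapM (x y : oct R) : omap f (omul x y) = omul (omap f x) (omap f y).
Proof. by octmorph. Qed.

Lemma onorm_map (x : oct R) : onorm (omap f x) = f (onorm x).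
Proof. by octmorph. Qed.

End OctMorphism.

(** * Null octonions over a finite field *)

Lemma kernel_arith (c d p : nat) : (1 < p)%N -> (0 < c)%N -> (c + d = p ^ 8)%N ->
  (p * p ^ 8 + c.-1 * p ^ 8 = c * (p * c) + d * c)%N -> c = (p ^ 4)%N.
Proof.
move=> p1 c0 cd E; suff /eqP : (c * c = p ^ 4 * p ^ 4)%N.
  by rewrite !mulnn eqn_sqr => /eqP.
rewrite -expnD -[(4 + 4)%N]/8%N.
have : (p.-1 * (c * c) = p.-1 * p ^ 8)%N.
  move: cd E; move: (p ^ 8)%N => P cd; subst P.
  by case: c p p1 c0 => [//|x] [|[|q]] //=; nia.
move/eqP; rewrite eqn_pmul2l; last by rewrite -ltnS prednK // ltnW.
by move/eqP.
Qed.

Lemma null_arith (d p z : nat) : (0 < p)%N -> (p ^ 4 + d = p ^ 8)%N ->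
  (p * (p ^ 4 * z) = p ^ 4 * (p * p ^ 4) + d * p ^ 4)%N ->
  z = (1 + (p ^ 4 - 1) * (p ^ 3 + 1))%N.
Proof.
move=> p0; have q0 : (0 < p ^ 3)%N by rewrite expn_gt0 p0.
rewrite -[8%N]/(4 + 4)%N expnD !(expnS _ 3); move: (p ^ 3)%N q0 => q q0 E1 E2.
have {}E2 : (p * z = p * (p * q) + d)%N.
  have r0 : (0 < p * q)%N by rewrite muln_gt0 p0.
  by apply/eqP; rewrite -(eqn_pmul2l r0); apply/eqP; nia.
have dE : (d = (p * q) * (p * q) - p * q)%N by lia.
apply/eqP; rewrite -(eqn_pmul2l p0) E2 dE.
have r0 : (0 < p * q)%N by rewrite muln_gt0 p0.
by apply/eqP; nia.
Qed.

Section NullVectors.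
Local Opaque omul onorm obil oscale oconj.
Variable F : finFieldType.
Notation V := (oct F).
Notation p := #|F|.

Let pV : #|{: V}| = (p ^ 8)%N.
Proof. by rewrite !card_prod !expnSr expn0 mul1n. Qed.

(** Translation by the multiples of [k0] preserves [A] and shifts [f] by every scalar, so all fibres
    have equal size. *)
Lemma card_fiber (A : pred V) (f : V -> F) (k0 : V) (s : F) :
  (forall r x, A x -> A (x + oscale r k0)) ->
  (forall r x, f (x + oscale r k0) = f x + r * f k0) -> f k0 != 0 ->
  (p * \sum_(k | A k && (f k == s)) 1 = \sum_(k | A k) 1)%N.
Proof.
move=> HA Hf fk0.
have same t : (\sum_(k | A k && (f k == t)) 1 = \sum_(k | A k && (f k == s)) 1)%N.
  pose r := (t - s) / f k0.
  have K1 x : x + oscale r k0 + oscale (- r) k0 = x.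
    by rewrite -addrA -oscaleDl subrr oscale0l addr0.
  have K2 x : x + oscale (- r) k0 + oscale r k0 = x.
    by rewrite -addrA -oscaleDl addNr oscale0l addr0.
  rewrite (reindex (fun x : V => x + oscale r k0)) /=; last first.
    by apply: onW_bij; exists (fun x : V => x + oscale (- r) k0).
  apply: eq_bigl => x; rewrite Hf /r divfK //.
  have -> : (f x + (t - s) == t) = (f x == s).
    by rewrite -[in RHS](inj_eq (addIr (t - s))) [s + _]addrC subrK.
  case: (_ == _); rewrite ?andbF // !andbT.
  by apply/idP/idP => [/HA|/HA //]; rewrite -{2}(K1 x); exact.
rewrite [RHS](partition_big f predT) //=.
rewrite (eq_bigr _ (fun t _ => same t)). by rewrite [RHS]sum_nat_const.
Qed.

Section Kernel.
Variable b : V.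
Hypotheses (b0 : b != 0) (Nb : onorm b = 0).

Let K := [pred x : V | omul b x == 0].
Let c := (\sum_(x | K x) 1)%N.

Lemma null_kernel_isotropic x : omul b x = 0 -> onorm x = 0.
Proof.
move=> Kx; apply: contraNeq b0 => Nx.
have := omulCr x b; rewrite Kx omul0l => /(congr1 (oscale (onorm x)^-1)).
by rewrite oscale0 oscaleA mulVf // oscale1 => <-.
Qed.

Let K_isotropic x : K x -> onorm x = 0.
Proof. by move=> /eqP; exact: null_kernel_isotropic. Qed.

Let KD x y : K x -> K y -> K (x + y).
Proof. by move=> /eqP Kx /eqP Ky; rewrite /= omulDr Kx Ky addr0. Qed.

Let KZ r x : K x -> K (oscale r x).
Proof. by move=> /eqP Kx; rewrite /= omulZr Kx oscale0. Qed.

Let K_orth x y : K x -> K y -> obil x y = 0.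
Proof.
move=> Kx Ky; have := onormD x y.
by rewrite !K_isotropic ?KD // !add0r => <-.
Qed.

(** [K] contains every [omul (oconj b) y], because [b] times it is N(b) y = 0. By adjunction, an [x]
    orthogonal to all of these has [omul b x] orthogonal to every [y], hence zero. So [K] is its own
    orthogonal. *)
Let K_perp x : ~~ K x -> exists2 k, K k & obil x k != 0.
Proof.
move=> Kx.
have [/existsP[k /andP[Kk nz]]|] := boolP [exists k, K k && (obil x k != 0)].
  by exists k.
rewrite negb_exists => /forallP H; case/negP: Kx; apply/eqP/obil_nondeg => y.
rewrite obil_adj; have := H (omul (oconj b) y); rewrite negb_and negbK.
case/orP => [|/eqP //]; rewrite /=.
have := omulCl (oconj b) y; rewrite oconjK onorm_conj Nb oscale0l => ->.
by rewrite eqxx.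
Qed.

Let fiberK x s : ~~ K x -> (p * \sum_(k | K k && (obil x k == s)) 1 = c)%N.
Proof.
move=> Kx; have [k0 Kk0 nz] := K_perp Kx.
refine (@card_fiber K (obil x) k0 s _ _ nz) => [r y Ky|r y].
  exact: (KD Ky (KZ r Kk0)).
by rewrite obilDr obilZr.
Qed.

Let c_gt0 : (0 < c)%N.
Proof. by rewrite /c (bigD1 (0 : V)) //= omul0r. Qed.

Let d := (\sum_(x | ~~ K x) 1)%N.

Let cd : (c + d = p ^ 8)%N.
Proof. by rewrite /c /d -(bigID K predT) /= sum1_card pV. Qed.

Let sum_split (e1 e2 : nat) (G : V -> nat) :
  (forall x, K x -> G x = e1) -> (forall x, ~~ K x -> G x = e2) ->
  (\sum_x G x = c * e1 + d * e2)%N.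
Proof.
move=> H1 H2; rewrite (bigID K) /= (eq_bigr _ H1) [X in (_ + X)%N](eq_bigr _ H2).
by rewrite /c /d !big_distrl /=; congr (_ + _)%N; apply: eq_bigr => x _; rewrite mul1n.
Qed.

Let sum_orth x : (p * \sum_(k | K k && (obil x k == 0%R)) 1 = if K x then p * c else c)%N.
Proof.
case: ifPn => [Kx|/fiberK //]; congr (_ * _)%N; apply: eq_bigl => k.
by case Kk: (K k); rewrite //= K_orth ?eqxx.
Qed.

(** The orthogonal pairs in V x K, counted in both orders: this yields |K|^2 = |V| without any
    dimension theory. *)
Let S := (\sum_(x : V) \sum_(k | K k && (obil x k == 0%R)) 1)%N.

Let S1 : (p * S = c * (p * c) + d * c)%N.
Proof.
rewrite /S big_distrr; apply: sum_split => x Kx; first by rewrite /= sum_orth Kx.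
by rewrite /= sum_orth (negPf Kx).
Qed.

Let sum_obil k : k != 0 -> (p * \sum_(x : V | obil x k == 0%R) 1 = p ^ 8)%N.
Proof.
move=> k0.
have [x0 nz] : exists x, obil x k != 0.
  apply/existsP; apply: contraNT k0; rewrite negb_exists => /forallP H.
  by apply/eqP/obil_nondeg => y; rewrite obilC; have := H y; rewrite negbK => /eqP.
have fib := @card_fiber (fun=> true) (fun x => obil x k) x0 0 (fun _ _ _ => isT) _ nz.
rewrite fib ?sum1_card ?pV // => r x.
by rewrite obilDl obilZl.
Qed.

Let K0 : K 0.
Proof. by rewrite /= omul0r. Qed.

Let S2a : S = (\sum_(k | K k) \sum_(x : V | obil x k == 0%R) 1)%N.
Proof.
rewrite /S (exchange_big_dep K) => [|x k _ /andP[] //].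
by apply: eq_bigr => k Kk; apply: eq_bigl => x; rewrite Kk.
Qed.

Let S2b : (\sum_(x : V | obil x 0%R == 0%R) 1 = p ^ 8)%N.
Proof.
by rewrite -pV -sum1_card; apply: eq_bigl => x; rewrite obil0r eqxx.
Qed.

Let S2c : (\sum_(k | K k && (k != 0%R)) 1 = c.-1)%N.
Proof. by rewrite /c [in RHS](bigD1 (0 : V)). Qed.

Let S2 : (p * S = p * p ^ 8 + c.-1 * p ^ 8)%N.
Proof.
rewrite S2a (bigD1 (0 : V)) // mulnDr S2b -S2c; congr (_ + _)%N.
rewrite big_distrr big_distrl; apply: eq_bigr => k /andP[_ k0].
by rewrite [RHS]mul1n; exact: sum_obil.
Qed.

Let cE : c = (p ^ 4)%N.
Proof.
have p1 := card_finNzRing_gt1 F.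
by apply: (kernel_arith p1 c_gt0 cd); rewrite -S1 -S2.
Qed.

Lemma card_null_kernel : (\sum_(x | omul b x == 0%R) 1 = p ^ 4)%N.
Proof. exact: cE. Qed.

Let z := (\sum_(x : V | onorm x == 0%R) 1)%N.

(** Pairs (x, k) with [x + k] null: for fixed [k] translation gives all null vectors, while for
    fixed [x] outside [K] the map k -> N(x + k) = N(x) + obil x k is equidistributed. *)
Let E1 : (p * (c * z) = p * \sum_(x : V) \sum_(k | K k && (onorm (x + k)%R == 0%R)) 1)%N.
Proof.
congr (_ * _)%N; rewrite (exchange_big_dep K) => [|x k _ /andP[] //].
rewrite /c big_distrl; apply: eq_bigr => k Kk; rewrite [LHS]mul1n /z.
rewrite (reindex (fun x : V => x + k)); last first.
  by apply: onW_bij; exists (fun x : V => x - k) => x; rewrite ?addrK ?subrK.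
by apply: eq_bigl => x; rewrite Kk.
Qed.

Let E2 x : (p * \sum_(k | K k && (onorm (x + k)%R == 0%R)) 1 =
  if K x then p * c else c)%N.
Proof.
case: ifPn => [Kx|nKx].
  congr (_ * _)%N; apply: eq_bigl => k; case Kk: (K k) => //=.
  by rewrite (K_isotropic (KD Kx Kk)) eqxx.
rewrite -(fiberK (- onorm x) nKx); congr (_ * _)%N; apply: eq_bigl => k.
case Kk: (K k) => //=; rewrite onormD (K_isotropic Kk) addr0.
by rewrite -addr_eq0 addrC.
Qed.

Lemma card_null :
  (\sum_(x : V | onorm x == 0%R) 1 = 1 + (p ^ 4 - 1) * (p ^ 3 + 1))%N.
Proof.
have E3 : (p * (c * z) = c * (p * c) + d * c)%N.
  rewrite E1 big_distrr; apply: sum_split => x Kx; have := E2 x.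
    by rewrite Kx.
  by rewrite (negPf Kx).
have := cd; move: E3; rewrite cE => E3 E4.
exact: null_arith (ltnW (card_finNzRing_gt1 F)) E4 E3.
Qed.

Lemma card_null_nz :
  (\sum_(x : V | (x != 0%R) && (onorm x == 0%R)) 1 = (p ^ 4 - 1) * (p ^ 3 + 1))%N.
Proof.
have := card_null; rewrite (bigD1 (0 : V)); last by rewrite onorm0.
by move=> /(@addnI 1) <-; apply: eq_bigl => x; rewrite andbC.
Qed.

Lemma card_null_kernel_nz :
  (\sum_(x : V | (x != 0%R) && (onorm x == 0%R) && (omul b x == 0%R)) 1 = p ^ 4 - 1)%N.
Proof.
have := card_null_kernel; rewrite (bigD1 (0 : V)); last by rewrite omul0r eqxx.
move=> E; rewrite -E [RHS](addKn 1); apply: eq_bigl => x.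
case Kx: (omul b x == 0); rewrite ?andbF // andbT /=.
by rewrite (null_kernel_isotropic (eqP Kx)) eqxx andbT.
Qed.

End Kernel.
End NullVectors.

(** * Octonions of prime norm *)

Section PrimeShell.
Variable p : nat.
Hypothesis p_pr : prime p.

Lemma intr_Fp_eq0 (n : int) : (n%:~R == 0 :> 'F_p) = (p %| n)%Z.
Proof.
have chF : p \in [pchar 'F_p] := pchar_Fp p_pr.
case: n => n; first by rewrite -pmulrn -(dvdn_pcharf chF).
by rewrite NegzE mulrNz oppr_eq0 -pmulrn -(dvdn_pcharf chF) dvdzE.
Qed.

Definition octmod (x : oct int) : oct 'F_p := omap intr x.

Lemma octmodM x y : octmod (omul x y) = omul (octmod x) (octmod y).
Proof. exact: omapM. Qed.

Lemma onorm_octmod x : onorm (octmod x) = (onorm x)%:~R.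
Proof. exact: onorm_map. Qed.

Lemma octmod_eq0 x : octmod x = 0 <-> odvd p%:Z x.
Proof.
split=> [|[[[[[[[[y0 y1] y2] y3] y4] y5] y6] y7] ->]]; last first.
  have E (y : int) : (p%:Z * y)%:~R = 0 :> 'F_p.
    by apply/eqP; rewrite intr_Fp_eq0 dvdz_mulr.
  by rewrite /octmod /omap /oscale !E.
move: x => [[[[[[[x0 x1] x2] x3] x4] x5] x6] x7] [].
have D (y : int) : y%:~R = 0 :> 'F_p -> exists q, y = p%:Z * q.
  by move/eqP; rewrite intr_Fp_eq0 => /dvdzP[q ->]; exists q; rewrite mulrC.
move=> /D[y0 ->] /D[y1 ->] /D[y2 ->] /D[y3 ->] /D[y4 ->] /D[y5 ->] /D[y6 ->] /D[y7 ->].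
by exists (y0, y1, y2, y3, y4, y5, y6, y7).
Qed.

Lemma octmod_surj (x : oct 'F_p) : exists y, octmod y = x.
Proof.
move: x => [[[[[[[x0 x1] x2] x3] x4] x5] x6] x7].
have E (y : 'F_p) : (nat_of_ord y)%:Z%:~R = y by rewrite -pmulrn; exact: natr_Zp.
exists ((nat_of_ord x0)%:Z, (nat_of_ord x1)%:Z, (nat_of_ord x2)%:Z, (nat_of_ord x3)%:Z,
  (nat_of_ord x4)%:Z, (nat_of_ord x5)%:Z, (nat_of_ord x6)%:Z, (nat_of_ord x7)%:Z).
by rewrite /octmod /omap !E.
Qed.

Lemma octmodD x y : octmod (x + y) = octmod x + octmod y.
Proof.
move: x y => [[[[[[[? ?] ?] ?] ?] ?] ?] ?] [[[[[[[? ?] ?] ?] ?] ?] ?] ?].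
by rewrite oct_addE /octmod /omap !rmorphD.
Qed.

Lemma onorm_isotropic2 (R : comNzRingType) (a b : R) :
  onorm (a, b, 1, 0, 0, 0, 0, 0) = a ^+ 2 + b ^+ 2 + 1.
Proof. by rewrite /onorm; ring. Qed.

Local Opaque omul onorm obil oscale oconj.

(** The case [k = 1] of [left_ideal_count]: in a left ideal whose norms are all divisible by [p],
    the elements of norm [p] correspond to the units. *)
Lemma count_left_divisors (x : oct int) :
  ~ odvd p%:Z x -> (p %| onorm x)%Z ->
  ocount p (fun b => odvd p%:Z (omul b x)) = ocount 1 (fun=> True).
Proof.
move=> ndvd /dvdzP[n Nx].
have p0 : p%:Z != 0 by rewrite eqz_nat -lt0n prime_gt0.
have [t nb] : exists t, ~~ (p %| obil x t)%Z.
  have : octmod x != 0 by apply/eqP => /octmod_eq0.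
  apply: contraNP => /forallNP H; apply/eqP/obil_nondeg => b.
  have [t <-] := octmod_surj b.
  have -> : obil (octmod x) (octmod t) = (obil x t)%:~R.
    have := onormD (octmod x) (octmod t); have := onormD x t.
    rewrite -octmodD.
    by rewrite !onorm_octmod => ->; rewrite !rmorphD /= => /addrI ->.
  by apply/eqP; rewrite intr_Fp_eq0; apply/negP => /negP; exact: H.
(* Translating [x] by [p t] we may assume that [p ^ 2] does not divide its norm. *)
have [x' [t' ->] [m Nx' ndm]] : exists2 x', exists t', x' = x + oscale p%:Z t' &
    exists2 m, onorm x' = p%:Z * m & ~~ (p %| m)%Z.
  have [dn|ndn] := boolP (p %| n)%Z; last first.
    exists (x + oscale p%:Z 0); first by exists 0.
    by exists n; rewrite // oscale0 addr0 Nx mulrC.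
  exists (x + oscale p%:Z t); first by exists t.
  exists (n + p%:Z * onorm t + obil x t).
    by rewrite onormD onormZ obilZr Nx; ring.
  by rewrite rpredDl // rpredD // dvdz_mulr.
have -> : ocount p (fun b => odvd p%:Z (omul b x)) =
  ocount (p * 1)%N (fun b => odvd p%:Z (omul b (x + oscale p%:Z t'))).
  by rewrite muln1; apply: ocount_eq => b _; apply: iff_sym; exact: odvd_mulDr.
apply: left_ideal_count; rewrite ?prime_gt0 //; first by exists m.
move=> b [y] /(congr1 (@onorm int)); rewrite onormM onormZ Nx' => E.
have {}E : onorm b * m = p%:Z * onorm y by apply: (mulfI p0); rewrite mulrCA E; ring.
have : (p %| onorm b * m)%Z by rewrite E dvdz_mulr.
rewrite !dvdzE abszM Euclid_dvdM // => /orP[|]; last by rewrite -dvdzE (negPf ndm).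
by rewrite -dvdzE => /dvdzP[q ->]; exists q; rewrite mulrC.
Qed.

Lemma octmod_shell b : onorm b = p%:Z -> octmod b != 0 /\ onorm (octmod b) = 0.
Proof.
move=> Nb; split; last by rewrite onorm_octmod Nb; apply/eqP; rewrite intr_Fp_eq0.
apply/eqP => /octmod_eq0[y] E; move: Nb; rewrite E onormZ expr2 -mulrA -[RHS]mulr1.
have p0 : p%:Z != 0 by rewrite eqz_nat -lt0n prime_gt0.
move/(mulfI p0) => E1; have : (p %| 1)%Z.
  by apply/dvdzP; exists (onorm y); rewrite mulrC E1.
by rewrite dvdz1 => /eqP /= p1; move: p_pr; rewrite p1.
Qed.

(** A solution of a^2 + b^2 = -1 is enough. Among p = 2h + 1 residues, the h + 1 squares meet the h
    + 1 values -1 - b^2. *)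
Lemma null_vector_exists : odd p -> exists2 x : oct 'F_p, x != 0 & onorm x = 0.
Proof.
move=> odd_p; pose h := p./2.
have pE : p = (h + h).+1.
  by rewrite -[LHS](odd_double_half p) odd_p addnn.
pose sq (i : 'I_h.+1) : 'F_p := i%:R ^+ 2.
have small (i j : 'I_h.+1) : (i + j)%:R = 0 :> 'F_p -> (i + j = 0)%N.
  move/eqP; rewrite -(dvdn_pcharf (pchar_Fp p_pr)) => /dvdnP[[|k] E] //.
  by case: i j E => [i /= Hi] [j /= Hj]; rewrite {1}pE; nia.
have sq_inj : injective sq.
  move=> i j /eqP; rewrite eqf_sqr => /orP[] /eqP E; apply: val_inj => /=.
    apply/eqP; wlog le : i j E / (i <= j)%N.
      by move=> H; case/orP: (leq_total i j) => ?; [exact: H | rewrite eq_sym; exact: H].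
    have : (j - i)%:R = 0 :> 'F_p by rewrite natrB // E subrr.
    move/eqP; rewrite -(dvdn_pcharf (pchar_Fp p_pr)) => /dvdnP[[|k] E2]; first by lia.
    by case: i j E2 {E le} => [i /= Hi] [j /= Hj]; rewrite {1}pE; nia.
  have := small i j; rewrite natrD E addNr => /(_ erefl).
  by lia.
have [[i j] E] : exists ij : 'I_h.+1 * 'I_h.+1, sq ij.1 = - 1 - sq ij.2.
  apply: contrapT => /forallNP H.
  pose f (s : 'I_h.+1 + 'I_h.+1) := match s with inl i => sq i | inr j => -1 - sq j end.
  have : injective f.
    case=> i [] j /=; first by move/sq_inj ->.
    - by move=> E; case: (H (i, j)).
    - by move=> E; case: (H (j, i)).
    - by move/addrI/oppr_inj/sq_inj ->.
  by move/leq_card; rewrite card_sum !card_ord Fp_cast // => le; move: pE le; lia.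
exists (i%:R, j%:R, 1, 0, 0, 0, 0, 0).
  by apply/eqP => -[] _ _ /eqP; rewrite oner_eq0.
by rewrite onorm_isotropic2; move: E; rewrite /sq /= => ->; ring.
Qed.

(** Double count of the pairs of [b] of norm [p] and nonzero null [x] mod [p] with b x = 0: each [b]
    annihilates p^4 - 1 vectors, and each of the (p^4 - 1)(p^3 + 1) vectors [x] is annihilated by as
    many [b] as there are units. *)
Lemma count_prime_shell : odd p ->
  ocount p (fun=> True) = (ocount 1 (fun=> True) * (p ^ 3 + 1))%N.
Proof.
move=> odd_p.
have cardF : #|'F_p| = p by rewrite card_Fp.
pose Q (x : oct 'F_p) := (x != 0) && (onorm x == 0).
have cQ : (\sum_(x | Q x) 1 = (p ^ 4 - 1) * (p ^ 3 + 1))%N.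
  have [b b0 Nb] := null_vector_exists odd_p.
  by rewrite -[in RHS]cardF; exact: (card_null_nz b0 Nb).
pose S := (\sum_(b <- oshell p) \sum_(x | Q x && (omul (octmod b) x == 0%R)) 1)%N.
have S1 : S = (ocount p (fun=> True) * (p ^ 4 - 1))%N.
  rewrite /S /ocount big_distrl /=.
  have T : `[< True >] by exact/asboolP.
  rewrite [RHS](eq_bigl xpredT) => [|b]; last exact: T.
  apply: eq_big_seq => b; rewrite mem_oshell => /eqP Nb.
  have [b0 Nb0] := octmod_shell Nb.
  by rewrite mul1n -[in RHS]cardF; exact: (card_null_kernel_nz b0 Nb0).
have S2 : S = (ocount 1 (fun=> True) * ((p ^ 4 - 1) * (p ^ 3 + 1)))%N.
  rewrite /S -cQ (exchange_big_dep Q) => [|b x _ /andP[] //].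
  rewrite mulnC big_distrl; apply: eq_bigr => x /andP[x0 /eqP Nx]; rewrite [RHS]mul1n.
  have [y yE] := octmod_surj x; rewrite -(@count_left_divisors y).
  - rewrite /ocount; apply: eq_bigl => b; rewrite /Q x0 Nx eqxx /= -yE -octmodM.
    by apply/eqP/asboolP => /octmod_eq0.
  - by move/octmod_eq0; rewrite yE; exact/eqP.
  - by rewrite -intr_Fp_eq0 -onorm_octmod yE Nx.
have p4 : (0 < p ^ 4 - 1)%N by rewrite subn_gt0 -(exp1n 4) ltn_exp2r // prime_gt1.
by apply/eqP; rewrite -(eqn_pmul2r p4) -S1 S2 -mulnA [((p ^ 4 - 1) * _)%N]mulnC.
Qed.

End PrimeShell.

(** * An octic harmonic sum over E8 and its Hecke relations *)

Definition oprod (c : oct int) : int := \prod_i toX c i.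

(** Coefficients of the theta series of E8 weighted by the harmonic octic x_0 ... x_7, a cusp form
    of weight 4 + 8 = 12; this is why a multiple of [tau] is to be expected. *)
Definition shell_sum (n : nat) : int := \sum_(c <- oshell n) oprod c.

Lemma oprodZ k c : oprod (oscale k c) = k ^+ 8 * oprod c.
Proof.
have -> : k ^+ 8 = \prod_(i < 8) k by rewrite prodr_const card_ord.
rewrite /oprod -big_split /=; apply: eq_bigr => i _.
move: c i => [[[[[[[a0 a1] a2] a3] a4] a5] a6] a7].
by apply: forall_ord8; rewrite !ffunE /=; ring.
Qed.

Section HeckeCount.
Local Opaque omul onorm obil oscale oconj.
Variable p : nat.
Hypotheses (p_pr : prime p) (p_odd : odd p).

Let p0 : p%:Z != 0.
Proof. by rewrite eqz_nat -lt0n prime_gt0. Qed.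

Let units := ocount 1 (fun=> True).

Lemma sum_left_multiples (a : oct int) n : onorm a = p%:Z ->
  \sum_(y <- oshell n) oprod (omul a y) =
  \sum_(x <- oshell (p * n) | `[< odvd p%:Z (omul (oconj a) x) >]) oprod x.
Proof.
move=> Na; rewrite -[RHS]big_filter.
have aK y : omul (oconj a) (omul a y) = oscale p%:Z y by rewrite omulCl Na.
have Hp : perm_eq (map (omul a) (oshell n))
  [seq x <- oshell (p * n) | `[< odvd p%:Z (omul (oconj a) x) >]].
  apply: uniq_perm; rewrite ?filter_uniq ?uniq_oshell //.
    rewrite map_inj_uniq ?uniq_oshell // => x y E.
    by apply: (oscale_inj p0); rewrite -!aK E.
  move=> x; rewrite mem_filter mem_oshell; apply/mapP/andP => [[y]|[/asboolP[y E] /eqP Nx]].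
    rewrite mem_oshell => /eqP Ny ->; rewrite onormM Na Ny PoszM eqxx; split=> //.
    by apply/asboolP; exists y.
  have xE : x = omul a y.
    apply: (oscale_inj p0); rewrite -omulZr -E.
    by have := omulCl (oconj a) x; rewrite oconjK onorm_conj Na.
  exists y => //; rewrite mem_oshell; apply/eqP/(mulfI p0).
  by rewrite -{1}Na -onormM -xE Nx PoszM.
by rewrite -(perm_big _ Hp) [RHS]big_map.
Qed.

Lemma count_conj (x : oct int) :
  (\sum_(a <- oshell p | `[< odvd p%:Z (omul (oconj a) x) >]) 1)%N =
  ocount p (fun b => odvd p%:Z (omul b x)).
Proof.
rewrite -[LHS]/(ocount p (fun a => odvd p%:Z (omul (oconj a) x))).
apply: (@ocount_bij _ _ _ _ (@oconj int) (@oconj int)) => b Nb H.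
  by rewrite onorm_conj oconjK.
by rewrite onorm_conj !oconjK.
Qed.

Lemma sum_multiples n :
  \sum_(x <- oshell (p * n) | `[< odvd p%:Z x >]) oprod x =
  if (p %| n)%N then p%:Z ^+ 8 * shell_sum (n %/ p) else 0.
Proof.
case: ifPn => [/dvdnP[m ->]|ndvd]; last first.
  rewrite big_seq_cond big1 // => x /andP[]; rewrite mem_oshell => /eqP Nx.
  move=> /asboolP[y E]; case/negP: ndvd; move: Nx; rewrite E onormZ PoszM expr2 -mulrA.
  by move/(mulfI p0) => ny; have : (p%:Z %| n%:Z)%Z by rewrite -ny dvdz_mulr.
rewrite mulnK ?prime_gt0 // -[LHS]big_filter /shell_sum big_distrr /=.
have Hp : perm_eq (map (oscale p%:Z) (oshell m))
  [seq x <- oshell (p * (m * p)) | `[< odvd p%:Z x >]].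
  apply: uniq_perm; rewrite ?filter_uniq ?uniq_oshell //.
    by rewrite map_inj_uniq ?uniq_oshell //; exact: oscale_inj.
  move=> x; rewrite mem_filter mem_oshell; apply/mapP/andP => [[y]|[/asboolP[y E] /eqP Nx]].
    rewrite mem_oshell => /eqP Ny ->; rewrite onormZ Ny; split.
      by apply/asboolP; exists y.
    by apply/eqP; rewrite !PoszM; ring.
  exists y => //; rewrite mem_oshell; apply/eqP/(mulfI p0)/(mulfI p0).
  by move: Nx; rewrite E onormZ !PoszM expr2 -mulrA => ->; ring.
by rewrite -(perm_big _ Hp) [LHS]big_map; apply: eq_bigr => y _; exact: oprodZ.
Qed.

(** An [x] of norm [p n] is counted once for each left factor [a] of norm [p]: [units] times if [p]
    does not divide [x], and [units (p^3 + 1)] times if it does. The surplus p^3 and the degree 8 of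
    [oprod] make up p^11. *)
Lemma hecke_count n :
  \sum_(a <- oshell p) \sum_(y <- oshell n) oprod (omul a y) =
  units%:Z * (shell_sum (p * n) +
    if (p %| n)%N then p%:Z ^+ 11 * shell_sum (n %/ p) else 0).
Proof.
transitivity (\sum_(a <- oshell p)
  \sum_(x <- oshell (p * n) | `[< odvd p%:Z (omul (oconj a) x) >]) oprod x).
  by apply: eq_big_seq => a; rewrite mem_oshell => /eqP Na; exact: sum_left_multiples.
rewrite (exchange_big_dep predT) //=.
transitivity (\sum_(x <- oshell (p * n))
  (units%:Z * oprod x + (units * p ^ 3)%:Z * (if `[< odvd p%:Z x >] then oprod x else 0))).
  apply: eq_big_seq => x; rewrite mem_oshell => /eqP Nx.
  rewrite (eq_bigr (fun=> (1%N)%:Z * oprod x)) => [|a _]; last by rewrite mul1r.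
  rewrite -big_distrl /= -[X in X * _](big_morph Posz PoszD (erefl _)) count_conj.
  case: asboolP => [[y ->]|ndvd]; last first.
    rewrite mulr0 addr0 /units -(count_left_divisors p_pr ndvd) // Nx.
    by rewrite PoszM dvdz_mulr.
  rewrite -mulrDl; congr (_ * _); rewrite -PoszD; congr Posz.
  transitivity (ocount p (fun=> True)).
    by apply: ocount_eq => b _; split=> // _; rewrite omulZr; exists (omul b y).
  by rewrite count_prime_shell // mulnDr muln1 addnC.
rewrite big_split /= -!big_distrr /= -big_mkcond sum_multiples mulrDr; congr (_ + _).
case: ifP => _; last by rewrite !mulr0.
have -> : (units * p ^ 3)%:Z = units%:Z * p%:Z ^+ 3.
  by rewrite PoszM -[(p ^ 3)%N%:Z]natz natrX natz.
by rewrite (exprD _ 3 8) !mulrA.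
Qed.

End HeckeCount.

(** * Degree 8 moments of the shells of E8 *)

Definition E8moment (n : nat) (f : {ffun 'I_8 -> int} -> int) : int :=
  \sum_(X <- shellX n) f X.

Lemma E8moment_sym n (g h : {ffun 'I_8 -> int} -> {ffun 'I_8 -> int}) f :
  {in shellX n, forall X, g X \in shellX n} ->
  {in shellX n, forall X, h X \in shellX n} ->
  {in shellX n, cancel g h} -> {in shellX n, cancel h g} ->
  E8moment n (f \o g) = E8moment n f.
Proof.
move=> Hg Hh gK hK.
have Hp : perm_eq (map g (shellX n)) (shellX n).
  apply: uniq_perm; rewrite ?filter_uniq ?uniq_box //.
    by rewrite map_inj_in_uniq ?filter_uniq ?uniq_box //; exact: can_in_inj gK.
  move=> X; apply/mapP/idP => [[Y HY ->]|HX]; first exact: Hg.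
  by exists (h X); [exact: Hh | rewrite hK].
by rewrite /E8moment -[RHS](perm_big _ Hp) big_map.
Qed.

Lemma E8moment_eq n f g : {in shellX n, f =1 g} -> E8moment n f = E8moment n g.
Proof. by move=> H; apply: eq_big_seq. Qed.

Lemma shellX_parity n X i j : X \in shellX n -> (2 %| X i + X j)%Z.
Proof.
rewrite mem_shellX => /andP[/andP[/forallP H _] _].
by move: (H i) (H j); move: (X i) (X j) (X 'i 0) => x y z; lia.
Qed.

Section CoordinatePermutation.
Variable s : {perm 'I_8}.

Definition permX (X : {ffun 'I_8 -> int}) : {ffun 'I_8 -> int} := [ffun i => X (s i)].

Lemma permX_shell n X : X \in shellX n -> permX X \in shellX n.
Proof.
move=> HX; have par := shellX_parity _ _ HX; move: HX; rewrite !mem_shellX.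
move=> /andP[/andP[_ H2] /eqP H3]; apply/andP; split; last first.
  rewrite -H3 [X in _ == X](reindex_inj (@perm_inj _ s)).
  by apply/eqP/eq_bigr => i _; rewrite ffunE.
apply/andP; split.
  apply/forallP => i; rewrite !ffunE; have := par (s i) (s 'i 0).
  by move: (X (s i)) (X (s 'i 0)) => x y; lia.
move: H2; rewrite (reindex_inj (@perm_inj _ s)) /=.
by under [X in _ -> (_ %| X)%Z]eq_bigr do rewrite ffunE.
Qed.
End CoordinatePermutation.

Definition mono (e : {ffun 'I_8 -> nat}) (X : {ffun 'I_8 -> int}) : int :=
  \prod_i X i ^+ e i.

Lemma moment_perm n (e : {ffun 'I_8 -> nat}) (s : {perm 'I_8}) :
  E8moment n (mono [ffun i => e (s i)]) = E8moment n (mono e).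
Proof.
rewrite -[RHS](@E8moment_sym n (permX s^-1) (permX s)) => [|X|X|X _|X _].
- apply: E8moment_eq => X _; rewrite /= /mono [RHS](reindex_inj (@perm_inj _ s)).
  by apply: eq_bigr => i _; rewrite !ffunE permK.
- exact: permX_shell.
- exact: permX_shell.
- by apply/ffunP => i; rewrite !ffunE permK.
- by apply/ffunP => i; rewrite !ffunE permKV.
Qed.

Definition flipX (i j : 'I_8) (X : {ffun 'I_8 -> int}) : {ffun 'I_8 -> int} :=
  [ffun k => if (k == i) || (k == j) then - X k else X k].

Lemma flipX_shell n i j X : i != j -> X \in shellX n -> flipX i j X \in shellX n.
Proof.
move=> ij HX; have par := shellX_parity _ _ HX; move: HX; rewrite !mem_shellX.
move=> /andP[/andP[_ H2] /eqP H3]; apply/andP; split; last first.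
  by rewrite -H3; apply/eqP/eq_bigr => k _; rewrite ffunE; case: ifP; rewrite ?sqrrN.
apply/andP; split.
  apply/forallP => k; rewrite !ffunE; have := par k 'i 0.
  by move: (X k) (X 'i 0) => x y; do 2!case: ifP => _; lia.
have -> : \sum_k flipX i j X k = \sum_k X k - (X i + X j) *+ 2.
  rewrite (bigD1 i) // (bigD1 j) 1?eq_sym //= [in RHS](bigD1 i) // [in RHS](bigD1 j) 1?eq_sym //=.
  rewrite !ffunE !eqxx orbT /= (eq_bigr X) => [|k /andP[ki kj]]; last first.
    by rewrite ffunE (negPf ki) (negPf kj).
  by ring.
have := par i j; move: (X i + X j) (\sum_k X k) H2 => x y; lia.
Qed.

(** Negating the coordinates [i] and [j] together preserves the shell and negates the monomial. *)
Lemma moment_odd n (e : {ffun 'I_8 -> nat}) i j : odd (e i) -> ~~ odd (e j) ->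
  E8moment n (mono e) = 0.
Proof.
move=> ei ej; have ij : i != j by apply: contraNneq ej => <-.
have flipK X : flipX i j (flipX i j X) = X.
  by apply/ffunP => k; rewrite !ffunE; case: (_ || _); rewrite ?opprK.
suff : E8moment n (mono e) = - E8moment n (mono e) by lia.
rewrite -{1}(@E8moment_sym n (flipX i j) (flipX i j)) => [|X|X|X _|X _];
  do ?exact: flipX_shell; do ?exact: flipK.
rewrite -[RHS]sumrN; apply: eq_bigr => X _; rewrite /= /mono.
rewrite (bigD1 i) // (bigD1 j) 1?eq_sym //= [in RHS](bigD1 i) // [in RHS](bigD1 j) 1?eq_sym //=.
rewrite !ffunE !eqxx orbT /= (eq_bigr (fun k => X k ^+ e k)) => [|k /andP[ki kj]]; last first.
  by rewrite ffunE (negPf ki) (negPf kj).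
by rewrite (exprNn (X i)) (exprNn (X j)) -(signr_odd _ (e i)) -(signr_odd _ (e j)) ei (negPf ej);
  ring.
Qed.

(** Half of a 4 x 4 Hadamard matrix on each block of four coordinates. It is a symmetry of E8 that
    is not a signed permutation, and the source of every relation between moments of different
    types. *)
Definition hadX (X : {ffun 'I_8 -> int}) : {ffun 'I_8 -> int} :=
  let x i := X i in
  [ffun i : 'I_8 => nth 0
    [:: ((x 'i 0 + x 'i 1 + x 'i 2 + x 'i 3) %/ 2)%Z;
        ((x 'i 0 + x 'i 1 - x 'i 2 - x 'i 3) %/ 2)%Z;
        ((x 'i 0 - x 'i 1 + x 'i 2 - x 'i 3) %/ 2)%Z;
        ((x 'i 0 - x 'i 1 - x 'i 2 + x 'i 3) %/ 2)%Z;
        ((x 'i 4 + x 'i 5 + x 'i 6 + x 'i 7) %/ 2)%Z;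
        ((x 'i 4 + x 'i 5 - x 'i 6 - x 'i 7) %/ 2)%Z;
        ((x 'i 4 - x 'i 5 + x 'i 6 - x 'i 7) %/ 2)%Z;
        ((x 'i 4 - x 'i 5 - x 'i 6 + x 'i 7) %/ 2)%Z] i].

Lemma hadXE X : inE8 X ->
  [/\ 2 * hadX X 'i 0 = X 'i 0 + X 'i 1 + X 'i 2 + X 'i 3,
      2 * hadX X 'i 1 = X 'i 0 + X 'i 1 - X 'i 2 - X 'i 3,
      2 * hadX X 'i 2 = X 'i 0 - X 'i 1 + X 'i 2 - X 'i 3 &
      2 * hadX X 'i 3 = X 'i 0 - X 'i 1 - X 'i 2 + X 'i 3] /\
  [/\ 2 * hadX X 'i 4 = X 'i 4 + X 'i 5 + X 'i 6 + X 'i 7,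
      2 * hadX X 'i 5 = X 'i 4 + X 'i 5 - X 'i 6 - X 'i 7,
      2 * hadX X 'i 6 = X 'i 4 - X 'i 5 + X 'i 6 - X 'i 7 &
      2 * hadX X 'i 7 = X 'i 4 - X 'i 5 - X 'i 6 + X 'i 7].
Proof.
case/andP=> /forallP H _.
move: (H 'i 1) (H 'i 2) (H 'i 3) (H 'i 4) (H 'i 5) (H 'i 6) (H 'i 7).
rewrite /hadX !ffunE /=.
move: (X 'i 0) (X 'i 1) (X 'i 2) (X 'i 3) (X 'i 4) (X 'i 5) (X 'i 6) (X 'i 7).
by move=> x0 x1 x2 x3 x4 x5 x6 x7 *; do 2!split; lia.
Qed.

Lemma hadX_inE8 X : inE8 X -> inE8 (hadX X).
Proof.
move=> HX; have [[E0 E1 E2 E3] [E4 E5 E6 E7]] := hadXE HX.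
case/andP: HX => /forallP H; rewrite big_ord8 /= => HS.
move: (H 'i 1) (H 'i 2) (H 'i 3) (H 'i 4) (H 'i 5) (H 'i 6) (H 'i 7).
move: HS E0 E1 E2 E3 E4 E5 E6 E7; rewrite /inE8 big_ord8 /=; move: (hadX X) => Y.
move=> HS E0 E1 E2 E3 E4 E5 E6 E7 P1 P2 P3 P4 P5 P6 P7.
apply/andP; split; last first.
  move: HS E0 E1 E2 E3 E4 E5 E6 E7 P1 P2 P3 P4 P5 P6 P7.
  move: (X 'i 0) (X 'i 1) (X 'i 2) (X 'i 3) (X 'i 4) (X 'i 5) (X 'i 6) (X 'i 7).
  move: (Y 'i 0) (Y 'i 1) (Y 'i 2) (Y 'i 3) (Y 'i 4) (Y 'i 5) (Y 'i 6) (Y 'i 7).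
  by lia.
apply/forallP; apply: forall_ord8;
  move: HS E0 E1 E2 E3 E4 E5 E6 E7 P1 P2 P3 P4 P5 P6 P7;
  move: (X 'i 0) (X 'i 1) (X 'i 2) (X 'i 3) (X 'i 4) (X 'i 5) (X 'i 6) (X 'i 7);
  move: (Y 'i 0) (Y 'i 1) (Y 'i 2) (Y 'i 3) (Y 'i 4) (Y 'i 5) (Y 'i 6) (Y 'i 7); lia.
Qed.

Lemma hadXK X : inE8 X -> hadX (hadX X) = X.
Proof.
move=> HX; have [[E0 E1 E2 E3] [E4 E5 E6 E7]] := hadXE HX.
have [[F0 F1 F2 F3] [F4 F5 F6 F7]] := hadXE (hadX_inE8 HX).
move: (hadX X) (hadX (hadX X)) E0 E1 E2 E3 E4 E5 E6 E7 F0 F1 F2 F3 F4 F5 F6 F7 => Y Z.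
move=> E0 E1 E2 E3 E4 E5 E6 E7 F0 F1 F2 F3 F4 F5 F6 F7.
by apply/ffunP; apply: forall_ord8;
  move: E0 E1 E2 E3 E4 E5 E6 E7 F0 F1 F2 F3 F4 F5 F6 F7;
  move: (X 'i 0) (X 'i 1) (X 'i 2) (X 'i 3) (X 'i 4) (X 'i 5) (X 'i 6) (X 'i 7);
  move: (Y 'i 0) (Y 'i 1) (Y 'i 2) (Y 'i 3) (Y 'i 4) (Y 'i 5) (Y 'i 6) (Y 'i 7);
  move: (Z 'i 0) (Z 'i 1) (Z 'i 2) (Z 'i 3) (Z 'i 4) (Z 'i 5) (Z 'i 6) (Z 'i 7);
  lia.
Qed.

Lemma hadX_norm X : inE8 X -> \sum_i hadX X i ^+ 2 = \sum_i X i ^+ 2.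
Proof.
move=> HX; have [[E0 E1 E2 E3] [E4 E5 E6 E7]] := hadXE HX.
move: (hadX X) E0 E1 E2 E3 E4 E5 E6 E7 => Y E0 E1 E2 E3 E4 E5 E6 E7.
apply: (@mulfI _ 4) => //; rewrite !big_ord8 /=.
transitivity ((2 * Y 'i 0) ^+ 2 + (2 * Y 'i 1) ^+ 2 + (2 * Y 'i 2) ^+ 2 +
  (2 * Y 'i 3) ^+ 2 + (2 * Y 'i 4) ^+ 2 + (2 * Y 'i 5) ^+ 2 +
  (2 * Y 'i 6) ^+ 2 + (2 * Y 'i 7) ^+ 2); first by ring.
by rewrite E0 E1 E2 E3 E4 E5 E6 E7; ring.
Qed.

Lemma moment_had n f : E8moment n (f \o hadX) = E8moment n f.
Proof.
have Hs : {in shellX n, forall X, hadX X \in shellX n}.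
  move=> X; rewrite !mem_shellX => /andP[HX /eqP NX].
  by rewrite hadX_inE8 // hadX_norm // NX eqxx.
have HK : {in shellX n, cancel hadX hadX}.
  by move=> X; rewrite mem_shellX => /andP[HX _]; exact: hadXK.
exact: (E8moment_sym f Hs Hs HK HK).
Qed.

Definition lmono (l : seq nat) (X : {ffun 'I_8 -> int}) : int :=
  \prod_(i < 8) X i ^+ nth 0%N l i.

(* A polynomial in eight variables is a list of pairs (coefficient, exponents). *)
Definition peval (P : seq (int * seq nat)) (X : {ffun 'I_8 -> int}) : int :=
  \sum_(t <- P) t.1 * lmono t.2 X.

Definition pmul (P Q : seq (int * seq nat)) : seq (int * seq nat) :=
  flatten [seq [seq (t.1 * u.1, [seq (nth 0 t.2 i + nth 0 u.2 i)%N | i <- iota 0 8])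
    | u <- Q] | t <- P].

Lemma peval_mul P Q X : peval (pmul P Q) X = peval P X * peval Q X.
Proof.
rewrite /peval /pmul big_flatten /= big_map big_distrl /=; apply: eq_bigr => t _.
rewrite big_map big_distrr /=; apply: eq_bigr => u _ /=.
rewrite mulrACA; congr (_ * _); rewrite /lmono -big_split /=; apply: eq_bigr => i _.
by rewrite -exprD; congr (_ ^+ _); move: i; apply: forall_ord8.
Qed.

Lemma E8moment_lmono_perm n (l l' : seq nat) : size l = 8%N -> perm_eq l l' ->
  E8moment n (lmono l) = E8moment n (lmono l').
Proof.
move=> sz Hp; have sz' : size l' = 8%N by rewrite -(perm_size Hp).
have sl : size l == 8%N by rewrite sz.
have sl' : size l' == 8%N by rewrite sz'.
have /tuple_permP[s Es] : perm_eq (Tuple sl) (Tuple sl') by [].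
have -> : lmono l' = mono [ffun i : 'I_8 => nth 0%N l' i].
  by apply/funext => X; apply: eq_bigr => i _; rewrite ffunE.
rewrite -(moment_perm n _ s); apply: E8moment_eq => X _.
apply: eq_bigr => i _; rewrite !ffunE; congr (_ ^+ _).
have := congr1 (fun t => nth 0%N t i) Es; rewrite /= => ->.
rewrite (nth_map i) ?size_enum_ord // nth_ord_enum (tnth_nth 0%N) //.
Qed.

Lemma E8moment_lmono_odd n l : size l = 8%N -> has odd l -> ~~ all odd l ->
  E8moment n (lmono l) = 0.
Proof.
move=> sz /(has_nthP 0%N)[i li oi] /allPn[x xl ox].
rewrite sz in li; have := xl; rewrite -index_mem sz => lj.
have -> : lmono l = mono [ffun i : 'I_8 => nth 0%N l i].
  by apply/funext => X; apply: eq_bigr => k _; rewrite ffunE.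
apply: (@moment_odd _ _ (Ordinal li) (Ordinal lj)); rewrite ffunE //=.
by rewrite nth_index.
Qed.

(** The decreasing exponent vectors of degree 8 whose eight entries share one parity; all other
    monomials have moment zero by [moment_odd]. *)
Definition octic_types : seq (seq nat) :=
  [:: [:: 8; 0; 0; 0; 0; 0; 0; 0]; [:: 6; 2; 0; 0; 0; 0; 0; 0];
      [:: 4; 4; 0; 0; 0; 0; 0; 0]; [:: 4; 2; 2; 0; 0; 0; 0; 0];
      [:: 2; 2; 2; 2; 0; 0; 0; 0]; [:: 1; 1; 1; 1; 1; 1; 1; 1]]%N.

Lemma octic_sorted_type a b c d e f g h :
  let l := [:: a; b; c; d; e; f; g; h]%N in
  sorted geq l -> sumn l = 8%N -> all odd l \/ ~~ has odd l -> l \in octic_types.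
Proof.
move=> /= /and5P[ab bc cd de] /and4P[ef fg gh _] S [].
  case/and5P=> oa ob oc od /and5P[oe of' og oh _].
  have [-> -> -> ->] : [/\ a = 1, b = 1, c = 1 & d = 1]%N by split; lia.
  by have [-> -> -> ->] : [/\ e = 1, f = 1, g = 1 & h = 1]%N by split; lia.
rewrite orbF !negb_or => /and5P[oa ob oc od /and4P[oe of' og oh]].
have [a8|[a6|[a4|a2]]] : (a = 8 \/ a = 6 \/ a = 4 \/ a = 2)%N by lia.
- have [-> -> -> ->] : [/\ a = 8, b = 0, c = 0 & d = 0]%N by split; lia.
  by have [-> -> -> ->] : [/\ e = 0, f = 0, g = 0 & h = 0]%N by split; lia.
- have [-> -> -> ->] : [/\ a = 6, b = 2, c = 0 & d = 0]%N by split; lia.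
  by have [-> -> -> ->] : [/\ e = 0, f = 0, g = 0 & h = 0]%N by split; lia.
- have [b4|b2] : (b = 4 \/ b = 2)%N by lia.
    have [-> -> -> ->] : [/\ a = 4, b = 4, c = 0 & d = 0]%N by split; lia.
    by have [-> -> -> ->] : [/\ e = 0, f = 0, g = 0 & h = 0]%N by split; lia.
  have [-> -> -> ->] : [/\ a = 4, b = 2, c = 2 & d = 0]%N by split; lia.
  by have [-> -> -> ->] : [/\ e = 0, f = 0, g = 0 & h = 0]%N by split; lia.
- have [-> -> -> ->] : [/\ a = 2, b = 2, c = 2 & d = 2]%N by split; lia.
  by have [-> -> -> ->] : [/\ e = 0, f = 0, g = 0 & h = 0]%N by split; lia.
Qed.

Lemma octic_type l : size l = 8%N -> sumn l = 8%N ->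
  all odd l \/ ~~ has odd l -> sort geq l \in octic_types.
Proof.
move=> sz S par.
have : sorted geq (sort geq l) by apply: sort_sorted => x y; exact: leq_total.
have : sumn (sort geq l) = 8%N by rewrite -S; apply: perm_sumn; rewrite perm_sort.
have : all odd (sort geq l) \/ ~~ has odd (sort geq l) by rewrite all_sort (eq_has_r (mem_sort
  geq l)).
have : size (sort geq l) = 8%N by rewrite size_sort.
case: (sort geq l) => [|a [|b [|c [|d [|e [|f [|g [|h []]]]]]]]] // _ P S' So.
exact: octic_sorted_type.
Qed.

Definition octic_moment n (k : nat) : int := E8moment n (lmono (nth [::] octic_types k)).

Lemma E8moment_octic n l : size l = 8%N -> sumn l = 8%N ->
  E8moment n (lmono l) =
  \sum_(k < 6) (sort geq l == nth [::] octic_types k)%:R * octic_moment n k.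
Proof.
move=> sz S; have [par|] := pselect (all odd l \/ ~~ has odd l).
  have Ht := octic_type sz S par; have := Ht; rewrite -index_mem => lt.
  rewrite (bigD1 (Ordinal lt)) //= big1 => [|k kn]; last first.
    case: eqP => [E|_]; last by rewrite mul0r.
    have idx : index (nth [::] octic_types k) octic_types = k.
      by apply: index_uniq => //; case: k {kn E}.
    by case/eqP: kn; apply: val_inj; rewrite -[LHS]idx -E.
  rewrite nth_index // eqxx mul1r addr0 /octic_moment nth_index //.
  by apply: E8moment_lmono_perm; rewrite // perm_sym perm_sort.
move=> /not_orP[nall /negP/negPn hasodd].
rewrite E8moment_lmono_odd //; last exact/negP.
rewrite big1 // => k _.
have : nth [::] octic_types k \in octic_types by apply: mem_nth; case: k.
case: eqP => [<- Ht|_ _]; last by rewrite mul0r.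
move: nall hasodd; rewrite -(all_sort _ geq) -(eq_has_r (mem_sort geq l)).
by move: Ht; rewrite !inE => /or4P[||| /or3P[]] /eqP ->.
Qed.

Fixpoint octic_coef (k : nat) (P : seq (int * seq nat)) : int :=
  if P is t :: P' then
    (if sort geq t.2 == nth [::] octic_types k then t.1 + octic_coef k P'
     else octic_coef k P')
  else 0.

Lemma E8moment_peval n P :
  all (fun t => (size t.2 == 8%N) && (sumn t.2 == 8%N)) P ->
  E8moment n (peval P) = \sum_(k < 6) octic_coef k P * octic_moment n k.
Proof.
rewrite /E8moment /peval exchange_big /=.
elim: P => [_|t P IH /= /andP[/andP[/eqP sz /eqP S] /IH{}IH]].
  by rewrite big_nil big1 // => k _; rewrite mul0r.
rewrite big_cons {}IH -big_distrr /= -[X in t.1 * X]/(E8moment n (lmono t.2)).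
rewrite E8moment_octic // big_distrr -big_split /=; apply: eq_bigr => k _.
by case: eqP => _; rewrite ?mul0r ?mulr0 ?add0r // mul1r mulrDl.
Qed.

(** A polynomial and its transform under [hadX] have the same moment; [k] clears the denominators
    that come from the halves. Expanding both sides by types leaves a linear relation with the
    computable coefficients [cs]. *)
Lemma had_relation n (k : int) P Q cs :
  all (fun t => (size t.2 == 8%N) && (sumn t.2 == 8%N)) P ->
  all (fun t => (size t.2 == 8%N) && (sumn t.2 == 8%N)) Q ->
  (forall X, inE8 X -> k * peval P (hadX X) = peval Q X) ->
  mkseq (fun i => k * octic_coef i P - octic_coef i Q) 6 = cs ->
  \sum_(i < 6) nth 0 cs i * octic_moment n i = 0.
Proof.
move=> HP HQ H <-; under eq_bigr do rewrite nth_mkseq // mulrBl -mulrA.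
rewrite big_split /= sumrN -big_distrr /= -!E8moment_peval // -moment_had.
apply/eqP; rewrite subr_eq0 /E8moment big_distrr; apply/eqP/eq_big_seq => X.
by rewrite mem_shellX => /andP[HX _]; exact: H.
Qed.

Definition x4 (o a b c d : nat) : seq nat := nseq o 0%N ++ [:: a; b; c; d] ++ nseq (4 - o) 0%N.

(* [16 y0 y1 y2 y3] in terms of [x], for [y = hadX x]. *)
Definition had_prod (o : nat) : seq (int * seq nat) :=
  [:: (1, x4 o 4 0 0 0); (1, x4 o 0 4 0 0); (1, x4 o 0 0 4 0); (1, x4 o 0 0 0 4);
      (-2, x4 o 2 2 0 0); (-2, x4 o 2 0 2 0); (-2, x4 o 2 0 0 2);
      (-2, x4 o 0 2 2 0); (-2, x4 o 0 2 0 2); (-2, x4 o 0 0 2 2);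
      (8%:Z, x4 o 1 1 1 1)].

Definition had_sqr (o : nat) : seq (int * seq nat) :=
  [:: (1, x4 o 2 0 0 0); (1, x4 o 0 2 0 0); (1, x4 o 0 0 2 0); (1, x4 o 0 0 0 2)].

Definition had_sum (o : nat) : seq (int * seq nat) :=
  [:: (1, x4 o 1 0 0 0); (1, x4 o 0 1 0 0); (1, x4 o 0 0 1 0); (1, x4 o 0 0 0 1)].

Definition xprod (o : nat) : seq (int * seq nat) := [:: (1, x4 o 1 1 1 1)].

Definition xhead : seq (int * seq nat) := [:: (1, x4 0 1 0 0 0)].

Ltac peval_simp := rewrite /peval !big_cons !big_nil /lmono !big_ord8 /=.

Lemma had_prodE X : inE8 X ->
  16 * peval (xprod 0) (hadX X) = peval (had_prod 0) X /\
  16 * peval (xprod 4) (hadX X) = peval (had_prod 4) X.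
Proof.
move=> /hadXE; move: (hadX X) => Y [[E0 E1 E2 E3] [E4 E5 E6 E7]]; split; peval_simp.
  transitivity ((2 * Y 'i 0) * (2 * Y 'i 1) * (2 * Y 'i 2) * (2 * Y 'i 3)); first by ring.
  by rewrite E0 E1 E2 E3; ring.
transitivity ((2 * Y 'i 4) * (2 * Y 'i 5) * (2 * Y 'i 6) * (2 * Y 'i 7)); first by ring.
by rewrite E4 E5 E6 E7; ring.
Qed.

Lemma had_sqrE X : inE8 X ->
  peval (had_sqr 0) (hadX X) = peval (had_sqr 0) X /\
  peval (had_sqr 4) (hadX X) = peval (had_sqr 4) X.
Proof.
move=> /hadXE; move: (hadX X) => Y [[E0 E1 E2 E3] [E4 E5 E6 E7]].
split; apply: (@mulfI _ 4) => //; peval_simp.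
  transitivity ((2 * Y 'i 0) ^+ 2 + (2 * Y 'i 1) ^+ 2 + (2 * Y 'i 2) ^+ 2 + (2 * Y 'i 3) ^+ 2).
    by ring.
  by rewrite E0 E1 E2 E3; ring.
transitivity ((2 * Y 'i 4) ^+ 2 + (2 * Y 'i 5) ^+ 2 + (2 * Y 'i 6) ^+ 2 + (2 * Y 'i 7) ^+ 2).
  by ring.
by rewrite E4 E5 E6 E7; ring.
Qed.

Lemma had_headE X : inE8 X -> 2 * peval xhead (hadX X) = peval (had_sum 0) X.
Proof.
move=> /hadXE; move: (hadX X) => Y [[E0 _ _ _] _]; peval_simp.
transitivity (2 * Y 'i 0); first by ring.
by rewrite E0; ring.
Qed.

(** Four octics are built from factors whose transforms under [hadX] are explicit, the sums of
    squares over a block being invariant. The resulting relations leave two of six moments free. The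
    coefficients 105, 15, 9, 3 are the Gaussian moments of the types, and -48, -6, 0, -2 are the
    entries of [harmonic]. *)
Lemma octic_relations n :
  [/\ octic_moment n 0 = 105 * octic_moment n 4 - 48 * octic_moment n 5,
      octic_moment n 1 = 15 * octic_moment n 4 - 6 * octic_moment n 5,
      octic_moment n 2 = 9 * octic_moment n 4 &
      octic_moment n 3 = 3 * octic_moment n 4 - 2 * octic_moment n 5].
Proof.
have R1 := @had_relation n 256 (pmul (xprod 0) (xprod 4))
  (pmul (had_prod 0) (had_prod 4)) [:: 0; 0; -16; 96; -144; 192] isT isT _ _.
have {}R1 := R1 _ (ltac:(vm_compute; reflexivity)).
have R2 := @had_relation n 64 (pmul (had_sqr 0) (pmul (xprod 4) (pmul xhead xhead)))
  (pmul (had_sqr 0) (pmul (had_prod 4) (pmul (had_sum 0) (had_sum 0))))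
  [:: 0; 0; -16; 0; 144; 0] isT isT _ _.
have {}R2 := R2 _ (ltac:(vm_compute; reflexivity)).
have R3 := @had_relation n 64 (pmul (had_sqr 4) (pmul (xprod 0) (pmul xhead xhead)))
  (pmul (had_sqr 4) (pmul (had_prod 0) (pmul (had_sum 0) (had_sum 0))))
  [:: 0; -16; 0; 48; 96; 0] isT isT _ _.
have {}R3 := R3 _ (ltac:(vm_compute; reflexivity)).
have R4 := @had_relation n 256 (pmul (xprod 0) (xprod 0))
  (pmul (had_prod 0) (had_prod 0)) [:: -4; 48; -36; -48; 168; 0] isT isT _ _.
have {}R4 := R4 _ (ltac:(vm_compute; reflexivity)).
move: R1 R2 R3 R4; rewrite !(big_ord_recr, big_ord0) /=.
move: (octic_moment n 0) (octic_moment n 1) (octic_moment n 2) (octic_moment n 3)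
  (octic_moment n 4) (octic_moment n 5) => m0 m1 m2 m3 m4 m5 R1 R2 R3 R4.
have {}R1 : 0 = - 16 * m2 + 96 * m3 - 144 * m4 + 192 * m5.
  rewrite -R1; first by ring.
  move=> X HX; have [E1 E2] := had_prodE HX.
  by rewrite !peval_mul -E1 -E2; ring.
have {}R2 : 0 = - 16 * m2 + 144 * m4.
  rewrite -R2; first by ring.
  move=> X HX; have [E1 E2] := had_prodE HX; have [E3 E4] := had_sqrE HX.
  by rewrite !peval_mul -E2 E3 -(had_headE HX); ring.
have {}R3 : 0 = - 16 * m1 + 48 * m3 + 96 * m4.
  rewrite -R3; first by ring.
  move=> X HX; have [E1 E2] := had_prodE HX; have [E3 E4] := had_sqrE HX.
  by rewrite !peval_mul -E1 E4 -(had_headE HX); ring.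
have {}R4 : 0 = - 4 * m0 + 48 * m1 - 36 * m2 - 48 * m3 + 168 * m4.
  rewrite -R4; first by ring.
  move=> X HX; have [E1 E2] := had_prodE HX.
  by rewrite !peval_mul -E1; ring.
by split; lra.
Qed.

(* [dfact k] is the k-th moment of a standard Gaussian variable. *)
Fixpoint dfact (k : nat) : nat :=
  match k with 0 => 1 | 1 => 0 | k'.+2 => k'.+1 * dfact k' end%N.

Lemma dfactS k : dfact k.+1 = (k * dfact k.-1)%N.
Proof. by case: k. Qed.

Lemma dfact_odd k : odd k -> dfact k = 0%N.
Proof.
elim/ltn_ind: k => -[//|[//|k]] IH /=; rewrite negbK => ok.
by rewrite IH ?muln0.
Qed.

Definition expo (e : {ffun 'I_8 -> nat}) : seq nat := [seq e i | i <- enum 'I_8].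

Lemma size_expo e : size (expo e) = 8%N.
Proof. by rewrite size_map size_enum_ord. Qed.

Lemma nth_expo e (i : 'I_8) : nth 0%N (expo e) i = e i.
Proof. by rewrite (nth_map i) ?size_enum_ord // nth_ord_enum. Qed.

Lemma lmono_expo e : lmono (expo e) = mono e.
Proof. by apply/funext => X; apply: eq_bigr => i _; rewrite nth_expo. Qed.

Lemma big_expo (R : Type) (idx : R) (op : Monoid.com_law idx) (f : nat -> R) e :
  \big[op/idx]_(x <- expo e) f x = \big[op/idx]_i f (e i).
Proof. by rewrite big_map big_enum. Qed.

Definition gaussian (e : {ffun 'I_8 -> nat}) : int := (\prod_i dfact (e i))%N%:Z.

(* The six values correspond to [octic_types]; together with the Gaussian moments this
   functional spans the solutions of [octic_relations]. *)
Definition harmonic (e : {ffun 'I_8 -> nat}) : int :=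
  nth 0 [:: -48; -6; 0; -2; 0; 1] (index (sort geq (expo e)) octic_types).

Lemma octic_moments_span n (e : {ffun 'I_8 -> nat}) : (\sum_i e i = 8)%N ->
  E8moment n (mono e) =
  octic_moment n 4 * gaussian e + octic_moment n 5 * harmonic e.
Proof.
move=> S; have sz := size_expo e.
have sum8 : sumn (expo e) = 8%N by rewrite sumnE big_expo.
rewrite -lmono_expo E8moment_octic //.
have gE : gaussian e = (\prod_(x <- sort geq (expo e)) dfact x)%N%:Z.
  by rewrite /gaussian -big_expo; congr Posz; apply: perm_big; rewrite perm_sym perm_sort.
have [E0 E1 E2 E3] := octic_relations n.
have [par|] := pselect (all odd (expo e) \/ ~~ has odd (expo e)).
  have := octic_type sz sum8 par; rewrite /harmonic gE; move: (sort geq (expo e)) => s.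
  rewrite !(big_ord_recr, big_ord0) /= add0r.
  by rewrite !inE => /or4P[||| /or3P[]] /eqP -> /=; rewrite !big_cons big_nil ?E0 ?E1 ?E2 ?E3 /=;
    ring.
move=> /not_orP[/negP nall /negP/negPn hasodd].
have nin : sort geq (expo e) \notin octic_types.
  apply/negP => Ht; move: nall hasodd.
  rewrite -(all_sort _ geq) -(eq_has_r (mem_sort geq (expo e))).
  by move: Ht; rewrite !inE => /or4P[||| /or3P[]] /eqP ->.
rewrite /harmonic (memNindex nin) mulr0 addr0 big1 => [|k _]; last first.
  case: eqP => [E|_]; last by rewrite mul0r.
  by case/negP: nin; rewrite E; apply: mem_nth; case: k {E}.
have /hasP[_ /mapP[i _ ->] oi] := hasodd.
by rewrite /gaussian (bigD1 i) //= dfact_odd // mul0n mulr0.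
Qed.

(** * Products of linear forms and the scalar of a similarity *)

Definition eadd (e : {ffun 'I_8 -> nat}) (j : 'I_8) : {ffun 'I_8 -> nat} :=
  [ffun i => (e i + (i == j))%N].

Definition esub (e : {ffun 'I_8 -> nat}) (j : 'I_8) : {ffun 'I_8 -> nat} :=
  [ffun i => (e i - (i == j))%N].

(* The value at [x ^ e * prod of the linear forms in ls] of the linear functional
   taking the value [g] on monomials. *)
Fixpoint contract (g : {ffun 'I_8 -> nat} -> int) (ls : seq ('I_8 -> int))
    (e : {ffun 'I_8 -> nat}) : int :=
  if ls is l :: ls' then \sum_j l j * contract g ls' (eadd e j) else g e.

Lemma contract_moment n ls e :
  contract (fun e => E8moment n (mono e)) ls e =
  E8moment n (fun X => mono e X * \prod_(l <- ls) \sum_j l j * X j).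
Proof.
elim: ls e => [|l ls IH] e /=.
  by apply: eq_bigr => X _; rewrite big_nil mulr1.
under eq_bigr do rewrite IH /E8moment big_distrr /=.
rewrite exchange_big; apply: eq_bigr => X _ /=.
rewrite big_cons mulrCA big_distrl /=; apply: eq_bigr => j _.
rewrite -mulrA; congr (_ * _); rewrite mulrA; congr (_ * _).
rewrite /mono (bigD1 j) //= [in RHS](bigD1 j) //= ffunE eqxx addn1 exprS -mulrA.
by congr (_ * (_ * _)); apply: eq_bigr => i /negPf ij; rewrite ffunE ij addn0.
Qed.

Lemma contract_lin (g g1 g2 : {ffun 'I_8 -> nat} -> int) (a b : int) (d : nat)
    (ls : seq ('I_8 -> int)) (e : {ffun 'I_8 -> nat}) :
  (forall e : {ffun 'I_8 -> nat}, (\sum_i e i = d)%N -> g e = a * g1 e + b * g2 e) ->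
  (size ls + \sum_i e i = d)%N ->
  contract g ls e = a * contract g1 ls e + b * contract g2 ls e.
Proof.
move=> Hg; elim: ls e => [|l ls IH] e /=; first exact: Hg.
move=> Hd; rewrite !big_distrr -big_split /=; apply: eq_bigr => j _.
rewrite IH; first by ring.
rewrite -Hd; under eq_bigr do rewrite ffunE.
have delta : (\sum_(i < 8) (i == j) = 1)%N.
  by rewrite (bigD1 j) //= eqxx big1 // => i /negPf ->.
by rewrite big_split /= delta addn1 addnS.
Qed.

Lemma gaussian_eadd (e : {ffun 'I_8 -> nat}) j : gaussian (eadd e j) = (e j)%:Z * gaussian (esub
  e j).
Proof.
rewrite /gaussian -PoszM (bigD1 j) //= [in RHS](bigD1 j) //= !ffunE eqxx addn1 dfactS.
rewrite subn1 -mulnA; congr (Posz (_ * (_ * _))); apply: eq_bigr => i /negPf ij.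
by rewrite !ffunE ij addn0 subn0.
Qed.

(** Gaussian integration by parts: the form [l] acts on the remaining factors as the derivation
    sum_j l_j d/dx_j. On a form [m] it gives the scalar product of [l] and [m], which vanishes, so
    only the derivative of the monomial survives. *)
Lemma contract_gaussian (l : 'I_8 -> int) (ls : seq ('I_8 -> int)) (e : {ffun 'I_8 -> nat}) :
  (forall m, List.In m ls -> \sum_j l j * m j = 0) ->
  contract gaussian (l :: ls) e =
  \sum_j l j * (e j)%:Z * contract gaussian ls (esub e j).
Proof.
elim: ls e => [|m ls IH] e orth.
  by apply: eq_bigr => j _ /=; rewrite gaussian_eadd mulrA.
transitivity (\sum_j m j * contract gaussian (l :: ls) (eadd e j)).
  rewrite /= ; under eq_bigr do rewrite big_distrr /=.
  rewrite exchange_big; apply: eq_bigr => j _ /=; rewrite big_distrr /=.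
  apply: eq_bigr => i _; rewrite mulrCA; congr (_ * (_ * contract _ _ _)).
  by apply/ffunP => k; rewrite !ffunE addnAC.
have {}IH j := IH (eadd e j) (fun m' Hm' => orth m' (or_intror Hm')).
rewrite (eq_bigr _ (fun j _ => congr1 ( *%R (m j)) (IH j))).
transitivity (\sum_j \sum_i (m j * (l i * (e i)%:Z * contract gaussian ls (esub (eadd e j) i)) +
   m j * (l i * (i == j)%:R * contract gaussian ls (esub (eadd e j) i)))).
  apply: eq_bigr => j _; rewrite big_distrr /=; apply: eq_bigr => i _.
  by rewrite ffunE PoszD; case: (i == j) => /=; ring.
under eq_bigr do rewrite big_split /=.
rewrite big_split /= [X in _ + X](_ : _ = contract gaussian ls e * \sum_j l j * m j).
  rewrite (orth m (or_introl erefl)) mulr0 addr0.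
  rewrite exchange_big; apply: eq_bigr => i _ /=; rewrite big_distrr /=.
  apply: eq_bigr => j _; have [->|ei] := eqVneq (e i) 0%N; first by ring.
  have -> : esub (eadd e j) i = eadd (esub e i) j.
    apply/ffunP => k; rewrite !ffunE; have [->|_] := eqVneq k i; last by rewrite !subn0.
    by rewrite addnBAC // lt0n.
  by ring.
rewrite big_distrr /=; apply: eq_bigr => j _; rewrite (bigD1 j) //= eqxx.
have -> : esub (eadd e j) j = e by apply/ffunP => k; rewrite !ffunE addnK.
rewrite [X in _ + X]big1 => [|i /negPf ->]; last by rewrite mulr0 mul0r mulr0.
by rewrite -[true%:R]/(1 : int); ring.
Qed.

(** Without a monomial factor the Gaussian contribution is zero by [contract_gaussian]. The
    contraction of [harmonic] that remains does not involve [n]. *)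
Lemma E8moment_orth n (ls : seq ('I_8 -> int)) :
  size ls = 8%N ->
  (forall l ls', ls = l :: ls' -> forall m, List.In m ls' -> \sum_j l j * m j = 0) ->
  E8moment n (fun X => \prod_(l <- ls) \sum_j l j * X j) =
  octic_moment n 5 * contract harmonic ls [ffun=> 0%N].
Proof.
move=> sz orth.
have e0 : (\sum_(i < 8) [ffun=> 0%N : nat] i = 0)%N.
  by rewrite big1 // => i _; rewrite ffunE.
transitivity (contract (fun e => E8moment n (mono e)) ls [ffun=> 0%N]).
  rewrite contract_moment; apply: E8moment_eq => X _.
  rewrite /mono [X in X * _]big1 ?mul1r // => i _.
  by rewrite ffunE.
rewrite (@contract_lin _ gaussian harmonic (octic_moment n 4) (octic_moment n 5) 8).
- case: ls sz orth => [//|l ls] _ orth.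
  rewrite contract_gaussian; last exact: orth.
  rewrite big1 ?mulr0 ?add0r // => j _; first by rewrite ffunE mulr0 mul0r.
- by move=> e; exact: octic_moments_span.
- by rewrite e0 addn0.
Qed.

(** The octonion with coordinate vector [4 e_j]; 4 is the least positive multiple of [e_j] lying in
    the lattice. *)
Definition dualX (j : 'I_8) : oct int :=
  nth 0 [:: (2, 0, -1, -1, 2, 0, 0, 0); (0, 0, 1, 1, -2, 0, 0, 0);
            (0, 2, -1, 1, 0, 2, 0, 0); (0, 0, 1, -1, 0, -2, 0, 0);
            (2, 0, 1, 1, 0, 0, -2, 2); (0, 2, 1, -1, 0, 0, -2, -2);
            (0, 0, 1, 1, 0, 0, 0, 0); (0, 0, 1, -1, 0, 0, 0, 0)] j.

Definition mul_row (a : oct int) (k j : 'I_8) : int := toX (omul a (dualX j)) k.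

Lemma toX_mul (a c : oct int) k :
  \sum_j mul_row a k j * toX c j = 4 * toX (omul a c) k.
Proof.
move: a c k => [[[[[[[a0 a1] a2] a3] a4] a5] a6] a7].
move=> [[[[[[[b0 b1] b2] b3] b4] b5] b6] b7].
by apply: forall_ord8; rewrite big_ord8 /mul_row /dualX /omul /= !ffunE /=; ring.
Qed.

(** Left multiplication by [a] is a similarity, so the rows of its matrix are orthogonal. *)
Lemma mul_row_orth (a : oct int) (k : 'I_8) : k != 'i 0 ->
  \sum_j mul_row a 'i 0 j * mul_row a k j = 0.
Proof.
move: a k => [[[[[[[a0 a1] a2] a3] a4] a5] a6] a7].
by apply: forall_ord8 => //= _; rewrite big_ord8 /mul_row /dualX /omul /= !ffunE /=; ring.
Qed.

Definition mul_rows (a : oct int) : seq ('I_8 -> int) :=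
  [seq mul_row a k | k <- [:: 'i 0; 'i 1; 'i 2; 'i 3; 'i 4; 'i 5; 'i 6; 'i 7]].

Lemma shell_sum_mul (a : oct int) n :
  4 ^+ 8 * \sum_(c <- oshell n) oprod (omul a c) =
  shell_sum n * contract harmonic (mul_rows a) [ffun=> 0%N].
Proof.
have -> : shell_sum n = octic_moment n 5.
  rewrite /shell_sum /oprod (sum_oshell n (fun X => \prod_i X i)).
  by apply: eq_bigr => X _; apply: eq_bigr; apply: forall_ord8.
rewrite -E8moment_orth // => [|l ls []]; last first.
  move=> <- <- m /= H; have [k k0 <-] : exists2 k, k != 'i 0 & mul_row a k = m.
    by move: H => [|[|[|[|[|[|[|[]]]]]]]] <-;
      [exists 'i 1|exists 'i 2|exists 'i 3|exists 'i 4|exists 'i 5|exists 'i 6|exists 'i 7].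
  exact: mul_row_orth.
rewrite /E8moment -(sum_oshell n (fun X => \prod_(l <- mul_rows a) \sum_j l j * X j)).
rewrite big_distrr /=; apply: eq_bigr => c _; rewrite big_map.
under [RHS]eq_bigr do rewrite toX_mul.
by rewrite /oprod !big_cons big_nil big_ord8 /=; ring.
Qed.

Lemma ocount_units : (0 < ocount 1 (fun=> True))%N.
Proof.
rewrite /ocount sum1_count -has_count; apply/hasP; exists (oone int).
  by rewrite mem_oshell onorm1.
exact/asboolP.
Qed.

(** Summing [shell_sum_mul] over all [a] of norm [p] multiplies [shell_sum n] by a scalar [kappa]
    that depends on [p] alone; comparing with the case n = 1 eliminates it. *)
Lemma shell_sum_hecke (p n : nat) : prime p -> odd p ->
  (shell_sum (p * n) + if (p %| n)%N then p%:Z ^+ 11 * shell_sum (n %/ p) else 0) *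
    shell_sum 1 = shell_sum p * shell_sum n.
Proof.
move=> p_pr p_odd; pose u := ocount 1 (fun=> True).
have [kappa Hk] : exists kappa : int, forall n,
    4 ^+ 8 * (u%:Z * (shell_sum (p * n) +
      if (p %| n)%N then p%:Z ^+ 11 * shell_sum (n %/ p) else 0)) = shell_sum n * kappa.
  exists (\sum_(a <- oshell p) contract harmonic (mul_rows a) [ffun=> 0%N]) => m.
  rewrite -hecke_count // !big_distrr /=; apply: eq_bigr => a _.
  exact: shell_sum_mul.
have u0 : 4 ^+ 8 * u%:Z != 0.
  by rewrite mulf_neq0 // eqz_nat -lt0n ocount_units.
have H1 := Hk 1%N; rewrite muln1 dvdn1 in H1.
have p1 : (p == 1)%N = false by apply: gtn_eqF; exact: prime_gt1.
rewrite p1 addr0 in H1.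
apply: (mulfI u0).
transitivity (shell_sum n * kappa * shell_sum 1); first by rewrite -Hk !mulrA.
by rewrite -mulrA [kappa * _]mulrC -H1; ring.
Qed.

(** * Jacobi's formula for the cube of the Euler product *)

(** The q-Pochhammer symbol (q^a; q)_n at q = X. *)
Definition qrise (a n : nat) : {poly int} := \prod_(i < n) (1 - 'X^(a + i)).

Lemma qrise0 a : qrise a 0 = 1.
Proof. by rewrite /qrise big_ord0. Qed.

Lemma qriseSr a n : qrise a n.+1 = qrise a n * (1 - 'X^(a + n)).
Proof. by rewrite /qrise big_ord_recr. Qed.

Lemma qriseSl a n : qrise a n.+1 = (1 - 'X^a) * qrise a.+1 n.
Proof.
rewrite /qrise big_ord_recl addn0; congr (_ * _); apply: eq_bigr => i _.
by rewrite addSnnS.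
Qed.

Lemma qrise_cong (a n k : nat) : (k <= a)%N -> exists r, qrise a n = 1 + 'X^k * r.
Proof.
move=> ka; elim: n => [|n [r E]]; first by exists 0; rewrite qrise0 mulr0 addr0.
exists (r * (1 - 'X^(a + n)) - 'X^(a + n - k)).
rewrite qriseSr E.
have -> : 'X^(a + n) = 'X^k * 'X^(a + n - k) :> {poly int}.
  by rewrite -exprD subnKC // (leq_trans ka) // leq_addr.
by ring.
Qed.

(* [(q)_N [2N+1 choose N-m]_q], where [d = N - m]. *)
Definition jac_coef (m d : nat) : {poly int} :=
  qrise d.+1 m * qrise (2 * m + d).+2 d.

Lemma jac_coef_rec m d :
  jac_coef m.+1 d.+2 = (1 - 'X^((m + d).+3)) *
    ('X^(d.+2) * jac_coef m d.+2 + (1 + 'X^(2 * (m + d).+3)) * jac_coef m.+1 d.+1 +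
     'X^((2 * m + d).+1.+4) * jac_coef m.+2 d).
Proof.
rewrite /jac_coef.
have -> : qrise d.+3 m.+1 = qrise d.+3 m * (1 - 'X^((m + d).+3)).
  by rewrite qriseSr; congr (_ * (1 - 'X^_)); lia.
have -> : qrise (2 * m.+1 + d.+2).+2 d.+2 =
   qrise (2 * m + d).+2.+4 d * (1 - 'X^(2 * (m + d).+3)) * (1 - 'X^((2 * (m + d).+3).+1)).
  by rewrite !qriseSr; congr (qrise _ _ * (1 - 'X^_) * (1 - 'X^_)); lia.
have -> : qrise (2 * m + d.+2).+2 d.+2 =
   (1 - 'X^((2 * m + d).+4)) * ((1 - 'X^((2 * m + d).+1.+4)) * qrise (2 * m + d).+2.+4 d).
  by rewrite !qriseSl; congr ((1 - 'X^_) * ((1 - 'X^_) * qrise _ _)); lia.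
have -> : qrise (2 * m.+1 + d.+1).+2 d.+1 =
   (1 - 'X^((2 * m + d).+1.+4)) * qrise (2 * m + d).+2.+4 d.
  by rewrite !qriseSl; congr ((1 - 'X^_) * qrise _ _); lia.
have -> : qrise (2 * m.+2 + d).+2 d = qrise (2 * m + d).+2.+4 d.
  by congr qrise; lia.
have -> : qrise d.+2 m.+1 = (1 - 'X^(d.+2)) * qrise d.+3 m by rewrite qriseSl.
have -> : qrise d.+1 m.+2 = (1 - 'X^(d.+1)) * ((1 - 'X^(d.+2)) * qrise d.+3 m).
  by rewrite !qriseSl.
rewrite !mul2n -!addnn !(exprD, exprS) .
set u := 'X ^+ m; set w := 'X ^+ d; ring.
Qed.

Lemma jac_coef_rec_d0 m :
  jac_coef m.+1 1 = (1 - 'X^(m.+2)) *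
    ('X * jac_coef m 1 + (1 + 'X^(2 * m.+2)) * jac_coef m.+1 0).
Proof.
rewrite /jac_coef !qrise0.
have -> : qrise 2 m.+1 = qrise 2 m * (1 - 'X^(m.+2)).
  by rewrite qriseSr; congr (_ * (1 - 'X^_)); lia.
have -> : qrise 1 m.+1 = (1 - 'X) * qrise 2 m by rewrite qriseSl.
rewrite !qriseSr !qrise0 !addn0 !addn1 !mul2n -!addnn !addSn !addnS !(exprD, exprS).
by set u := 'X ^+ m; ring.
Qed.

Lemma jac_coef_rec_m0 d :
  jac_coef 0 d.+2 = (1 - 'X^(d.+2)) *
    ('X^(d.+2) * jac_coef 0 d.+1 + (1 + 'X^(2 * d.+2)) * jac_coef 0 d.+1 +
     'X^(d.+3) * jac_coef 1 d).
Proof.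
rewrite /jac_coef !qrise0 ?muln0 ?add0n ?muln1.
have -> : qrise d.+4 d.+2 = qrise d.+4 d * (1 - 'X^(2 * d.+2)) * (1 - 'X^((2 * d.+2).+1)).
  by rewrite !qriseSr; congr (_ * (1 - 'X^_) * (1 - 'X^_)); lia.
have -> : qrise d.+3 d.+1 = (1 - 'X^(d.+3)) * qrise d.+4 d by rewrite qriseSl.
have -> : qrise (2 + d).+2 d = qrise d.+4 d by [].
rewrite qriseSr qrise0 addn0 !mul2n -!addnn !addSn !addnS !(exprD, exprS).
by set w := 'X ^+ d; ring.
Qed.

Lemma jac_coef_rec_00 :
  jac_coef 0 1 = (1 - 'X) * ('X * jac_coef 0 0 + (1 + 'X^2) * jac_coef 0 0).
Proof. by rewrite /jac_coef !qriseSr !qrise0 /=; ring. Qed.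

Lemma jac_coef_top m : jac_coef m.+1 0 = (1 - 'X^(m.+1)) * jac_coef m 0.
Proof. by rewrite /jac_coef !qrise0 !mulr1 qriseSr mulrC add1n. Qed.

Definition jac (N m : nat) : {poly int} := if (m <= N)%N then jac_coef m (N - m) else 0.

Definition jac_prev (N m : nat) : {poly int} :=
  if m is m'.+1 then 'X^(N.+1 - m) * jac N m' else 'X^(N.+1) * jac N 0.

(** The q-Pascal rule applied twice, passing from the q-binomials of 2N + 1 to those of 2N + 3; the
    factor 1 - X^(N+1) extends (q)_N. *)
Lemma jac_rec N m : (m <= N.+1)%N ->
  jac N.+1 m = (1 - 'X^(N.+1)) *
    (jac_prev N m + (1 + 'X^(2 * N.+1)) * jac N m + 'X^((N + m).+2) * jac N m.+1).
Proof.
rewrite leq_eqVlt ltnS => /predU1P[->|mN].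
  rewrite /jac_prev /jac !leqnn !ltnn ltnNge leqnSn /= !subnn expr0 !mulr0 !addr0 mul1r.
  exact: jac_coef_top.
have [d ->] : exists d, N = (m + d)%N by exists (N - m)%N; rewrite subnKC.
rewrite /jac_prev /jac.
have -> : (m <= (m + d).+1)%N = true by rewrite leqW ?leq_addr.
have -> : (m <= m + d)%N = true by rewrite leq_addr.
have -> : ((m + d).+1 - m = d.+1)%N by rewrite -addnS addKn.
have -> : (m < m + d)%N = (0 < d)%N by lia.
rewrite addKn.
case: m {mN} d => [|m] [|d] /=.
- by rewrite jac_coef_rec_00 !expr1; ring.
- by rewrite jac_coef_rec_m0 !subn0 !addn0 /= subn1 mulrDr.
- rewrite jac_coef_rec_d0 addn0 leqnSn mulr0 addr0.
  have -> : (m.+1 - m = 1)%N by lia.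
  by rewrite expr1.
rewrite jac_coef_rec.
have -> : (m <= m.+1 + d.+1)%N by lia.
have -> : (m.+1 + d.+1 - m = d.+2)%N by lia.
have -> : (m.+1 + d.+1 - m.+2 = d)%N by lia.
have -> : (m.+1 + d.+1 = (m + d).+2)%N by lia.
by congr (_ * (_ + _ + 'X^_ * _)); lia.
Qed.

Definition jac_term (m : nat) : {poly int} :=
  ((-1) ^+ m * m.*2.+1%:R) * 'X^('C(m.+1, 2)).

(* [2m + 1] is annihilated by [f (m + 1) - 2 f m + f (m - 1)]; the boundary term of the
   recurrence is the reflection [m -> -1 - m] of the missing one. *)
Lemma jac_cube N : qrise 1 N ^+ 3 = \sum_(m < N.+1) jac_term m * jac N m.
Proof.
elim: N => [|N IH].
  rewrite qrise0 big_ord_recl big_ord0 /jac /jac_coef !qrise0 /jac_term /= bin_small //.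
  by rewrite double0; ring.
rewrite qriseSr exprMn IH add1n.
have -> : \sum_(m < N.+2) jac_term m * jac N.+1 m = (1 - 'X^(N.+1)) *
    (\sum_(m < N.+2) jac_term m * jac_prev N m +
     \sum_(m < N.+2) jac_term m * ((1 + 'X^(2 * N.+1)) * jac N m) +
     \sum_(m < N.+2) jac_term m * ('X^((N + m).+2) * jac N m.+1)).
  rewrite -!big_split big_distrr; apply: eq_bigr => m _ /=.
  by rewrite (jac_rec (leq_ord m)); ring.
have jac0 m : (N < m)%N -> jac N m = 0 by rewrite /jac ltnNge => /negPf ->.
pose g k := if k is k'.+1 then jac_term k' * ('X^((N + k').+2) * jac N k)
            else jac_term 0 * ('X^(N.+1) * jac N 0).
have E1 : \sum_(m < N.+2) jac_term m * jac_prev N m =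
    g 0%N + \sum_(k < N.+1) jac_term k.+1 * ('X^(N - k) * jac N k).
  by rewrite [LHS]big_ord_recl; congr (_ + _); apply: eq_bigr.
have E2 : \sum_(m < N.+2) jac_term m * ((1 + 'X^(2 * N.+1)) * jac N m) =
    \sum_(k < N.+1) jac_term k * ((1 + 'X^(2 * N.+1)) * jac N k).
  by rewrite big_ord_recr /= jac0 // !mulr0 addr0.
have E3 : g 0%N + \sum_(m < N.+2) jac_term m * ('X^((N + m).+2) * jac N m.+1) =
    \sum_(k < N.+1) g k.
  rewrite [X in _ + X]big_ord_recr [X in _ + (X + _)]big_ord_recr.
  rewrite [jac N N.+1]jac0 // [jac N N.+2]jac0 // !mulr0 !addr0 [RHS]big_ord_recl.
  by congr (_ + _); rewrite [LHS]addr0; apply: eq_bigr.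
have -> : \sum_(m < N.+2) jac_term m * jac_prev N m +
     \sum_(m < N.+2) jac_term m * ((1 + 'X^(2 * N.+1)) * jac N m) +
     \sum_(m < N.+2) jac_term m * ('X^((N + m).+2) * jac N m.+1) =
     \sum_(k < N.+1) (jac_term k.+1 * ('X^(N - k) * jac N k) +
       jac_term k * ((1 + 'X^(2 * N.+1)) * jac N k) + g k).
  rewrite E1 E2 !big_split -E3; move: (g 0%N) => g0.
  by rewrite /=; ring.
have DE (j : nat) : j.*2.+1%:R = 2 * j%:R + 1 :> {poly int}.
  by rewrite -natr1 -addnn natrD; ring.
rewrite mulrC !big_distrr; apply: eq_bigr => -[k /= kN] _.
have T k' : 'X^('C(k'.+2, 2)) = 'X^('C(k'.+1, 2)) * 'X^(k'.+1) :> {poly int}.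
  by rewrite -exprD binS bin1.
have -> : jac_term k.+1 * ('X^(N - k) * jac N k) =
    - ((-1) ^+ k * (2 * k%:R + 3)) * 'X^('C(k.+1, 2)) * ('X^(N.+1) * jac N k).
  have -> : 'X^(N.+1) = 'X^(k.+1) * 'X^(N - k) :> {poly int}.
    by rewrite -exprD addSn subnKC.
  by rewrite /jac_term T exprS DE -natr1; ring.
have tE : jac_term k = (-1) ^+ k * (2 * k%:R + 1) * 'X^('C(k.+1, 2)).
  by rewrite /jac_term DE.
have -> : g k = - ((-1) ^+ k * (2 * k%:R - 1)) * 'X^('C(k.+1, 2)) * ('X^(N.+1) * jac N k).
  case: k kN {tE} => [|k] kN; rewrite /g /jac_term.
    by rewrite bin_small // double0; ring.
  rewrite T (exprS (-1)) DE -[k.+1%:R]natr1.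
  have -> : 'X^((N + k).+2) = 'X^(k.+1) * 'X^(N.+1) :> {poly int}.
    by rewrite -exprD; congr 'X^_; lia.
  by ring.
by rewrite tE mul2n -addnn exprD; ring.
Qed.

Lemma jac_cong N m : (m <= N)%N -> exists r, jac N m = 1 + 'X^((N - m).+1) * r.
Proof.
move=> mN; rewrite /jac mN /jac_coef.
have [r1 ->] := @qrise_cong (N - m).+1 m (N - m).+1 (leqnn _).
have le : ((N - m).+1 <= (2 * m + (N - m)).+2)%N by lia.
have [r2 ->] := qrise_cong (N - m) le.
by exists (r1 + r2 + 'X^((N - m).+1) * r1 * r2); ring.
Qed.

(** [jac N m] is 1 up to terms of exponent at least N - m + 1, and [jac_term m] starts at C(m + 1,
    2) >= m, so every error is divisible by X^(N+1). *)
Lemma euler_cube N : exists r,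
  qrise 1 N ^+ 3 = \sum_(m < N.+1) jac_term m + 'X^(N.+1) * r.
Proof.
have /fin_all_exists[r Hr] (m : 'I_N.+1) : exists r,
    jac_term m * jac N m = jac_term m + 'X^(N.+1) * r.
  have mN : (m <= N)%N by rewrite -ltnS.
  have [s ->] := jac_cong mN.
  exists (((-1) ^+ m * m.*2.+1%:R) * 'X^('C(m.+1, 2) - m) * s).
  rewrite mulrDr mulr1; congr (_ + _); rewrite /jac_term.
  have T : (m <= 'C(m.+1, 2))%N by rewrite binS bin1 leq_addl.
  have -> : 'X^('C(m.+1, 2)) = 'X^('C(m.+1, 2) - m) * 'X^m :> {poly int}.
    by rewrite -exprD subnK.
  have -> : 'X^(N.+1) = 'X^m * 'X^((N - m).+1) :> {poly int}.
    by rewrite -exprD addnS subnKC.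
  by ring.
exists (\sum_m r m); rewrite jac_cube (eq_bigr _ (fun m _ => Hr m)).
by rewrite big_split /= big_distrr.
Qed.

Lemma tau_jac n : tau n.+1 = ((\sum_(m < n.+2) jac_term m) ^+ 8)`_n.
Proof.
rewrite /tau /tau_partial coefXM /= prodrXl -[24%N]/(3 * 8)%N exprM.
have -> : \prod_(1 <= k < n.+2) (1 - 'X^k) = qrise 1 n.+1 :> {poly int}.
  by rewrite big_add1 /= big_mkord; apply: eq_bigr => i _; rewrite add1n.
have [r ->] := euler_cube n.+1; set J := \sum_(m < _) _.
have [s ->] : exists s, (J + 'X^(n.+2) * r) ^+ 8 = J ^+ 8 + s * 'X^(n.+2).
  have := subrXX (J + 'X^(n.+2) * r) J 8; set S := \sum_(i < 8) _ => E.
  by exists (r * S); rewrite -[LHS](subrK (J ^+ 8)) E; ring.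
by rewrite coefD coefMXn ltnW ?ltnSn // addr0.
Qed.

Lemma coef_sum_exp (I : finType) (g : I -> int) (t : I -> nat) (k n : nat) :
  ((\sum_i (g i)%:P * 'X^(t i)) ^+ n)`_k =
  \sum_(f : {ffun 'I_n -> I} | (\sum_j t (f j) == k)%N) \prod_j g (f j).
Proof.
have -> : (\sum_i (g i)%:P * 'X^(t i)) ^+ n =
    \sum_(f : {ffun 'I_n -> I}) \prod_j ((g (f j))%:P * 'X^(t (f j))).
  by rewrite -[in LHS](card_ord n) -prodr_const bigA_distr_bigA.
rewrite coef_sum [RHS]big_mkcond; apply: eq_bigr => f _.
rewrite big_split /= prodrXr -rmorph_prod coefCM coefXn eq_sym.
by case: eqP => _; rewrite ?mulr1 ?mulr0.
Qed.

(* The index [(m, s)] stands for the odd number [(-1)^s (2m + 1)]. *)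
Definition odd_of (n : nat) (i : 'I_n * bool) : int := (-1) ^+ i.2 * (i.1).*2.+1%:Z.

(** As 24 = 3 * 8, [tau] comes from the eighth power of Jacobi's series. The sign bit doubles the
    series, which accounts for 2^8, and turns the indices into all odd integers. *)
Lemma tau_odd_vectors n : 2 ^+ 8 * tau n.+1 =
  \sum_(f : {ffun 'I_8 -> 'I_n.+2 * bool} | (\sum_j 'C((f j).1.+1, 2) == n)%N)
    \prod_j ((-1) ^+ (f j).1 * (f j).1.*2.+1%:Z).
Proof.
rewrite tau_jac -(@coef_sum_exp _ (fun i : 'I_n.+2 * bool => (-1) ^+ i.1 * (i.1).*2.+1%:Z)
  (fun i : 'I_n.+2 * bool => 'C(i.1.+1, 2))).
rewrite -(pair_bigA _ (fun (m : 'I_n.+2) (s : bool) => ((-1) ^+ m * m.*2.+1%:Z)%:P * 'X^('C(m.+1,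
  2)))) /=.
have -> : \sum_(i < n.+2) \sum_(j : bool) ((-1) ^+ i * i.*2.+1%:Z)%:P * 'X^('C(i.+1, 2)) =
    2%:P * \sum_(m < n.+2) jac_term m :> {poly int}.
  rewrite big_distrr; apply: eq_bigr => m _; rewrite big_bool /= /jac_term.
  by rewrite polyCM rmorphXn /= polyCN -[m.*2.+1%:Z]natz polyC_natr; ring.
by rewrite exprMn -polyC_exp coefCM.
Qed.

Lemma odd_sqr_bin m : (m.*2.+1 ^ 2 = 8 * 'C(m.+1, 2) + 1)%N.
Proof.
elim: m => [|m IH]; first by rewrite bin_small.
by rewrite binS bin1; move: IH; rewrite -!mul2n; nia.
Qed.

Section OddVectors.
Variable n : nat.
Notation idx := ('I_n.+2 * bool)%type.

Let weight (f : {ffun 'I_8 -> idx}) : nat := \sum_j ((f j).1 + (f j).2).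
Let cond (f : {ffun 'I_8 -> idx}) : bool := (\sum_j 'C((f j).1.+1, 2) == n)%N.
Let vec (f : {ffun 'I_8 -> idx}) : {ffun 'I_8 -> int} := [ffun j => odd_of (f j)].
Let psi (f : {ffun 'I_8 -> idx}) : int := \prod_j ((-1) ^+ (f j).1 * (f j).1.*2.+1%:Z).

Let vecE f j : vec f j = odd_of (f j).
Proof. by rewrite ffunE. Qed.

Lemma odd_of_mod4 (i : idx) :
  exists q, odd_of i = 1 + 2 * (i.1 + i.2)%N%:Z + 4 * q.
Proof.
case: i => m [] /=; rewrite /odd_of /=.
  by exists (- m.+1%:Z); rewrite expr1; lia.
by exists 0; rewrite expr0; lia.
Qed.

(** Modulo 4 the entries are 1 + 2 (m_j + s_j), and the eight ones add up to 8. *)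
Let vec_inE8 f : inE8 (vec f) = ~~ odd (weight f).
Proof.
have /fin_all_exists[q Hq] j := odd_of_mod4 (f j).
rewrite /inE8.
have -> : [forall i, (2 %| vec f i - vec f 'i 0)%Z].
  by apply/forallP => i; rewrite !ffunE !Hq; lia.
have -> : \sum_i vec f i = 4 * (2 + \sum_j q j) + 2 * (weight f)%:Z.
  under eq_bigr do rewrite vecE Hq.
  rewrite !big_split /= -!big_distrr /= sumr_const card_ord /weight.
  by rewrite (big_morph Posz PoszD (erefl _)); ring.
by rewrite /=; move: (weight f) (2 + _) => w Q; lia.
Qed.

Let vec_norm f : (\sum_i vec f i ^+ 2 == (8 * n.+1)%N%:Z) = cond f.
Proof.
have -> : \sum_i vec f i ^+ 2 = (8 * (\sum_j 'C((f j).1.+1, 2)) + 8)%N%:Z.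
  under [LHS]eq_bigr do rewrite vecE /odd_of exprMn sqrr_sign mul1r.
  rewrite (eq_bigr (fun j => (8 * 'C((f j).1.+1, 2) + 1)%N%:Z)) => [|j _].
    rewrite -(big_morph Posz PoszD (erefl _)) big_split /= -big_distrr /=.
    by rewrite sum_nat_const card_ord.
  by rewrite -odd_sqr_bin -[RHS]natz natrX natz.
by rewrite /cond eqz_nat; apply/eqP/eqP; lia.
Qed.

(** Even weight makes the product of the signs (-1)^m equal to that of the signs (-1)^s. *)
Let psiE f : ~~ odd (weight f) -> psi f = \prod_i vec f i.
Proof.
move=> ev; rewrite /psi big_split /=.
under [RHS]eq_bigr do rewrite vecE /odd_of.
rewrite [RHS]big_split /=; congr (_ * _); rewrite !prodrXr.
rewrite -[LHS]signr_odd -[RHS]signr_odd; congr (_ ^+ nat_of_bool _).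
by move: ev; rewrite /weight big_split /= oddD; case: odd; case: odd.
Qed.

Let flip (f : {ffun 'I_8 -> idx}) : {ffun 'I_8 -> idx} :=
  [ffun j => if j == 'i 0 then ((f j).1, ~~ (f j).2) else f j].

Let flipK : involutive flip.
Proof.
move=> f; apply/ffunP => j; rewrite !ffunE; case: eqP => // _.
by case: (f j) => m s; rewrite /= negbK.
Qed.

Let flip1 f j : (flip f j).1 = (f j).1.
Proof. by rewrite ffunE; case: eqP. Qed.

Let flip_weight f : odd (weight (flip f)) = ~~ odd (weight f).
Proof.
rewrite /weight (bigD1 'i 0) //= [in RHS](bigD1 'i 0) //= !ffunE eqxx /=.
rewrite (eq_bigr (fun j => ((f j).1 + (f j).2)%N)) => [|j /negPf j0]; last first.
  by rewrite ffunE j0.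
by rewrite !oddD; case: (f 'i 0) => m [] /=; case: odd; case: odd.
Qed.

(** Flipping one sign bit exchanges the two parities of the weight and does not change [psi]. *)
Let sum_psi : \sum_(f | cond f) psi f = 2 * \sum_(f | cond f && ~~ odd (weight f)) psi f.
Proof.
rewrite (bigID (fun f => odd (weight f))) /= addrC mulr_natl mulr2n; congr (_ + _).
rewrite (reindex_inj (inv_inj flipK)) /=; apply: eq_big => [f|f _].
  rewrite flip_weight; congr (_ && _); congr (_ == _).
  by apply: eq_bigr => j _; rewrite flip1.
by apply: eq_bigr => j _; rewrite flip1.
Qed.

Let odd_part : E8moment n.+1 (fun X => if (2 %| X 'i 0)%Z then 0 else \prod_i X i) =
  \sum_(f | cond f && ~~ odd (weight f)) psi f.
Proof.
rewrite /E8moment.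
rewrite (eq_bigr (fun X : {ffun 'I_8 -> int} => if ~~ (2 %| X 'i 0)%Z then \prod_i X i else 0))
  => [|X _].
  2: by case: ifP.
rewrite -big_mkcond -big_filter /=.
pose F := enum [pred f | cond f && ~~ odd (weight f)].
have Hp : perm_eq (map vec F) [seq X : {ffun 'I_8 -> int} <- shellX n.+1 | ~~ (2 %| X 'i 0)%Z].
  apply: uniq_perm; rewrite ?filter_uniq ?uniq_box //.
    rewrite map_inj_uniq ?enum_uniq // => f g /ffunP E.
    apply/ffunP => j; have := E j; rewrite !vecE /odd_of.
    case: (f j) (g j) => [m s] [m' s'] /= Ejj.
    have sE : s = s' by case: s s' Ejj => -[] //; rewrite ?expr0 ?expr1; lia.
    rewrite sE in Ejj *; congr pair; apply: val_inj.
    by move: Ejj => /(can_inj (signrMK _)) /=; lia.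
  move=> X; rewrite mem_filter mem_shellX; apply/mapP/and3P => [[f]|[X0 HX NX]].
    rewrite mem_enum => /andP[Cf Wf] ->.
    rewrite vec_inE8 vec_norm Cf Wf; split => //.
    by rewrite vecE; have [q ->] := odd_of_mod4 (f 'i 0); lia.
  have /fin_all_exists[f Hf] j : exists i : idx, X j = odd_of i.
    have Xj : ~~ (2 %| X j)%Z.
      have := @shellX_parity n.+1 X j 'i 0; rewrite mem_shellX HX NX => /(_ isT).
      by move: X0; move: (X j) (X 'i 0) => x y; lia.
    have Nj : X j ^+ 2 <= 8 * n%:Z + 8.
      move/eqP: NX; rewrite (bigD1 j) //=.
      have : 0 <= \sum_(i < 8 | i != j) X i ^+ 2 by apply: sumr_ge0 => i _; exact: sqr_ge0.
      by move: (X j ^+ 2) (\sum_(i < 8 | _) _) => x y; lia.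
    have mlt : (`|X j|./2 < n.+2)%N.
      move: Xj Nj; case: (X j) => x; rewrite ?NegzE ?sqrrN /=; nia.
    exists (Ordinal mlt, X j < 0); rewrite /odd_of /=.
    by move: Xj; move: (X j) => x; case: ltP; rewrite ?expr0 ?expr1; lia.
  have XE : X = vec [ffun j => f j] by apply/ffunP => j; rewrite vecE ffunE.
  exists [ffun j => f j] => //.
  by rewrite mem_enum inE -vec_norm -vec_inE8 -XE HX NX.
rewrite -(perm_big _ Hp) big_map big_enum /=.
by apply: eq_bigr => f /andP[_ Wf]; rewrite psiE.
Qed.

(** On even vectors, negating x_0 alone changes the coordinate sum by a multiple of 4; it therefore
    preserves the lattice, and it negates the product. *)
Let even_part : E8moment n.+1 (fun X => if (2 %| X 'i 0)%Z then \prod_i X i else 0) = 0.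
Proof.
pose g (X : {ffun 'I_8 -> int}) : {ffun 'I_8 -> int} :=
  if (2 %| X 'i 0)%Z then [ffun i => if i == 'i 0 then - X i else X i] else X.
have gK : involutive g.
  move=> X; rewrite /g; case H: (2 %| X 'i 0)%Z; last by rewrite H.
  rewrite ffunE eqxx rpredN H; apply/ffunP => i; rewrite !ffunE.
  by case: (i == _); rewrite ?opprK.
have gS : {in shellX n.+1, forall X, g X \in shellX n.+1}.
  move=> X; rewrite !mem_shellX => /andP[/andP[/forallP H HS] /eqP NX].
  rewrite /g; case: ifP => X0; last by rewrite /inE8 HS NX eqxx andbT; apply/andP; split=> //;
    apply/forallP.
  apply/andP; split; last first.
    by rewrite -NX; apply/eqP/eq_bigr => i _; rewrite ffunE; case: eqP => // _; rewrite sqrrN.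
  apply/andP; split.
    apply/forallP => i; rewrite !ffunE eqxx; have := H i; move: X0.
    by case: (i == _); move: (X i) (X 'i 0) => x y; lia.
  move: HS; rewrite (bigD1 'i 0) //= [X in _ -> (_ %| X)%Z](bigD1 'i 0) //= ffunE eqxx.
  rewrite [X in _ -> (_ %| _ + X)%Z](eq_bigr X) => [|i /negPf i0]; last by rewrite ffunE i0.
  by move: X0; move: (X 'i 0) (\sum_(i < 8 | _) _) => x y; lia.
set f := (fun X : {ffun 'I_8 -> int} => _).
suff : E8moment n.+1 f = - E8moment n.+1 f by lia.
rewrite -{1}(E8moment_sym f gS gS (fun X _ => gK X) (fun X _ => gK X)).
rewrite -[RHS]sumrN; apply: eq_bigr => X _; rewrite /f /g /=.
case H: (2 %| X 'i 0)%Z; last by rewrite H oppr0.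
rewrite ffunE eqxx rpredN H (bigD1 'i 0) //= [in RHS](bigD1 'i 0) //= ffunE eqxx mulNr.
by congr (- (_ * _)); apply: eq_bigr => i /negPf i0; rewrite ffunE i0.
Qed.

Lemma shell_sum_tau : shell_sum n.+1 = 2 ^+ 7 * tau n.+1.
Proof.
apply: (@mulfI _ 2) => //; rewrite mulrA -exprS tau_odd_vectors -[RHS]/(\sum_(f | cond f) psi f).
rewrite sum_psi -odd_part -[E8moment _ _]addr0; congr (2 * _).
rewrite -[X in _ = _ + X]even_part /shell_sum /oprod.
rewrite (sum_oshell n.+1 (fun X => \prod_i X i)) /E8moment -big_split /=.
by apply: eq_bigr => X _; case: (2 %| X 'i 0)%Z; rewrite ?add0r ?addr0.
Qed.

End OddVectors.

(** * The values at prime powers as binary forms *)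

Lemma tau1 : tau 1 = 1.
Proof.
rewrite /tau /tau_partial coefXM /= big_nat1 -horner_coef0 horner_exp.
by rewrite !hornerE expr1n.
Qed.

Lemma tau_hecke (p n : nat) : prime p -> odd p -> (0 < n)%N ->
  tau (p * n) + (if (p %| n)%N then p%:Z ^+ 11 * tau (n %/ p) else 0) = tau p * tau n.
Proof.
move=> p_pr p_odd n0; have p0 := prime_gt0 p_pr.
have T k : (0 < k)%N -> shell_sum k = 2 ^+ 7 * tau k by case: k => // k _; exact: shell_sum_tau.
have := shell_sum_hecke n p_pr p_odd; rewrite (T (p * n)%N) ?muln_gt0 ?p0 // (T 1%N) // (T p) //
  (T n) // tau1.
have -> : (if (p %| n)%N then p%:Z ^+ 11 * shell_sum (n %/ p) else 0) =
    2 ^+ 7 * (if (p %| n)%N then p%:Z ^+ 11 * tau (n %/ p) else 0).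
  case: ifP => pn; last by rewrite mulr0.
  by rewrite T ?divn_gt0 // ?(dvdn_leq n0) // mulrCA.
move: (tau _) (if _ then _ else _) (tau p) (tau n) => x y z t E.
have nz : 2 ^+ 7 * 2 ^+ 7 != 0 :> int by [].
by apply: (mulfI nz); lra.
Qed.

Lemma tau_prime_power (p k : nat) : prime p -> odd p ->
  tau (p ^ k.+2) = tau p * tau (p ^ k.+1) - p%:Z ^+ 11 * tau (p ^ k).
Proof.
move=> p_pr p_odd; have p0 := prime_gt0 p_pr.
have := @tau_hecke p (p ^ k.+1) p_pr p_odd; rewrite expn_gt0 p0 => /(_ isT).
rewrite -expnS; have -> : (p %| p ^ k.+1)%N by rewrite expnS dvdn_mulr.
have -> : (p ^ k.+1 %/ p = p ^ k)%N by rewrite expnS mulKn.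
by move=> <-; rewrite addrK.
Qed.

(** For A = (alpha + beta)^2 and B = alpha beta this is (alpha^(2n+1) - beta^(2n+1)) / (alpha -
    beta); the recurrence has coefficients alpha^2 + beta^2 = A - 2B and (alpha beta)^2 = B^2. *)
Fixpoint tauF (R : comNzRingType) (n : nat) (A B : R) : R :=
  match n with
  | 0 => 1
  | n1.+1 => match n1 with
             | 0 => A - B
             | n2.+1 => (A - 2 * B) * tauF n1 A B - B ^+ 2 * tauF n2 A B
             end
  end.

Lemma tauFSS (R : comNzRingType) n (A B : R) :
  tauF n.+2 A B = (A - 2 * B) * tauF n.+1 A B - B ^+ 2 * tauF n A B.
Proof. by []. Qed.

Lemma tauF_ind (P : nat -> Prop) : P 0%N -> P 1%N ->
  (forall n, P n -> P n.+1 -> P n.+2) -> forall n, P n.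
Proof.
move=> P0 P1 PS n; suff [] : P n /\ P n.+1 by [].
by elim: n => [//|n [Pn PSn]]; split=> //; exact: PS.
Qed.

Lemma tau_even_power (p n : nat) : prime p -> odd p ->
  tau (p ^ (2 * n)) = tauF n (tau p ^+ 2) (p%:Z ^+ 11).
Proof.
move=> p_pr p_odd; have R := fun k => @tau_prime_power p k p_pr p_odd.
elim/tauF_ind: n => [|/=|n IH0 IH1]; first by rewrite muln0 expn0 tau1.
  by rewrite muln1 R expn1 expn0 tau1; ring.
rewrite tauFSS -IH0 -IH1.
have -> : (2 * n.+2 = (2 * n).+4)%N by lia.
have -> : (2 * n.+1 = (2 * n).+2)%N by lia.
by rewrite !(R _.+2) !(R _.+1) !R; ring.
Qed.

Lemma tauF_map (R S : comNzRingType) (f : {rmorphism R -> S}) n A B :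
  f (tauF n A B) = tauF n (f A) (f B).
Proof.
elim/tauF_ind: n => [|/=|n IH0 IH1]; first exact: rmorph1.
  by rewrite rmorphB.
by rewrite !tauFSS -IH0 -IH1; ring.
Qed.

Lemma tauF_homog (R : comNzRingType) n (c A B : R) :
  tauF n (c * A) (c * B) = c ^+ n * tauF n A B.
Proof.
elim/tauF_ind: n => [|/=|n IH0 IH1]; first by rewrite mul1r.
  by ring.
by rewrite !tauFSS IH0 IH1 !exprS; ring.
Qed.

Lemma tauF0r (R : comNzRingType) n (A : R) : tauF n A 0 = A ^+ n.
Proof.
elim/tauF_ind: n => [//|/=|n IH0 IH1]; first by rewrite subr0.
by rewrite tauFSS IH1 mulr0 subr0 expr0n mul0r subr0 -exprS.
Qed.

Lemma tauF0l (R : comNzRingType) n (B : R) : tauF n 0 B = (- B) ^+ n.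
Proof.
elim/tauF_ind: n => [//|/=|n IH0 IH1]; first by rewrite sub0r.
by rewrite tauFSS IH1 IH0 !exprS; ring.
Qed.

Lemma tauF_expand n : exists c : nat -> int, [/\ c 0%N = 1, c n = (-1) ^+ n &
  forall (R : comNzRingType) (A B : R),
    tauF n A B = \sum_(j < n.+1) (c j)%:~R * A ^+ (n - j) * B ^+ j].
Proof.
suff [] : (exists c : nat -> int, [/\ c 0%N = 1, c n = (-1) ^+ n, forall j, (n < j)%N -> c j = 0 &
  forall (R : comNzRingType) (A B : R),
    tauF n A B = \sum_(j < n.+1) (c j)%:~R * A ^+ (n - j) * B ^+ j]).
  by move=> c [c0 cn _ E]; exists c.
elim/tauF_ind: n => [||n [c [c0 cn cz Ec]] [d [d0 dn dz Ed]]].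
- exists (fun j => (j == 0%N)%:R); split => // [[|j]|R A B] //.
  by rewrite big_ord_recl big_ord0 /=; ring.
- exists (fun j => (j == 0%N)%:R - (j == 1%N)%:R); split => // [[|[|j]]|R A B] //.
  by rewrite !big_ord_recl big_ord0 /=; ring.
pose pre (f : nat -> int) j := if j is j1.+1 then f j1 else 0.
exists (fun j => d j - 2 * pre d j - pre (pre c) j); split => [||j jn|R A B].
- by rewrite /= d0; ring.
- by rewrite /= dz // dn cn !exprS; ring.
- by case: j jn => [|[|j]] //= jn; rewrite !dz ?cz //; lia.
have preE (f : nat -> int) m (g : nat -> R) :
    \sum_(j < m.+1) (pre f j)%:~R * g j = \sum_(j < m) (f j)%:~R * g j.+1.
  by rewrite big_ord_recl /= mul0r add0r; apply: eq_bigr.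
transitivity (\sum_(j < n.+3) (d j)%:~R * (A ^+ (n.+2 - j) * B ^+ j) -
    2 * \sum_(j < n.+3) (pre d j)%:~R * (A ^+ (n.+2 - j) * B ^+ j) -
    \sum_(j < n.+3) (pre (pre c) j)%:~R * (A ^+ (n.+2 - j) * B ^+ j)); last first.
  rewrite big_distrr -!sumrB; apply: eq_bigr => j _.
  by rewrite !rmorphB rmorphM /=; ring.
rewrite tauFSS Ec Ed (preE _ _ (fun j => A ^+ (n.+2 - j) * B ^+ j)).
rewrite (preE _ _ (fun j => A ^+ (n.+2 - j) * B ^+ j)).
rewrite (preE _ _ (fun j => A ^+ (n.+2 - j.+1) * B ^+ j.+1)).
rewrite [X in _ = X - _ - _]big_ord_recr /= dz // mul0r addr0 mulrBl; congr (_ - _ - _).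
- rewrite big_distrr; apply: eq_bigr => j _ /=.
  have jn : (j <= n.+1)%N by rewrite -ltnS.
  by rewrite (subSn jn) exprS; ring.
- rewrite -mulrA; congr (_ * _); rewrite big_distrr; apply: eq_bigr => j _ /=.
  by rewrite subSS exprS; ring.
rewrite big_distrr; apply: eq_bigr => j _ /=.
by rewrite !subSS !exprS; ring.
Qed.

Lemma tauF_bound n (A B M : int) : 1 <= M -> `|A| <= M -> `|B| <= M ->
  `|tauF n A B| <= (4 * M) ^+ n.
Proof.
move=> M1 HA HB; elim/tauF_ind: n => [|/=|n IH0 IH1]; first by rewrite normr1.
  by apply: le_trans (ler_normB _ _) _; rewrite expr1; lia.
rewrite tauFSS; apply: le_trans (ler_normB _ _) _; rewrite (normrM (A
  - 2 * B)) (normrM (B ^+ 2)) normrX.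
have HAB : `|A - 2 * B| <= 3 * M.
  by apply: le_trans (ler_normB _ _) _; rewrite normrM; lia.
have M0 : 0 <= 4 * M by lia.
apply: le_trans (_ : 3 * M * (4 * M) ^+ n.+1 + M ^+ 2 * (4 * M) ^+ n <= _).
  apply: lerD; apply: ler_pM; rewrite ?normr_ge0 ?exprn_ge0 ?normr_ge0 //.
  by rewrite lerXn2r ?nnegrE ?normr_ge0 //; lia.
rewrite !exprS; have := exprn_ge0 n M0; move: (_ ^+ n) => y y0.
nra.
Qed.

(** Coordinates on the shell are at most 8n in absolute value and the box has (16n + 1)^8 points,
    with 8n (16n + 1) <= 136 n^2. *)
Lemma tau_bound (n : nat) : (0 < n)%N -> `|tau n| <= ((136 * n ^ 2) ^ 8)%N%:Z.
Proof.
case: n => // n _; have := shell_sum_tau n; rewrite /shell_sum /oprod.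
rewrite (sum_oshell n.+1 (fun X => \prod_i X i)) => E.
have : `|2 ^+ 7 * tau n.+1| <= (((8 * n.+1) ^ 8) * (2 * (8 * n.+1)).+1 ^ 8)%N%:Z.
  rewrite -E; apply: le_trans (ler_norm_sum _ _ _) _.
  apply: le_trans (_ : \sum_(X <- shellX n.+1) ((8 * n.+1) ^ 8)%N%:Z <= _).
    rewrite big_seq [leRHS]big_seq; apply: ler_sum => X; rewrite mem_shellX => /andP[_ /eqP NX].
    have -> : ((8 * n.+1) ^ 8)%N%:Z = \prod_(i < 8) (8 * n.+1)%N%:Z.
      by rewrite prodr_const card_ord -natz natrX natz.
    rewrite normr_prod.
    by apply: ler_prod => i _; rewrite normr_ge0 coord_le_norm.
  rewrite -(big_morph Posz PoszD (erefl _)) lez_nat big_const_seq count_predT iter_addn_0 leq_mul2l.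
  by rewrite -size_box /shellX size_filter count_size orbT.
rewrite normrM => H; apply: le_trans (_ : `|2 ^+ 7| * `|tau n.+1| <= _).
  by rewrite ler_peMl // normr_ge0.
apply: le_trans H _; rewrite lez_nat -expnMn leq_exp2r //.
by rewrite expnS expn1; nia.
Qed.

(** * Integral points on the curves F(v ^ 2, u ^ 11) = N *)

Lemma horner_taylor2 (R : comNzRingType) (p : {poly R}) (x h : R) :
  exists r, p.[x + h] = p.[x] + h * (p^`().[x] + h * r).
Proof.
elim/poly_ind: p => [|p c [r E]]; first by exists 0; rewrite deriv0 !horner0; ring.
exists (r * x + p^`().[x] + h * r).
by rewrite derivD derivM derivX derivC !hornerE E; ring.
Qed.

Definition gpoly (R : comNzRingType) (n : nat) (Y N : R) : {poly R} :=
  tauF n ('X^2) Y%:P - N%:P.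

Lemma horner_gpoly (R : comNzRingType) n (Y N v : R) :
  (gpoly n Y N).[v] = tauF n (v ^+ 2) Y - N.
Proof.
rewrite /gpoly !hornerE -[_.[v]]/(horner_eval v _) tauF_map /= /horner_eval.
by rewrite !hornerE.
Qed.

Lemma map_gpoly (R S : comNzRingType) (f : {rmorphism R -> S}) n (Y N : R) :
  map_poly f (gpoly n Y N) = gpoly n (f Y) (f N).
Proof.
by rewrite /gpoly rmorphB /= tauF_map /= map_polyXn !map_polyC.
Qed.

Section Hensel.
Variables (l n : nat) (N e v0 : int).
Hypothesis l_pr : prime l.

(* Newton iteration for [v] as a function of [u], with [e] an inverse mod [l] of the
   derivative in [v]: this makes [v] a polynomial in [u] modulo powers of [l]. *)
Fixpoint hensel_poly (k : nat) : {poly int} :=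
  if k is k'.+1 then
    hensel_poly k' - e%:P * (tauF n (hensel_poly k' ^+ 2) ('X^11) - N%:P)
  else v0%:P.

Lemma horner_hensel k u : (hensel_poly k.+1).[u] =
  (hensel_poly k).[u] - e * (gpoly n (u ^+ 11) N).[(hensel_poly k).[u]].
Proof.
rewrite horner_gpoly /= !hornerE -[(tauF _ _ _).[u]]/(horner_eval u _) tauF_map /= /horner_eval.
by rewrite !hornerE.
Qed.

(** The constant [e] inverts the derivative modulo [l] only, so each Newton step gains a single
    factor [l]; in return the same polynomial serves all points above one residue pair. *)
Lemma hensel_cong (u v : int) :
  e%:~R * (gpoly n (u%:~R ^+ 11) N%:~R)^`().[v%:~R] = 1 :> 'F_l ->
  v%:~R = v0%:~R :> 'F_l -> tauF n (v ^+ 2) (u ^+ 11) = N ->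
  forall k, exists h, (hensel_poly k).[u] = v + l%:Z ^+ k.+1 * h.
Proof.
move=> He Hv HG; have root_v : (gpoly n (u ^+ 11) N).[v] = 0.
  by rewrite horner_gpoly HG subrr.
have [q Hq] : exists q, 1 - e * (gpoly n (u ^+ 11) N)^`().[v] = l%:Z * q.
  have : (1 - e * (gpoly n (u ^+ 11) N)^`().[v])%:~R == 0 :> 'F_l.
    rewrite rmorphB rmorphM /= -horner_map -deriv_map map_gpoly rmorphXn /= He.
    by rewrite subrr.
  by rewrite intr_Fp_eq0 // => /dvdzP[q ->]; exists q; rewrite mulrC.
elim=> [|k [h IH]].
  have : (v0 - v)%:~R == 0 :> 'F_l by rewrite rmorphB /= Hv subrr.
  rewrite intr_Fp_eq0 // => /dvdzP[h Hh]; exists h.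
  by rewrite /= hornerC -[LHS](subrK v) Hh; ring.
have [r Hr] := horner_taylor2 (gpoly n (u ^+ 11) N) v (l%:Z ^+ k.+1 * h).
exists (h * (q - e * (l%:Z ^+ k * h) * r)).
rewrite horner_hensel IH Hr root_v add0r.
transitivity (v + l%:Z ^+ k.+1 * h * (1 - e * (gpoly n (u ^+ 11) N)^`().[v]
   - e * (l%:Z ^+ k.+1 * h) * r)); first by ring.
by rewrite Hq !exprS; ring.
Qed.

End Hensel.

(** * The determinant method *)

Section Cofactor.
Variables (d : nat) (u : 'I_d.+1 -> int).

Definition vdm : 'M[int]_d.+1 := Vandermonde d.+1 (\row_j u j).

(** The sums of [w j * cof j] below are the determinants with rows 1, u, ..., u^(d-1), w, expanded
    along the last row. *)
Definition cof (j : 'I_d.+1) : int := cofactor vdm ord_max j.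

Lemma cof_expr i : (i < d.+1)%N ->
  \sum_j u j ^+ i * cof j = (\det vdm) *+ (i == d)%N.
Proof.
move=> id; have := congr1 (fun M : 'M[int]_(d.+1) => M (Ordinal id) ord_max) (mul_mx_adj vdm).
rewrite !mxE -val_eqE /= => <-; apply: eq_bigr => j _.
by rewrite !mxE.
Qed.

Lemma cof_poly_small (R : {poly int}) : (size R <= d.+1)%N ->
  \sum_j R.[u j] * cof j = R`_d * \det vdm.
Proof.
move=> sR; under eq_bigr do rewrite (horner_coef_wide _ sR) big_distrl /=.
rewrite exchange_big /= (bigD1 ord_max) //= [X in _ + X]big1 => [|i iN].
  by under eq_bigr do rewrite -mulrA; rewrite -big_distrr /= cof_expr // eqxx addr0.
under eq_bigr do rewrite -mulrA.
rewrite -big_distrr /= cof_expr //.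
by rewrite -[d]/(nat_of_ord (@ord_max d)) val_eqE (negPf iN) mulr0n mulr0.
Qed.

(** Reduction modulo prod_j (X - u_j) changes none of the values and leaves degree at most [d],
    where the determinant is the coefficient of X^d times the Vandermonde determinant. *)
Lemma cof_poly (P : {poly int}) : exists q, \sum_j P.[u j] * cof j = q * \det vdm.
Proof.
pose w := \prod_j ('X - (u j)%:P).
have w_monic : w \is monic by exact: monic_prod_XsubC.
have sw : size w = d.+2 by rewrite size_prod_XsubC /index_enum -enumT size_enum_ord.
pose r := Pdiv.Ring.rmodp P w.
have sr : (size r <= d.+1)%N.
  by rewrite -ltnS -sw Pdiv.Ring.ltn_rmodp monic_neq0.
exists r`_d; rewrite -cof_poly_small //; apply: eq_bigr => j _; congr (_ * _).
rewrite {1}(Pdiv.RingMonic.rdivp_eq w_monic P) hornerD hornerM.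
suff -> : w.[u j] = 0 by rewrite mulr0 add0r.
by rewrite horner_prod (bigD1 j) //= !hornerE subrr mul0r.
Qed.

Lemma cof_bound (U : int) : 1 <= U -> (forall j, `|u j| <= U) ->
  forall j, `|cof j| <= d`!%:Z * U ^+ 'C(d, 2).
Proof.
move=> U1 HU j; rewrite /cof /cofactor normrM normrX normrN1 expr1n mul1r.
rewrite /determinant; apply: le_trans (ler_norm_sum _ _ _) _.
apply: le_trans (_ : \sum_(s : 'S_d) U ^+ 'C(d, 2) <= _); last first.
  by rewrite sumr_const card_Sn -mulr_natl natz.
apply: ler_sum => s _; rewrite normrM normrX normrN1 expr1n mul1r normr_prod.
have -> : U ^+ 'C(d, 2) = \prod_(i < d) U ^+ i by rewrite prodrXr -bin2_sum big_mkord.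
apply: ler_prod => i _; rewrite normr_ge0 !mxE normrX /=.
have -> : bump d i = i by rewrite /bump leqNgt ltn_ord.
by rewrite lerXn2r ?nnegrE ?normr_ge0 ?HU //; lia.
Qed.

Lemma vdm_dvd (l : int) : (forall i j, (l %| u i - u j)%Z) ->
  (l ^+ 'C(d.+1, 2) %| \det vdm)%Z.
Proof.
move=> Hl; have -> : l ^+ 'C(d.+1, 2) = \prod_(i < d.+1) \prod_(j < d.+1 | (i < j)%N) l.
  rewrite (exchange_big_dep predT) //= -bin2_sum big_mkord -prodrXr.
  apply: eq_bigr => j _; rewrite (big_ord_narrow (ltnW (ltn_ord j))).
  by rewrite prodr_const card_ord.
rewrite det_Vandermonde.
elim/big_rec2: _ => // i x y _ xy; apply: dvdz_mul => //.
elim/big_rec2: _ => // j x' y' _ xy'; apply: dvdz_mul => //.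
by rewrite !mxE.
Qed.

Lemma vdm_neq0 : injective u -> \det vdm != 0.
Proof.
move=> u_inj; rewrite det_Vandermonde; apply/prodf_neq0 => i _; apply/prodf_neq0 => j ij.
rewrite !mxE subr_eq0; apply: contraTneq ij => /u_inj ->.
by rewrite ltnn.
Qed.

End Cofactor.

Lemma dvdz_small (m x : int) : (m %| x)%Z -> `|x| < m -> x = 0.
Proof.
case/dvdzP=> q ->; rewrite normrM => H; case: (eqVneq q 0) => [->|q0]; first by rewrite mul0r.
have : 1 <= `|q| by rewrite -gtz0_ge1 normr_gt0.
by move: (ler_norm m) (normr_ge0 m) H; move: `|q| `|m| => a b *; nia.
Qed.

Lemma cluster_vanish (l n d : nat) (N U V : int) (a b : 'F_l)
    (u v : 'I_d.+1 -> int) : prime l ->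
  (forall j, (u j)%:~R = a) -> (forall j, (v j)%:~R = b) ->
  (forall j, tauF n (v j ^+ 2) (u j ^+ 11) = N) ->
  (gpoly n (a ^+ 11) N%:~R)^`().[b] != 0 ->
  1 <= U -> (forall j, `|u j| <= U) -> (forall j, `|v j| <= V) ->
  d.+1%:Z * V * (d`!%:Z * U ^+ 'C(d, 2)) < l%:Z ^+ 'C(d.+1, 2) ->
  \sum_j v j * cof u j = 0.
Proof.
move=> l_pr ua vb curve nsing U1 uU vV small.
have lift_int (x : 'F_l) : exists y : int, y%:~R = x.
  by exists (nat_of_ord x)%:Z; rewrite -pmulrn; exact: natr_Zp.
have [e He] := lift_int ((gpoly n (a ^+ 11) N%:~R)^`().[b])^-1.
have [v0 Hv0] := lift_int b.
pose M := 'C(d.+1, 2).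
have /fin_all_exists[h Hh] j : exists h,
    (hensel_poly n N e v0 M).[u j] = v j + l%:Z ^+ M.+1 * h.
  by apply: hensel_cong => //; rewrite ?ua ?vb ?Hv0 // He mulVf.
apply: (@dvdz_small (l%:Z ^+ M)).
  have -> : \sum_j v j * cof u j = \sum_j (hensel_poly n N e v0 M).[u j] * cof u j -
      l%:Z ^+ M * (l%:Z * \sum_j h j * cof u j).
    rewrite !big_distrr -sumrB; apply: eq_bigr => j _ /=.
    by rewrite Hh exprS; ring.
  have [q ->] := cof_poly u (hensel_poly n N e v0 M).
  apply: rpredB; last exact: dvdz_mulr.
  apply: dvdz_mull; apply: vdm_dvd => i j.
  by rewrite -intr_Fp_eq0 // rmorphB /= !ua subrr.
apply: le_lt_trans small; apply: le_trans (ler_norm_sum _ _ _) _.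
apply: le_trans (_ : \sum_(j < d.+1) V * (d`!%:Z * U ^+ 'C(d, 2)) <= _).
  apply: ler_sum => j _; rewrite normrM; apply: ler_pM => //.
  exact: cof_bound.
by rewrite sumr_const card_ord -mulr_natl natz mulrA.
Qed.

Lemma tauF_size_gt (R : idomainType) n (A B : {poly R}) : (size B < size A)%N ->
  size (tauF n A B) = (n * (size A).-1).+1.
Proof.
move=> ltBA; have A0 : A != 0 by rewrite -size_poly_gt0 (leq_ltn_trans _ ltBA).
have [c [c0 _ ->]] := tauF_expand n.
have sA : size (A ^+ n) = (n * (size A).-1).+1.
  have An0 : A ^+ n != 0 by rewrite expf_neq0.
  by have := size_exp A n; rewrite mulnC => <-; rewrite prednK // size_poly_gt0.
rewrite big_ord_recl /= c0 subn0 expr0 mulr1 mul1r size_polyDl ?sA //.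
rewrite ltnS; apply: leq_trans (size_sum _ _ _) _; apply/bigmax_leqP => j _.
have [->|B0] := eqVneq B 0; first by rewrite expr0n mulr0 size_poly0.
rewrite -mulrA mulrzl -scaler_int; apply: leq_trans (size_scale_leq _ _) _.
have jn := ltn_ord j; rewrite /bump /= ?add1n.
have [Ap Bp] : A ^+ (n - j.+1) != 0 /\ B ^+ j.+1 != 0 by rewrite !expf_neq0.
rewrite size_mul //.
have := size_exp A (n - j.+1); have := size_exp B j.+1.
move: Ap Bp; rewrite -!size_poly_gt0; rewrite -size_poly_gt0 in B0.
move: (size (A ^+ _)) (size (B ^+ _)) (size A) (size B) ltBA B0 => x y s t.
case: s => [//|s]; case: t => [//|t]; case: x => [//|x]; case: y => [//|y] /=.
move=> ts _ _ _ -> ->; rewrite addnS /=.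
have := subnK jn; move: (n - j.+1)%N => k nE.
by rewrite -[X in (_ < X * _)%N]nE; move: (nat_of_ord j) => i; nia.
Qed.

Lemma tauF_size_lt (R : idomainType) n (A B : {poly R}) : (size A < size B)%N ->
  size (tauF n A B) = (n * (size B).-1).+1.
Proof.
move=> ltAB; have B0 : B != 0 by rewrite -size_poly_gt0 (leq_ltn_trans _ ltAB).
have [c [_ cn ->]] := tauF_expand n.
have sB : size ((c n)%:~R * A ^+ (n - n) * B ^+ n) = (n * (size B).-1).+1.
  rewrite cn subnn expr0 mulr1 rmorphXn rmorphN1 size_Msign.
  have Bn0 : B ^+ n != 0 by rewrite expf_neq0.
  by have := size_exp B n; rewrite mulnC => <-; rewrite prednK // size_poly_gt0.
rewrite big_ord_recr /= addrC size_polyDl ?sB //.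
rewrite ltnS; apply: leq_trans (size_sum _ _ _) _; apply/bigmax_leqP => j _.
have jn := ltn_ord j.
have [->|A0] := eqVneq A 0.
  by rewrite expr0n subn_eq0 (leqNgt n j) jn mulr0 mul0r size_poly0.
rewrite -mulrA mulrzl -scaler_int; apply: leq_trans (size_scale_leq _ _) _.
have [Ap Bp] : A ^+ (n - j) != 0 /\ B ^+ j != 0 by rewrite !expf_neq0.
rewrite size_mul //.
have := size_exp A (n - j); have := size_exp B j.
move: Ap Bp; rewrite -!size_poly_gt0; rewrite -size_poly_gt0 in A0.
move: (size (A ^+ _)) (size (B ^+ _)) (size A) (size B) ltAB A0 => x y s t.
case: s => [//|s]; case: t => [//|t]; case: x => [//|x]; case: y => [//|y] /=.
move=> st _ _ _ -> ->; rewrite addnS /=.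
have := subnK (ltnW jn); have : (0 < n - j)%N by rewrite subn_gt0.
move: (n - j)%N => k k0 nE.
by rewrite -[X in (_ < X * _)%N]nE; move: (nat_of_ord j) => i; nia.
Qed.

Lemma Vandermonde_neq0 (k : nat) (u : 'I_k -> int) : injective u ->
  \det (Vandermonde k (\row_j u j)) != 0.
Proof.
move=> u_inj; rewrite det_Vandermonde; apply/prodf_neq0 => i _; apply/prodf_neq0 => j ij.
rewrite !mxE subr_eq0; apply: contraTneq ij => /u_inj ->.
by rewrite ltnn.
Qed.

(** Lagrange interpolation with denominators cleared by the Vandermonde determinant [c]. *)
Lemma interpolation_multiple (d : nat) (u w : 'I_d -> int) : injective u ->
  exists c : int, exists R : {poly int},
    [/\ c != 0, (size R <= d)%N & forall j, R.[u j] = c * w j].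
Proof.
move=> u_inj; pose W := Vandermonde d (\row_j u j).
pose C := (\row_j w j) *m \adj W.
exists (\det W); exists (rVpoly C); split; first exact: Vandermonde_neq0.
  exact: size_poly.
move=> j; have sC : (size (rVpoly C) <= d)%N by exact: size_poly.
rewrite (horner_coef_wide _ sC).
have := congr1 (fun M : 'rV[int]_d => M 0 j) (mulmxA (\row_j w j) (\adj W) W).
rewrite mul_adj_mx mul_mx_scalar !mxE => ->; apply: eq_bigr => i _.
by rewrite coef_rVpoly_ord !mxE.
Qed.

Lemma interpolation_extend (d : nat) (u : 'I_d.+1 -> int) (w : 'I_d.+1 -> int)
    (c : int) (R : {poly int}) :
  injective u -> (size R <= d)%N -> \sum_j w j * cof u j = 0 ->
  (forall j, j != ord_max -> R.[u j] = c * w j) -> R.[u ord_max] = c * w ord_max.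
Proof.
move=> u_inj sR W0 HR.
have cof_nz : cof u ord_max != 0.
  pose P := \prod_(j < d) ('X - (u (widen_ord (leqnSn d) j))%:P).
  have sP : size P = d.+1 by rewrite size_prod_XsubC /index_enum -enumT size_enum_ord.
  have lP : P`_d = 1.
    have : P \is monic by exact: monic_prod_XsubC.
    by rewrite monicE lead_coefE sP => /eqP.
  have := cof_poly_small u (eq_leq sP); rewrite lP mul1r => E.
  apply: contraNneq (vdm_neq0 u_inj) => cof0; rewrite -E big_ord_recr /= cof0 mulr0 addr0.
  rewrite big1 // => j _; rewrite /P horner_prod (bigD1 j) //= hornerXsubC subrr.
  by rewrite !mul0r.
apply/eqP; rewrite -subr_eq0; apply/eqP/(mulIf cof_nz).
have : \sum_j (R.[u j] - c * w j) * cof u j = 0.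
  under eq_bigr do rewrite mulrBl -mulrA.
  rewrite sumrB -big_distrr /= W0 mulr0 subr0 cof_poly_small; last exact: leq_trans sR _.
  by rewrite nth_default // mul0r.
rewrite (bigD1 ord_max) //= [X in _ + X]big1 ?addr0 ?mul0r // => j jN.
by rewrite HR // subrr mul0r.
Qed.

(** Interpolation at the first [d] points, extended by the vanishing determinants, gives R(x) = c
    v(x) on all of [s], so every x is a root of F(R^2, c^2 X^11) - c^(2n) N. Since 2 deg R and 11
    differ by parity, the leading terms cannot cancel and the degree is n max(2 deg R, 11). *)
Lemma cluster_size (l n d : nat) (N V : int) (U : nat) (a b : 'F_l) (s : seq int)
    (v : int -> int) : prime l -> (0 < n)%N -> uniq s -> N != 0 ->
  {in s, forall x, [/\ x%:~R = a, (v x)%:~R = b, 0 <= x <= U%:Z, `|v x| <= V &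
     tauF n (v x ^+ 2) (x ^+ 11) = N]} ->
  (gpoly n (a ^+ 11) N%:~R)^`().[b] != 0 -> (0 < U)%N ->
  d.+1%:Z * V * (d`!%:Z * U%:Z ^+ 'C(d, 2)) < l%:Z ^+ 'C(d.+1, 2) ->
  (size s <= n * (2 * d + 11))%N.
Proof.
move=> l_pr n0 us N0 Hs nsing U0 small.
have [le|gt] := leqP (size s) d; first by nia.
pose u (j : 'I_d) := nth 0 s j.
have u_inj : injective u.
  move=> i j E; apply: val_inj; apply/eqP; rewrite -(nth_uniq 0 _ _ us) ?(leq_trans (ltn_ord _)
    (ltnW gt)) //.
  exact/eqP.
have [c [R [c0 sR HR]]] := interpolation_multiple (fun j => v (u j)) u_inj.
have HRs x : x \in s -> R.[x] = c * v x.
  move=> xs; have [|xb] := boolP (x \in take d s).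
    move=> /(nthP 0)[j]; rewrite size_take gt => jd; rewrite nth_take // => <-.
    exact: (HR (Ordinal jd)).
  pose u' (j : 'I_d.+1) := nth 0 (rcons (take d s) x) j.
  have sz : size (rcons (take d s) x) = d.+1 by rewrite size_rcons size_take gt.
  have uu : uniq (rcons (take d s) x) by rewrite rcons_uniq xb take_uniq.
  have u'_inj : injective u'.
    move=> i j E; apply: val_inj; apply/eqP.
    by rewrite -(nth_uniq 0 _ _ uu) ?sz ?ltn_ord //; apply/eqP; exact: E.
  have u's j : u' j \in s.
    have : u' j \in rcons (take d s) x by rewrite mem_nth ?sz.
    by rewrite mem_rcons inE => /orP[/eqP -> //|/mem_take].
  have u'x : u' ord_max = x by rewrite /u' nth_rcons size_take gt ltnn eqxx.
  rewrite -u'x; apply: (interpolation_extend (w := fun j => v (u' j)) u'_inj sR).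
    apply: (cluster_vanish (N := N) (U := U%:Z) (V := V) (a := a) (b := b) l_pr _ _ _ nsing) => //.
    - by move=> j; have [] := Hs _ (u's j).
    - by move=> j; have [] := Hs _ (u's j).
    - by move=> j; have [] := Hs _ (u's j).
    - by move=> j; have [_ _ /andP[? ?] _ _] := Hs _ (u's j); rewrite ger0_norm.
    - by move=> j; have [] := Hs _ (u's j).
  move=> j jN; have jd : (j < d)%N.
    by rewrite ltn_neqAle -ltnS ltn_ord andbT; apply: contra_neq jN => jd; exact: val_inj.
  have -> : u' j = u (Ordinal jd).
    by rewrite /u' nth_rcons size_take gt jd nth_take.
  exact: HR.
pose B := (c ^+ 2)%:P * 'X^11 : {poly int}.
pose H := tauF n (R ^+ 2) B - ((c ^+ 2) ^+ n * N)%:P.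
have c2 : c ^+ 2 != 0 by rewrite expf_neq0.
have sB : size B = 12%N by rewrite /B mul_polyC size_scale // size_polyXn.
have [m [sT mlo mhi]] : exists m, [/\ size (tauF n (R ^+ 2) B) = (n * m).+1,
    (11 <= m)%N & (m <= 2 * d + 11)%N].
  have sR2 : (size (R ^+ 2) <= (2 * d).+1)%N.
    have := size_exp R 2; have := sR; move: (size (R ^+ 2)) (size R) => x y; lia.
  have [lt|gt'|eq] := ltngtP (size (R ^+ 2)) (size B).
  - by exists 11%N; rewrite tauF_size_lt // sB; split=> //; lia.
  - exists (size (R ^+ 2)).-1; rewrite tauF_size_gt //; split=> //.
      by move: gt'; rewrite sB; lia.
    by move: sR2; lia.
  - by have := size_exp R 2; rewrite eq sB; lia.
have sC : (size ((c ^+ 2) ^+ n * N)%:P <= 1)%N by exact: size_polyC_leq1.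
have sH : size H = (n * m).+1.
  rewrite size_polyDl ?sT // size_polyN; apply: leq_ltn_trans sC _.
  by rewrite ltnS muln_gt0 n0; lia.
have H0 : H != 0 by rewrite -size_poly_gt0 sH.
have := max_poly_roots H0 _ us; rewrite sH ltnS => le.
apply: leq_trans (le _) _; last by rewrite leq_pmul2l.
apply/allP => x xs; rewrite /root /H hornerD hornerN hornerC.
rewrite -[(tauF _ _ _).[x]]/(horner_eval x _) tauF_map /= /horner_eval horner_exp.
rewrite /B hornerM hornerC hornerXn HRs // exprMn tauF_homog.
by have [_ _ _ _ ->] := Hs x xs; rewrite subrr.
Qed.

Lemma size_gpoly (F : idomainType) n (Y N : F) : (0 < n)%N -> size (gpoly n Y N) = (2 * n).+1.
Proof.
move=> n0; have sT : size (tauF n ('X^2) Y%:P) = (2 * n).+1.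
  rewrite tauF_size_gt ?size_polyXn ?(leq_ltn_trans (size_polyC_leq1 _)) //.
  by rewrite mulnC.
rewrite /gpoly size_polyDl ?sT // size_polyN.
by apply: leq_ltn_trans (size_polyC_leq1 _) _; rewrite ltnS muln_gt0.
Qed.

Lemma card_root (F : finFieldType) (p : {poly F}) : p != 0 ->
  (\sum_(x | root p x) 1 < size p)%N.
Proof.
move=> p0; rewrite sum1_card cardE.
apply: max_poly_roots => //; last exact: enum_uniq.
by apply/allP => x; rewrite mem_enum.
Qed.

(** * Singular points modulo l *)

Section SingularFibres.
Variables (F : finFieldType) (n : nat) (N : F).
Hypotheses (n0 : (0 < n)%N) (N0 : N != 0) (nF : n%:R != 0 :> F) (two : 2 != 0 :> F).

Definition singular_fibre (a : F) : bool :=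
  [exists b, root (gpoly n (a ^+ 11) N) b && root (gpoly n (a ^+ 11) N)^`() b].

Let phi : {poly F} := tauF n 'X 1.

Let size_phi : size phi = n.+1.
Proof. by rewrite /phi tauF_size_gt ?size_polyX ?size_poly1 // muln1. Qed.

Let phi_comp (q : {poly F}) : phi \Po q = tauF n q 1.
Proof.
rewrite -[LHS]/(comp_poly q phi) tauF_map /= comp_polyX.
by rewrite rmorph1.
Qed.

Let gpoly_phi Y : Y != 0 ->
  gpoly n Y N = (Y ^+ n)%:P * (phi \Po (Y^-1%:P * 'X^2)) - N%:P.
Proof.
move=> Y0; rewrite /gpoly phi_comp polyC_exp -tauF_homog mulr1.
by rewrite mulrA -polyCM mulfV // mul1r.
Qed.

Let dphi0 : phi^`() != 0.
Proof.
apply/eqP => /(congr1 (fun p : {poly F} => p`_n.-1)); rewrite coef_deriv prednK // coef0.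
move/eqP; rewrite -mulr_natr mulf_eq0 (negPf nF) orbF.
by rewrite -[n]/(n.+1.-1) -size_phi -lead_coefE lead_coef_eq0 -size_poly_eq0 size_phi.
Qed.

Let crit (t : F) := (t == 0) || root phi^`() t.

Let card_crit : (\sum_(t | crit t) 1 <= n)%N.
Proof.
have s' : (size phi^`() <= n)%N.
  by rewrite -ltnS -size_phi lt_size_deriv // -size_poly_eq0 size_phi.
rewrite (bigD1 0) ?/crit ?eqxx //= add1n.
apply: leq_trans s'; apply: leq_ltn_trans (card_root dphi0).
rewrite !sum1_card; apply: subset_leq_card; apply/fintype.subsetP => t.
by rewrite /in_mem /= => /andP[/orP[-> //|rt _]]; exact: rt.
Qed.

(** With Y = a^11, homogeneity gives [gpoly] as Y^n phi(T^2 / Y) - N. At a double root b the point t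
    = b^2 / Y is 0 or a critical point of [phi], and the equation becomes phi(t) a^(11n) = N. *)
Lemma singular_critical a : singular_fibre a -> a != 0 ->
  exists2 t, crit t & root (phi.[t]%:P * 'X^(11 * n) - N%:P) a.
Proof.
move=> /existsP[b /andP[/rootP g0 /rootP g1]] a0.
have Y0 : a ^+ 11 != 0 by rewrite expf_neq0.
pose t := (a ^+ 11)^-1 * b ^+ 2; exists t.
  have : (a ^+ 11) ^+ n * (phi^`().[t] * ((a ^+ 11)^-1 * (2 * b))) = 0.
    rewrite -g1 gpoly_phi // derivB derivC subr0 derivM derivC mul0r add0r.
    rewrite deriv_comp derivM derivC mul0r add0r derivXn !hornerM.
    by rewrite horner_comp hornerM !hornerC hornerXn -/t hornerMn hornerX -[b *+ 2]mulr_natl.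
  move/eqP; rewrite !mulf_eq0 expf_eq0 invr_eq0 (negPf Y0) (negPf two) andbF /=.
  by rewrite /crit => /orP[rt|/eqP b0]; apply/orP; [right|left; rewrite /t b0 expr0n mulr0].
move: g0; rewrite gpoly_phi // hornerD hornerN hornerC hornerM hornerC horner_comp.
rewrite hornerM hornerC hornerXn -/t => g0; apply/rootP.
by rewrite hornerD hornerN hornerM !hornerC hornerXn exprM mulrC.
Qed.

(** The residue 0, then for each of at most [n] values [t] the at most 11n roots of phi(t) X^(11n) -
    N, which is nonzero because of its constant term. *)
Lemma card_singular : (\sum_(a | singular_fibre a) 1 <= 1 + n * (11 * n))%N.
Proof.
pose cnt (a : F) : nat := (\sum_(t | crit t) root (phi.[t]%:P * 'X^(11 * n) - N%:P)%R a)%N.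
apply: (@leq_trans (\sum_(a : F) ((a == 0%R) + cnt a))%N).
  rewrite big_mkcond; apply: leq_sum => a _; case: ifP => // sa.
  have [//|a0] := eqVneq a 0.
  by have [t ct ra] := singular_critical sa a0; rewrite /cnt (bigD1 t) //= ra.
rewrite big_split /=; apply: leq_add.
  by rewrite (bigD1 0) //= eqxx big1 // => a /negPf ->.
rewrite /cnt exchange_big /=; apply: leq_trans (_ : \sum_(t | crit t) (11 * n) <= _)%N.
  apply: leq_sum => t _; set p := phi.[t]%:P * 'X^(11 * n) - N%:P.
  have -> : (\sum_(a : F) root p a = \sum_(a | root p a) 1)%N.
    by rewrite [RHS]big_mkcond; apply: eq_bigr => a _; case: root.
  have n11 : (0 < 11 * n)%N by rewrite muln_gt0.
  have p0 : p != 0.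
    apply/eqP => /(congr1 (fun q : {poly F} => q`_0)).
    rewrite coef0 coefB coefMXn n11 coefC eqxx sub0r => /eqP.
    by rewrite oppr_eq0 (negPf N0).
  have sp : (size p <= (11 * n).+1)%N.
    apply: leq_trans (size_polyD _ _) _; rewrite geq_max size_polyN.
    rewrite (leq_trans (size_polyC_leq1 _)) // andbT mul_polyC.
    by apply: leq_trans (size_scale_leq _ _) _; rewrite size_polyXn.
  by rewrite -ltnS; apply: leq_trans (card_root p0) sp.
by move: card_crit; rewrite sum1_card sum_nat_const; move=> le_n; exact: leq_mul le_n (leqnn _).
Qed.

End SingularFibres.

Lemma count_fibre (T : Type) (F : finType) (f : T -> F) (P : pred T) (s : seq T) :
  count P s = (\sum_a count (fun x => P x && (f x == a)) s)%N.
Proof.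
elim: s => [|x s IH] /=; first by rewrite big1.
rewrite big_split /= -IH; congr (_ + _)%N.
rewrite (bigD1 (f x)) //= eqxx andbT big1 ?addn0 // => a.
by rewrite eq_sym => /negPf ->; rewrite andbF.
Qed.

Lemma count_residue (l U : nat) (a : 'F_l) (s : seq int) : prime l -> uniq s ->
  {in s, forall x, 0 <= x <= U%:Z} ->
  (count (fun x : int => x%:~R == a) s <= U %/ l + 1)%N.
Proof.
move=> l_pr us Hs; rewrite -size_filter; set r := seq.filter _ _.
have l0 := prime_gt0 l_pr.
have r_uniq : uniq r by exact: filter_uniq.
have inj : {in r &, injective (fun x : int => (`|x| %/ l)%N)}.
  move=> x y; rewrite !mem_filter => /andP[/eqP xa /Hs/andP[x0 _]] /andP[/eqP ya /Hs/andP[y0 _]].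
  move=> E; have : (x - y)%:~R == 0 :> 'F_l by rewrite rmorphB /= xa ya subrr.
  rewrite intr_Fp_eq0 // -[x]gez0_abs // -[y]gez0_abs // => /dvdzP[q Hq].
  have := divn_eq `|x| l; have := divn_eq `|y| l.
  have := ltn_pmod `|x| l0; have := ltn_pmod `|y| l0.
  move: Hq E; move: (`|x| %/ l)%N (`|x| %% l)%N (`|y| %/ l)%N (`|y| %% l)%N => k1 r1 k2 r2.
  move=> Hq -> lt1 lt2 E1 E2; congr Posz; rewrite E1 E2; congr (_ + _)%N.
  rewrite E1 E2 in Hq; have Hq' : r1%:Z - r2%:Z = q * l%:Z by move: Hq; lia.
  have q0 : q = 0 by nia.
  by move: Hq'; rewrite q0; lia.
rewrite -(size_map (fun x : int => (`|x| %/ l)%N)) -(size_iota 0 (U %/ l + 1)).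
apply: uniq_leq_size; first by rewrite map_inj_in_uniq.
move=> k /mapP[x]; rewrite mem_filter => /andP[_ /Hs/andP[x0 xU]] ->.
by rewrite mem_iota /= add0n addn1 ltnS leq_div2r //; lia.
Qed.

(** A residue [a] with nonsingular fibre has at most 2n residues [b] above it, each bounded by
    [cluster_size]. In a singular fibre all the integers of the residue class are counted. *)
Lemma curve_count (l n d U : nat) (N V : int) (s : seq int) (v : int -> int) :
  prime l -> odd l -> ~~ (l %| n)%N -> ~~ (l%:Z %| N)%Z -> uniq s ->
  {in s, forall x, [/\ 0 <= x <= U%:Z, `|v x| <= V & tauF n (v x ^+ 2) (x ^+ 11) = N]} ->
  (0 < U)%N -> d.+1%:Z * V * (d`!%:Z * U%:Z ^+ 'C(d, 2)) < l%:Z ^+ 'C(d.+1, 2) ->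
  (size s <= l * (2 * n * (n * (2 * d + 11))) + (1 + n * (11 * n)) * (U %/ l + 1))%N.
Proof.
move=> l_pr l_odd ln lN us Hs U0 small.
have n0 : (0 < n)%N by rewrite lt0n; apply: contraNneq ln => ->; exact: dvdn0.
have N0 : N%:~R != 0 :> 'F_l by rewrite intr_Fp_eq0.
have nF : n%:R != 0 :> 'F_l by rewrite pmulrn intr_Fp_eq0.
have two : 2 != 0 :> 'F_l.
  rewrite pmulrn intr_Fp_eq0 //; apply/negP; rewrite -[(_ %| _)%Z]/(l %| 2)%N.
  by rewrite dvdn_prime2 // => /eqP E; rewrite E in l_odd.
rewrite -(count_predT s) (count_fibre (fun x : int => x%:~R : 'F_l)) /=.
rewrite (bigID (singular_fibre n (N%:~R : 'F_l))) /= addnC; apply: leq_add; last first.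
  apply: leq_trans (_ : \sum_(a | singular_fibre n (N%:~R : 'F_l) a) (U %/ l + 1) <= _)%N.
    by apply: leq_sum => a _; apply: count_residue => // x /Hs[].
  rewrite sum_nat_const leq_mul2r -sum1_card.
  by rewrite (card_singular n0 N0 nF two) orbT.
apply: leq_trans (_ : \sum_(a : 'F_l) (2 * n * (n * (2 * d + 11))) <= _)%N; last first.
  by rewrite sum_nat_const card_Fp // leqnn.
rewrite big_mkcond; apply: leq_sum => a _; case: ifP => // sing.
rewrite (count_fibre (fun x : int => (v x)%:~R : 'F_l)).
pose g := gpoly n (a ^+ 11) (N%:~R : 'F_l).
apply: leq_trans (_ : \sum_(b | root g b) (n * (2 * d + 11)) <= _)%N.
  rewrite [X in (_ <= X)%N]big_mkcond; apply: leq_sum => b _; case: ifP => gb.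
    rewrite -size_filter; apply: (@cluster_size l n d N V U a b _ v) => //.
    - exact: filter_uniq.
    - by apply: contraNneq N0 => ->.
    - by move=> x; rewrite mem_filter => /andP[/andP[/eqP xa /eqP vb] /Hs[]].
    - apply/negP => /eqP g'b; move/negP: sing; apply; apply/existsP; exists b.
      by rewrite gb /=; apply/rootP.
  rewrite leqn0 -leqn0 leqNgt -has_count; apply/hasPn => x /Hs[_ _ E].
  apply/negP => /andP[/eqP xa /eqP vb]; move/negP: gb; apply; apply/rootP.
  by rewrite horner_gpoly -xa -vb -!rmorphXn -tauF_map /= E subrr.
rewrite sum_nat_const leq_mul2r; apply/orP; right.
rewrite -sum1_card -ltnS -(size_gpoly (a ^+ 11) (N%:~R : 'F_l) n0).
by apply: card_root; rewrite -size_poly_gt0 size_gpoly.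
Qed.

(** * Primes and smooth numbers *)

(** The valuations 2k of a^2 and 11 of p^11 are distinct. Once the common power of [p] is removed,
    one argument is zero mod [p] and the other is not, and the form reduces to a power of the latter
    up to sign. *)
Lemma tauF_neq0 n (p : nat) (a : int) : prime p -> tauF n (a ^+ 2) (p%:Z ^+ 11) != 0.
Proof.
move=> p_pr; have p0 : p%:Z != 0 by rewrite -lt0n prime_gt0.
have nz_Fp (z : int) : z%:~R != 0 :> 'F_p -> z != 0 by apply: contraNneq => ->.
have pF : p%:Z%:~R = 0 :> 'F_p by apply/eqP; rewrite intr_Fp_eq0.
have [->|a0] := eqVneq a 0.
  by rewrite expr0n tauF0l expf_neq0 // oppr_eq0 expf_neq0.
have [k [c [-> c_p]]] : exists k (c : int), a = p%:Z ^+ k * c /\ c%:~R != 0 :> 'F_p.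
  have a_gt0 : (0 < `|a|)%N by rewrite absz_gt0.
  have [c cp ac] := pfactor_coprime p_pr a_gt0.
  exists (logn p `|a|), (sgz a * c%:Z); split.
    rewrite [LHS]intEsg [in LHS]ac PoszM mulrA mulrC.
    by congr (_ * _); elim: (logn _ _) => // k IH; rewrite expnS PoszM IH exprS.
  rewrite intr_Fp_eq0 // dvdzE abszM absz_sg a0 mul1n.
  by rewrite -prime_coprime.
rewrite exprMn -exprM; have [lt|le] := ltnP (k * 2) 11.
  have -> : p%:Z ^+ 11 = p%:Z ^+ (k * 2) * p%:Z ^+ (11 - k * 2) by rewrite -exprD subnKC // ltnW.
  rewrite tauF_homog mulf_neq0 ?expf_neq0 //; apply: nz_Fp.
  rewrite tauF_map /= !rmorphXn /= pF expr0n subn_eq0 leqNgt lt tauF0r.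
  by rewrite !expf_neq0.
have -> : p%:Z ^+ (k * 2) * c ^+ 2 = p%:Z ^+ 11 * (p%:Z ^+ (k * 2 - 11) * c ^+ 2).
  by rewrite mulrA -exprD subnKC.
rewrite -[X in tauF _ _ X]mulr1 tauF_homog mulf_neq0 ?expf_neq0 //; apply: nz_Fp.
rewrite tauF_map /= rmorphM !rmorphXn /= pF rmorph1 expr0n subn_eq0.
have -> : (k * 2 <= 11)%N = false by lia.
by rewrite mul0r tauF0l expf_neq0 // oppr_eq0 oner_eq0.
Qed.

Definition npi (m : nat) : nat := (\sum_(0 <= p < m.+1 | prime p) 1)%N.

(** In Legendre's formula each p^k <= 2m contributes at most 1 to the exponent, and larger powers
    contribute 0. *)
Lemma logn_central_bin p m : prime p -> (0 < m)%N -> (p ^ logn p 'C(2 * m, m) <= 2 * m)%N.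
Proof.
move=> p_pr m0; have m2 : (0 < 2 * m)%N by lia.
have p1 := prime_gt1 p_pr.
suff H : (logn p 'C(2 * m, m) <= trunc_log p (2 * m))%N.
  by apply: leq_trans (trunc_logP p1 m2); rewrite leq_exp2l.
have := congr1 (logn p) (bin_fact (leq_pmull m (isT : (0 < 2)%N))).
have -> : (2 * m - m = m)%N by lia.
rewrite lognM ?lognM ?bin_gt0 ?muln_gt0 ?fact_gt0 //; last by lia.
rewrite !logn_fact //.
have -> : (\sum_(1 <= k < m.+1) m %/ p ^ k = \sum_(1 <= k < (2 * m).+1) m %/ p ^ k)%N.
  rewrite [RHS](big_cat_nat (n := m.+1)) //=; last by lia.
  rewrite [X in (_ + X)%N]big_nat_cond [X in (_ + X)%N]big1 ?addn0 // => k /andP[/andP[mk _] _].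
  by rewrite divn_small //; apply: leq_trans mk _; exact/ltnW/ltn_expl.
set T := trunc_log _ _ => E.
suff : (\sum_(1 <= k < (2 * m).+1) (2 * m) %/ p ^ k <=
    T + (\sum_(1 <= k < (2 * m).+1) m %/ p ^ k + \sum_(1 <= k < (2 * m).+1) m %/ p ^ k))%N.
  by rewrite -E leq_add2r.
rewrite -big_split /=; apply: leq_trans (_ : \sum_(1 <= k < (2 * m).+1)
   ((k <= T) + (m %/ p ^ k + m %/ p ^ k)) <= _)%N.
  apply: leq_sum => k _; have pk : (0 < p ^ k)%N by rewrite expn_gt0 prime_gt0.
  have [kT|Tk] := leqP k T; last first.
    by rewrite divn_small ?trunc_log_ltn //; apply: leq_trans (trunc_log_ltn _ p1) _; rewrite
      leq_exp2l.
  rewrite -ltnS ltn_divLR //; have := divn_eq m (p ^ k); have := ltn_pmod m pk.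
  by move: (m %/ p ^ k)%N (m %% p ^ k)%N (p ^ k)%N => a b c; nia.
rewrite big_split leq_add2r /= -big_mkcond /= sum1_count.
have -> : (count (fun k => (k <= T)%N) (index_iota 1 (2 * m).+1) =
   size [seq k <- index_iota 1 (2 * m).+1 | (k <= T)%N])%N by rewrite size_filter.
rewrite -[X in (_ <= X)%N](size_iota 1); apply: uniq_leq_size.
  by rewrite filter_uniq // iota_uniq.
by move=> k; rewrite mem_filter mem_index_iota mem_iota => /andP[? /andP[? _]]; lia.
Qed.

Lemma central_bin_ge m : (2 ^ m <= 'C(2 * m, m))%N.
Proof.
elim: m => [//|m IH].
have -> : (2 * m.+1 = (2 * m).+2)%N by lia.
rewrite binS (binS (2 * m) m) expnS mul2n -addnn.
have : ('C(2 * m, m) <= 'C((2 * m).+1, m.+1))%N by rewrite binS leq_addl.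
have : ('C(2 * m, m) <= 'C((2 * m).+1, m))%N by case: m {IH} => // m; rewrite binS leq_addr.
by rewrite binS; lia.
Qed.

(** For m = 2^(e-1), C(2m, m) is at least 2^m and is a product of at most [npi (2 ^ e)] prime
    powers, each at most 2m = 2^e. *)
Lemma chebyshev e : (0 < e)%N -> (2 ^ e.-1 <= e * npi (2 ^ e))%N.
Proof.
move=> e0; set m := (2 ^ e.-1)%N; have m0 : (0 < m)%N by rewrite expn_gt0.
have em : (2 * m = 2 ^ e)%N by rewrite -expnS prednK.
rewrite -(@leq_exp2l 2) // expnM; apply: leq_trans (central_bin_ge m) _.
have C0 : (0 < 'C(2 * m, m))%N by rewrite bin_gt0; lia.
have CE : 'C(2 * m, m) = (\prod_(p <- primes 'C(2 * m, m)) p ^ logn p 'C(2 * m, m))%N.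
  by rewrite {1}[LHS]prod_prime_decomp // prime_decompE big_map.
apply: (@leq_trans (\prod_(p <- primes 'C(2 * m, m)) (2 ^ e))%N).
  rewrite [X in (X <= _)%N]CE !big_seq; apply: leq_prod => p.
  by rewrite mem_primes => /andP[p_pr _]; rewrite -em logn_central_bin.
rewrite big_const_seq count_predT iter_muln_1 leq_exp2l; last by rewrite -{1}[1%N]/(2 ^ 0)%N
  ltn_exp2l.
rewrite /npi -em sum1_count -size_filter; apply: uniq_leq_size; first exact: primes_uniq.
move=> p; rewrite mem_primes => /and3P[p_pr _ pC].
rewrite mem_filter p_pr mem_index_iota /= ltnS; apply: leq_trans (logn_central_bin p_pr m0).
by rewrite -{1}[p]expn1 leq_exp2l ?prime_gt1 // logn_gt0 mem_primes p_pr C0.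
Qed.

(** Every integer up to [s] serves as a base, composite or not; the resulting overcount is
    harmless. *)
Fixpoint smooths (E s : nat) : seq nat :=
  if s is s'.+1 then [seq (a * s ^ j)%N | a <- smooths E s', j <- iota 0 E.+1] else [:: 1%N].

Lemma size_smooths E s : size (smooths E s) = (E.+1 ^ s)%N.
Proof. by elim: s => // s IH; rewrite [LHS]size_allpairs size_iota IH expnSr. Qed.

Lemma mem_smooths E s N : (0 < N < 2 ^ E.+1)%N ->
  (forall p, prime p -> (p %| N)%N -> (p <= s)%N) -> N \in smooths E s.
Proof.
elim: s N => [|s IH] N /andP[N0 NE] Ns.
  rewrite mem_seq1 eqn_leq N0 andbT leqNgt; apply/negP => N1.
  by have := Ns _ (pdiv_prime N1) (pdiv_dvd N); rewrite leqNgt pdiv_gt0.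
have sp : (s.+1 ^ logn s.+1 N * N`_(s.+1^') = N)%N by rewrite -p_part partnC.
have N'0 : (0 < N`_(s.+1^'))%N by rewrite part_gt0.
apply/allpairsP; exists ((N`_(s.+1^'))%N, logn s.+1 N); split; rewrite ?mem_iota -?[(_,
  _).1]/((N`_(s.+1^'))%N) -?[(_, _).2]/(logn s.+1 N).
- apply: IH; first by rewrite N'0 (leq_ltn_trans _ NE) // dvdn_leq // dvdn_part.
  move=> p p_pr pN; have := Ns p p_pr (dvdn_trans pN (dvdn_part _ _)).
  rewrite leq_eqVlt => /predU1P[ps|//].
  by have /pnatP := part_pnat (s.+1^') N; move=> /(_ N'0 _ p_pr pN); rewrite ps !inE eqxx.
- rewrite leq0n add0n andTb ltnS; have [s_pr|/negPf sN] := boolP (prime s.+1); last first.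
    by rewrite lognE sN.
  rewrite -ltnS -(@ltn_exp2l 2) //; apply: leq_ltn_trans NE.
  apply: leq_trans (_ : s.+1 ^ logn s.+1 N <= _)%N.
    by case: (logn _ _) => // k; rewrite leq_exp2r //; case: s s_pr {IH Ns sp N'0}.
  by rewrite dvdn_leq // pfactor_dvdnn.
by rewrite mulnC sp.
Qed.

Lemma size_by_fibre (T : Type) (S : eqType) (f : T -> S) (L : seq S) (s : seq T) :
  all (fun x => f x \in L) s -> (size s <= \sum_(y <- L) count (fun x => f x == y) s)%N.
Proof.
elim: s => [|x s IH] //= /andP[fx /IH le]; rewrite big_split /= -add1n leq_add //.
by rewrite (big_rem _ fx) /= eqxx.
Qed.

Lemma sqr_le_exp2 c : exists r0, forall r, (r0 <= r)%N -> (c * r ^ 2 <= 2 ^ r)%N.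
Proof.
exists (4 * (64 * c).+1)%N => r Hr; set u := (r %/ 4)%N.
have ur : (4 * u <= r < 4 * u + 4)%N by have := divn_eq r 4; rewrite /u; lia.
apply: leq_trans (_ : 2 ^ (4 * u) <= _)%N; last by rewrite leq_exp2l; lia.
rewrite (mulnC 4%N) expnM; apply: leq_trans (_ : u ^ 4 <= _)%N; last first.
  by rewrite leq_exp2r // ltnW // ltn_expl.
have cu : (64 * c <= u)%N by lia.
have u1 : (0 < u)%N by lia.
apply: leq_trans (_ : c * (8 * u) ^ 2 <= _)%N.
  by rewrite leq_mul2l leq_exp2r //; apply/orP; right; lia.
rewrite (expnD u 2 2) expnMn mulnA leq_mul2r; apply/orP; right.
by apply: leq_trans (_ : u * 1 <= _)%N; [lia | rewrite expnS expn1 leq_mul2l u1 orbT].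
Qed.

(** The exponent of 2 on the left is about c + (2s + 4) log t with s <= sqrt t, hence o(t). For 2^t
    close to X this makes the number of smooth values X^o(1). *)
Lemma subexponential c : exists t0, forall t s, (t0 <= t)%N -> (s ^ 2 <= t)%N ->
  (2 ^ c * t ^ (2 * s + 4) <= 2 ^ (t %/ 100))%N.
Proof.
have [r0 Hr0] := sqr_le_exp2 (2 * 1600 ^ 2).
exists (2 ^ r0 + 400 * c)%N => t s Ht st; set r := (trunc_log 2 t).+1.
have t0 : (0 < t)%N by apply: leq_trans Ht; rewrite addn_gt0 expn_gt0.
have tr : (t <= 2 ^ r)%N by rewrite ltnW // trunc_log_ltn.
have rt : (2 ^ r <= 2 * t)%N by rewrite expnS leq_mul2l trunc_logP.
have r0r : (r0 <= r)%N.
  by rewrite -(@leq_exp2l 2) //; apply: leq_trans tr; apply: leq_trans Ht; rewrite leq_addr.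
have rr : ((1600 * r) ^ 2 <= t)%N.
  by rewrite -(@leq_pmul2l 2) //; apply: leq_trans rt; apply: leq_trans (Hr0 r r0r); rewrite
    expnMn mulnA.
apply: leq_trans (_ : 2 ^ (c + r * (2 * s + 4)) <= _)%N.
  by rewrite (expnD 2 c) leq_mul2l (expnM 2 r) leq_exp2r ?tr ?orbT // addn_gt0 orbT.
rewrite leq_exp2l // leq_divRL //.
have ct : (400 * c <= t)%N by apply: leq_trans Ht; rewrite leq_addl.
have qs : (1600 * r * s <= t)%N.
  have [le|/ltnW le] := leqP (1600 * r) s.
    by apply: leq_trans st; rewrite -mulnn leq_mul2r le orbT.
  by apply: leq_trans rr; rewrite -mulnn leq_mul2l le orbT.
have qt : (1600 * r <= t)%N by apply: leq_trans rr; rewrite -mulnn leq_pmulr // muln_gt0.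
by lia.
Qed.

(** With w = t / 100, if there were none then at most 2^(t-2w) primes would lie below 2^(t-w), a
    deficit of 2^w that Chebyshev's bound excludes. *)
Lemma exists_prime_between : exists t0, forall t, (t0 <= t)%N ->
  exists l, [/\ prime l, (2 ^ (t - 2 * (t %/ 100)) < l)%N & (l <= 2 ^ (t - t %/ 100))%N].
Proof.
have [t0 Ht0] := subexponential 1.
exists (maxn t0 100) => t; rewrite geq_max => /andP[/Ht0/(_ (leq0n _ : 0 ^ 2 <= t)%N) t4 t100].
set w := (t %/ 100)%N in t4 *; have wt : (100 * w <= t)%N by rewrite mulnC leq_trunc_div.
have w0 : (0 < w)%N by rewrite divn_gt0.
pose P l := prime l && (2 ^ (t - 2 * w) < l)%N.
have [/hasP[l]|/hasPn noP] := boolP (has P (index_iota 0 (2 ^ (t - w)).+1)).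
  by rewrite mem_index_iota ltnS => /andP[_ lt] /andP[l_pr ltl]; exists l.
have le_npi : (npi (2 ^ (t - w)) <= 2 ^ (t - 2 * w))%N.
  rewrite /npi sum1_count -size_filter -[X in (_ <= X)%N](size_iota 1); apply: uniq_leq_size.
    by rewrite filter_uniq // iota_uniq.
  move=> l; rewrite mem_filter mem_iota => /andP[l_pr /noP].
  by rewrite /P l_pr /= -leqNgt add1n ltnS prime_gt0.
have tw0 : (0 < t - w)%N by lia.
have := leq_trans (chebyshev tw0) (leq_mul (leqnn _) le_npi).
have -> : (t - w).-1 = ((t - 2 * w) + w.-1)%N by lia.
rewrite expnD mulnC leq_pmul2r ?expn_gt0 // => le.
move: t4; rewrite muln0 add0n expn1 -[w]prednK // (expnS 2 w.-1) leq_pmul2l // => t4.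
have : (t ^ 4 <= t ^ 1)%N by apply: leq_trans t4 _; apply: leq_trans le _; rewrite expn1 leq_subr.
by rewrite leq_exp2l //; lia.
Qed.

Lemma fact_le_expn k : (k`! <= k ^ k)%N.
Proof.
elim: k => // k IH; rewrite factS expnS leq_mul2l (leq_trans IH) //.
by case: k {IH} => // k; rewrite leq_exp2r.
Qed.

Lemma posz_expn (a k : nat) : (a ^ k)%N%:Z = a%:Z ^+ k.
Proof. by elim: k => // k IH; rewrite expnS PoszM IH exprS. Qed.

(** Powers of 2: the left side is at most 2^(292 t + 481), using 24! <= 24^24 <= 2^120, and the
    right side exceeds 2^(300 (t - 2w)) >= 2^(294 t). *)
Lemma determinant_small (t w U l : nat) : (100 * w <= t)%N -> (1000 <= t)%N ->
  (U <= 2 ^ t.+1)%N -> (2 ^ (t - 2 * w) < l)%N ->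
  25%:Z * ((136 * U ^ 2) ^ 8)%N%:Z * (24`!%:Z * U%:Z ^+ 'C(24, 2)) < l%:Z ^+ 'C(25, 2).
Proof.
move=> wt t1 Ut tl.
have [c1 E1] : exists c, c = 'C(24, 2) by eexists.
have [c2 E2] : exists c, c = 'C(25, 2) by eexists.
have [f Ef] : exists f, f = 24`! by eexists.
have Hf : (f <= 2 ^ 120)%N.
  rewrite Ef; apply: leq_trans (fact_le_expn _) _; rewrite -[120%N]/(5 * 24)%N (expnM 2 5).
  by rewrite leq_exp2r.
rewrite -Ef -E1 -E2; rewrite bin2 -[X in _ = X]/276%N in E1; rewrite bin2 -[X in _ = X]/300%N in E2.
rewrite -!posz_expn -!PoszM ltz_nat.
apply: (@leq_ltn_trans (2 ^ (5 + (8 + t.+1 * 2) * 8 + (120 + t.+1 * c1)))%N).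
  rewrite 3!expnD; apply: leq_mul; last first.
    by apply: leq_mul => //; rewrite expnM; case: (c1) => // c; rewrite leq_exp2r.
  apply: leq_mul; first by [].
  rewrite expnM leq_exp2r // expnD; apply: leq_mul; first by [].
  by rewrite expnM leq_exp2r.
apply: (@leq_trans ((2 ^ (t - 2 * w)).+1 ^ c2)%N); last by rewrite E2 leq_exp2r.
apply: (@ltn_trans ((2 ^ (t - 2 * w)) ^ c2)%N); last by rewrite E2 ltn_exp2r.
rewrite -expnM ltn_exp2l //; lia.
Qed.

Lemma tau_fibre_bound n : (0 < n)%N -> exists t0, forall t m y (N : int) (s : seq nat),
  (t0 <= t)%N -> (2 ^ t <= m < 2 ^ t.+1)%N -> (y ^ 2 <= t)%N -> N != 0 ->
  (forall p, prime p -> (p %| `|N|)%N -> (p <= y)%N) -> uniq s ->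
  all (fun p => (0 < p <= m)%N && (tauF n (tau p ^+ 2) (p%:Z ^+ 11) == N)) s ->
  (size s <= (129 * n ^ 2 + 1) * 2 ^ (t - t %/ 100))%N.
Proof.
move=> n0; have [t1 Ht1] := exists_prime_between.
exists (t1 + 1000 + 4 * n)%N => t m y N s Ht /andP[tm mt] yt N0 Ny us Hs.
set w := (t %/ 100)%N; have wt : (100 * w <= t)%N by rewrite mulnC leq_trunc_div.
have [|l [l_pr tl lt]] := Ht1 t; first by lia.
rewrite -/w in tl lt.
have tl' : (t < 2 * l)%N by have := ltn_expl (t - 2 * w) (isT : (1 < 2)%N); lia.
(* Being larger than [n] and [y], the prime [l] divides neither [n] nor the [y]-smooth [N], as
   [curve_count] requires. *)
have nl : (n < l)%N by lia.
have yl : (y < l)%N.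
  by rewrite ltnNge; apply/negP => ly; have := leq_mul ly ly; rewrite mulnn; nia.
have l_odd : odd l by case: (even_prime l_pr) => // l2; lia.
pose v (x : int) := tau `|x|.
rewrite -(size_map Posz); apply: leq_trans (@curve_count l n 24 m N ((136 * m ^ 2) ^ 8)%N%:Z
   [seq p%:Z | p <- s] v l_pr l_odd _ _ _ _ _ _) _.
- by rewrite gtnNdvd.
- by apply/negP => lN; move: yl; rewrite ltnNge Ny.
- by rewrite map_inj_uniq // => a b [].
- move=> _ /mapP[p /(allP Hs)/andP[/andP[p0 pm] /eqP E] ->]; split => //.
  apply: le_trans (tau_bound p0) _; rewrite lez_nat leq_exp2r // leq_mul2l leq_exp2r //.
- by apply: leq_trans tm; rewrite expn_gt0.
- by apply: determinant_small wt _ (ltnW mt) tl; lia.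
have : (m %/ l + 1 <= 2 ^ (t - w))%N.
  rewrite addn1; apply: (@leq_trans (2 ^ (2 * w).+1)%N); last by rewrite leq_exp2l //; lia.
  rewrite ltn_divLR ?prime_gt0 //; apply: leq_trans mt _.
  have -> : (t.+1 = (2 * w).+1 + (t - 2 * w))%N by lia.
  by rewrite expnD leq_mul2l ltnW ?orbT.
(* For d = 24 the two terms of [curve_count] are 2n * 59n = 118 n^2 and 11 n^2 + 1, each times at
   most 2^(t-w). *)
move: lt; move: (2 ^ (t - w))%N (m %/ l + 1)%N => q z lq zq.
rewrite -mulnn; nia.
Qed.

Lemma max_pdiv_ge p N : (0 < N)%N -> prime p -> (p %| N)%N -> (p <= max_pdiv N)%N.
Proof. by move=> N0 p_pr pN; rewrite max_pdiv_max // /pi_of mem_primes p_pr N0. Qed.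

Lemma tau_even_power_bound n p m t : (0 < p <= m)%N -> (m < 2 ^ t.+1)%N ->
  (`|tauF n (tau p ^+ 2) (p%:Z ^+ 11)| <= 2 ^ ((32 * t + 162) * n))%N.
Proof.
move=> /andP[p0 pm] mt.
pose M := (2 ^ (32 * t + 160))%N; have M1 : 1 <= M%:Z by rewrite lez_nat expn_gt0.
have pt : (136 * p ^ 2 <= 2 ^ (2 * t + 10))%N.
  have -> : (2 * t + 10 = 8 + t.+1 * 2)%N by lia.
  rewrite expnD; apply: leq_mul; first by [].
  by rewrite expnM leq_exp2r // (leq_trans pm) // ltnW.
have HA : `|tau p ^+ 2| <= M%:Z.
  have -> : M = (((2 ^ (2 * t + 10)) ^ 8) ^ 2)%N by rewrite -!expnM /M; congr (2 ^ _)%N; lia.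
  rewrite normrX posz_expn lerXn2r ?nnegrE //; apply: le_trans (tau_bound p0) _.
  by rewrite lez_nat leq_exp2r.
have HB : `|p%:Z ^+ 11| <= M%:Z.
  rewrite -posz_expn ger0_norm // lez_nat; apply: leq_trans (_ : (2 ^ t.+1) ^ 11 <= _)%N.
    by rewrite leq_exp2r // (leq_trans pm) // ltnW.
  by rewrite -expnM leq_exp2l //; lia.
have := tauF_bound n M1 HA HB.
have -> : (4 * M%:Z) ^+ n = (2 ^ ((32 * t + 162) * n))%N%:Z.
  by rewrite expnM posz_expn -[162%N]/(160 + 2)%N addnA (expnD 2) PoszM -/M mulrC.
by rewrite -abszE lez_nat.
Qed.

(** Taken for every [k], the inequality says that the exceptional primes are o(pi(m)); the inner [k]
    leaves room for finitely many further exceptions. *)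
Lemma few_smooth_values n k : (0 < n)%N -> exists m0, forall m, (m0 <= m)%N ->
  (k * (k + \sum_(0 <= p < m.+1 | prime p &&
     (gpf (tau (p ^ (2 * n))) ^ 2 <= trunc_log 2 m)) 1) <= npi m)%N.
Proof.
move=> n0; pose C := (129 * n ^ 2 + 1)%N; pose c := (2 * (k * ((3 + k) * C)))%N.
have [t1 Ht1] := tau_fibre_bound n0; have [t2 Ht2] := subexponential c.
exists (2 ^ (t1 + t2 + 194 * n + 2))%N => m Hm; set t := trunc_log 2 m.
have m0 : (0 < m)%N by apply: leq_trans Hm; rewrite expn_gt0.
have tm : (2 ^ t <= m < 2 ^ t.+1)%N by rewrite trunc_logP ?trunc_log_ltn.
have tt : (t1 + t2 + 194 * n + 2 <= t)%N by rewrite -ltnS -(@ltn_exp2l 2) //; case/andP: tm => _;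
  apply: leq_ltn_trans.
rewrite sum1_count -size_filter; set B := seq.filter _ _.
pose f p := tauF n (tau p ^+ 2) (p%:Z ^+ 11).
pose B1 := [seq p <- B | odd p].
have B1P p : p \in B1 -> [/\ prime p, (0 < p <= m)%N, tau (p ^ (2 * n)) = f p & (gpf (f p) ^ 2 <=
  t)%N].
  rewrite !mem_filter mem_index_iota /= ltnS => /andP[p_odd /andP[/andP[p_pr gp] pm]].
  by rewrite /f -tau_even_power // pm prime_gt0.
(* The Hecke relations are available for odd [p], so the prime 2 is counted apart. *)
have sB : (size B <= 1 + size B1)%N.
  rewrite -(count_predC (fun p => odd p) B) addnC [size B1]size_filter leq_add2r -size_filter.
  rewrite -[1%N]/(size [:: 2%N]); apply: uniq_leq_size.
    by rewrite !filter_uniq // iota_uniq.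
  move=> p; rewrite !mem_filter mem_seq1 => /andP[/= p_odd /andP[/andP[p_pr _] _]].
  by case: (even_prime p_pr) p_odd => [->|->].
pose y := \max_(p <- B1) gpf (f p).
have yt : (y ^ 2 <= t)%N.
  rewrite /y big_seq; elim/big_ind: _ => //; last by move=> p /B1P[].
  by move=> a b; rewrite /maxn; case: ifP.
have gpf_y p : p \in B1 -> (gpf (f p) <= y)%N.
  by move=> pB; rewrite /y (big_rem _ pB) /= leq_maxl.
have f_neq0 p : p \in B1 -> f p != 0 by move=> /B1P[p_pr _ _ _]; exact: tauF_neq0.
have f_smooth p q : p \in B1 -> prime q -> (q %| `|f p|)%N -> (q <= y)%N.
  move=> pB q_pr qf; apply: leq_trans (gpf_y p pB); apply: max_pdiv_ge => //.
  by rewrite absz_gt0 f_neq0.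
pose E := ((32 * t + 162) * n)%N.
pose L := [seq a%:Z | a <- smooths E y] ++ [seq - a%:Z | a <- smooths E y].
have fL : all (fun p => f p \in L) B1.
  apply/allP => p pB; have [p_pr pm _ _] := B1P p pB.
  have fp : `|f p|%N \in smooths E y.
    apply: mem_smooths => [|q]; last exact: f_smooth.
    rewrite absz_gt0 f_neq0 //= expnS; case/andP: tm => _ /(tau_even_power_bound n pm).
    rewrite -/(f p) -/E => le; apply: leq_ltn_trans le _.
    by rewrite ltn_Pmull // expn_gt0.
  rewrite mem_cat; case: (leP 0 (f p)) => f0; apply/orP; [left|right]; apply/mapP; exists `|f
    p|%N => //; lia.
pose Q := (t ^ (2 * y))%N; pose D := (2 ^ (t - t %/ 100))%N.
(* Since t >= 194 n + 2, the number E + 1 of exponents allowed for each base is at most t^2. *)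
have sL : (size L <= 2 * Q)%N.
  rewrite size_cat !size_map size_smooths addnn -mul2n leq_mul2l /Q expnM.
  apply/orP; right; case: (y) => // y'; rewrite leq_exp2r // /E -mulnn; nia.
have sB1 : (size B1 <= 2 * Q * (C * D))%N.
  apply: leq_trans (size_by_fibre fL) _.
  apply: leq_trans (_ : \sum_(N <- L) C * D <= _)%N; last first.
    by rewrite big_const_seq count_predT iter_addn_0 mulnC leq_mul2r sL orbT.
  apply: leq_sum => N _; rewrite -size_filter.
  case E0 : [seq _ <- _ | _] => [//|p s']; rewrite -E0.
  have : p \in [seq x <- B1 | f x == N] by rewrite E0 mem_head.
  rewrite mem_filter => /andP[/eqP fpN pB].
  apply: (Ht1 t m y N) => //; first by lia.
  - by rewrite -fpN f_neq0.
  - by move=> q; rewrite -fpN; exact: f_smooth.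
  - by rewrite !filter_uniq // iota_uniq.
  by apply/allP => q; rewrite mem_filter => /andP[fq /B1P[_ -> _ _]].
have Q0 : (0 < Q)%N by rewrite expn_gt0; apply/orP; left; lia.
have D0 : (0 < D)%N by rewrite expn_gt0.
have t0 : (0 < t)%N by lia.
have kB : (k + size B <= (3 + k) * (Q * (C * D)))%N.
  apply: leq_trans (_ : k + (1 + 2 * Q * (C * D)) <= _)%N; first by lia.
  have : (0 < Q * (C * D))%N by rewrite !muln_gt0 Q0 D0 /C addn1.
  by rewrite -(mulnA 2 Q); move: (Q * (C * D))%N => z; nia.
have mono : (npi (2 ^ t) <= npi m)%N.
  rewrite /npi [X in (_ <= X)%N](big_cat_nat (n := (2 ^ t).+1)) //= ?leq_addr //.
  by rewrite ltnS; case/andP: tm.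
rewrite -(@leq_pmul2l t) //; apply: leq_trans (leq_mul (leqnn t) mono).
apply: leq_trans (chebyshev t0).
rewrite -(@leq_pmul2l 2) // -expnS prednK //.
apply: leq_trans (_ : c * t ^ (2 * y + 1) * D <= _)%N.
  apply: leq_trans (_ : 2 * (t * (k * ((3 + k) * (Q * (C * D))))) <= _)%N.
    by rewrite !leq_mul2l kB !orbT.
  by rewrite /c expnD expn1 -/Q; apply: eq_leq; ring.
have tE : (t = t %/ 100 + (t - t %/ 100))%N by rewrite subnKC // leq_div.
rewrite [X in (_ <= 2 ^ X)%N]tE (expnD 2) -/D leq_mul2r; apply/orP; right.
have := Ht2 t y _ yt; rewrite (leq_trans _ tt); last by lia.
move=> /(_ isT); apply: leq_trans; apply: leq_mul; first exact/ltnW/ltn_expl.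
by rewrite leq_exp2l // ?leq_add2l //; lia.
Qed.

(** * Density *)

Section LimitAtInfinity.
Variables (R : realType) (f : R -> \bar R).
Local Open Scope classical_set_scope.
Local Open Scope ereal_scope.

Lemma limf_einf_pinfty_ge (a : \bar R) (A : R) :
  (forall x, (A < x)%R -> a <= f x) -> a <= limf_einf f +oo%R.
Proof.
move=> Hf; rewrite limf_einfE; apply: le_ereal_sup_tmp.
exists (ereal_inf (f @` [set x | (A < x)%R])).
  exists [set x | (A < x)%R] => //.
  by exists A; split; [exact: num_real|].
by apply/ereal_infP => _ [x Ax <-]; exact: Hf.
Qed.

Lemma limf_esup_pinfty_le (a : \bar R) (A : R) :
  (forall x, (A < x)%R -> f x <= a) -> limf_esup f +oo%R <= a.
Proof.
move=> Hf; rewrite limf_esupE; apply: ge_ereal_inf.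
exists (ereal_sup (f @` [set x | (A < x)%R])).
  exists [set x | (A < x)%R] => //.
  by exists A; split; [exact: num_real|].
by apply/ereal_supP => _ [x Ax <-]; exact: Hf.
Qed.

Lemma limf_einf_le_esup_pinfty : limf_einf f +oo%R <= limf_esup f +oo%R.
Proof.
rewrite limf_einfE limf_esupE; apply/ereal_supP => _ [V [A [_ AV]] <-].
apply/ereal_infP => _ [W [B [_ BW]] <-].
pose x : R := (Num.max A B + 1)%R.
have Ax : (A < x)%R by rewrite ltr_pwDr // le_max lexx.
have Bx : (B < x)%R by rewrite ltr_pwDr // le_max lexx orbT.
apply: (@le_trans _ _ (f x)).
  by apply: ge_ereal_inf; exists (f x) => //; exists x => //; exact: AV.
by apply: le_ereal_sup_tmp; exists (f x) => //; exists x => //; exact: BW.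
Qed.

End LimitAtInfinity.

Lemma prime_countE (R : realType) (S : set nat) (x : R) :
  (prime_count S x + \sum_(0 <= p < (Num.truncn x).+1 | prime p && (p \notin S)) 1 =
   npi (Num.truncn x))%N.
Proof. by rewrite /npi /prime_count [RHS](bigID (fun p => p \in S)). Qed.

Lemma density_one (R : realType) (S : set nat) :
  (forall k, exists m0, forall m, (m0 <= m)%N ->
     (k * (k + \sum_(0 <= p < m.+1 | prime p && (p \notin S)) 1) <= npi m)%N) ->
  lower_density R S = 1%E /\ upper_density R S = 1%E.
Proof.
move=> HS; have le1 x : (prime_ratio S x <= 1 :> \bar R)%E.
  rewrite lee_fin -[primepi x]/(npi (Num.truncn x)).
  have [->|n0] := posnP (npi (Num.truncn x)); first by rewrite invr0 mulr0.
  by rewrite ler_pdivrMr ?ltr0n // mul1r ler_nat -(prime_countE S) leq_addr.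
have ge1 : (1 <= lower_density R S)%E.
  apply/lee_addgt0Pr => e e0.
  pose k := (Num.truncn e^-1).+1; have ke : 1 <= e * k%:R.
    by rewrite mulrC -ler_pdivrMr // mul1r ltW // truncnS_gt.
  have [m0 Hm0] := HS k.
  suff : ((1 - e)%:E <= lower_density R S)%E by rewrite EFinB leeBlDr.
  apply: (@limf_einf_pinfty_ge _ _ _ m0%:R) => x m0x.
  have /Hm0 : (m0 <= Num.truncn x)%N by rewrite truncn_ge_nat ?(le_trans _ (ltW m0x)) // ltW.
  rewrite lee_fin; have := prime_countE S x; set b := (\sum_(_ <= _ < _ | _) _)%N => E kb.
  have n0 : (0 < npi (Num.truncn x))%N by apply: leq_trans kb; rewrite muln_gt0 addn_gt0.
  rewrite ler_pdivlMr ?ltr0n // -[primepi x]/(npi (Num.truncn x)) -E natrD.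
  move: kb; rewrite -(ler_nat R) natrM !natrD -E natrD.
  set c := (prime_count S x)%:R; set d := b%:R => kb.
  have d0 : 0 <= d by []. have k0 : 0 <= k%:R :> R by [].
  suff : d <= e * (c + d) by lra.
  by nra.
split; apply/eqP; rewrite eq_le.
  rewrite ge1 andbT; apply: le_trans (limf_einf_le_esup_pinfty _) _.
  exact: (@limf_esup_pinfty_le _ _ _ 0).
rewrite (le_trans ge1 (limf_einf_le_esup_pinfty _)) andbT.
exact: (@limf_esup_pinfty_le _ _ _ 0).
Qed.

Lemma density_one_gpf_tau (R : realType) n (thr : nat -> R) (P0 : nat) : (0 < n)%N ->
  (forall p, (P0 <= p)%N -> thr p <= Num.sqrt (ln p%:R)) ->
  let S := [set p : nat | prime p /\ thr p < (gpf (tau (p ^ (2 * n))))%:R]%classic in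
  lower_density R S = 1%E /\ upper_density R S = 1%E.
Proof.
move=> n0 Hthr S; apply: density_one => k.
(* The summand [P0] absorbs the primes below [P0], where the threshold is not controlled. *)
have [m0 Hm0] := few_smooth_values (k + P0) n0; exists m0 => m /Hm0.
apply: leq_trans; apply: leq_mul; first exact: leq_addr.
rewrite -addnA leq_add2l; pose A p := prime p && (p \notin S).
pose B p := prime p && (gpf (tau (p ^ (2 * n))) ^ 2 <= trunc_log 2 m)%N.
apply: leq_trans (_ : \sum_(0 <= p < m.+1) ((p < P0)%N + B p) <= _)%N.
  rewrite [X in (X <= _)%N]big_mkcond !big_nat; apply: leq_sum => p pm; case: ifP => // Ap.
  have [//|Pp] := ltnP p P0; suff -> : B p by [].
  move: Ap => /andP[p_pr pS]; rewrite /B p_pr /=.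
  have p0 : 0 < p%:R :> R by rewrite ltr0n prime_gt0.
  have m1 : (0 < m)%N by apply: leq_trans (prime_gt0 p_pr) _; move: pm; lia.
  set g := gpf _; have gs : g%:R <= Num.sqrt (ln p%:R) :> R.
    apply: le_trans (Hthr p Pp); rewrite leNgt; apply/negP => H.
    by move/negP: pS; apply; rewrite inE.
  (* g^2 <= ln p < (t + 1) ln 2 <= t + 1 for t = [trunc_log 2 m], so the integer g^2 is at most
     t. *)
  have : (g ^ 2)%:R < (trunc_log 2 m).+1%:R :> R.
    have lp0 : 0 <= ln p%:R :> R by rewrite ln_ge0 // ler1n prime_gt0.
    rewrite natrX; apply: (@le_lt_trans _ _ (ln p%:R)).
      by rewrite -(sqr_sqrtr lp0) lerXn2r ?nnegrE ?sqrtr_ge0.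
    apply: (@lt_le_trans _ _ (ln (2 ^+ (trunc_log 2 m).+1))).
      rewrite ltr_ln ?posrE // ?exprn_gt0 // -natrX ltr_nat.
      by apply: leq_ltn_trans (trunc_log_ltn m (isT : (1 < 2)%N)); move: pm; lia.
    rewrite lnXn // -[ln 2 *+ _]mulr_natr ler_piMl //.
    by have := @le_ln1Dx R 1; rewrite (_ : 1 + 1 = 2) //; apply; lra.
  by rewrite ltr_nat ltnS.
rewrite big_split /= leq_add //; last by rewrite [X in (_ <= X)%N]big_mkcond /=; apply: leq_sum
  => p _; rewrite -/(B p); case: (B p).
rewrite -big_mkcond /= sum1_count -size_filter -[X in (_ <= X)%N](size_iota 0).
apply: uniq_leq_size; first by rewrite filter_uniq // iota_uniq.
by move=> p; rewrite mem_filter mem_iota => /andP[-> _].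
Qed.

(** Replace the exponent [a] by 3/8, then ln ln x by ln x, and add 1/8 + 3/8 = 1/2. *)
Lemma threshold_le (R : realType) (x a : R) : 1 <= ln (ln x) -> a <= 3 / 8 ->
  ln x `^ (1 / 8) * ln (ln x) `^ a <= Num.sqrt (ln x).
Proof.
move=> lx ha; have l0 : 0 < ln x by rewrite ltNge; apply/negP => /ln0 E; move: lx; rewrite E; lra.
rewrite -powR12_sqrt ?(ltW l0) //.
have -> : 2^-1 = 1 / 8 + 3 / 8 :> R by lra.
rewrite powRD; last by rewrite gt_eqF ?implybT.
rewrite ler_pM ?powR_ge0 //; apply: (le_trans (ler_powR lx ha)).
apply: ge0_ler_powR; rewrite ?nnegrE; [lra|lra|exact: ltW|].
by have := @le_ln1Dx R (ln x - 1); rewrite (addrC 1) subrK; lra.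
Qed.

Theorem theorem1 (R : realType) (eps : R) (heps : 0 < eps) :
  (forall n : nat, (1 <= n)%N ->
     almost_all_primes R (fun p : nat =>
       ln (p%:R : R) `^ (1 / 8) * ln (ln (p%:R : R)) `^ (3 / 8 - eps)
         < (gpf (tau (p ^ (2 * n))%N))%:R)) /\
  (exists q0 : nat, forall n : nat, (1 <= n)%N ->
     (q0 <= gpf (2 * n + 1)%N)%N ->
     (0 < lower_density R [set p : nat | prime p /\
        (((gpf (2 * n + 1)%N)%:R : R) `^ (- eps) * ln (p%:R : R) `^ (1 / 8)
          * ln (ln (p%:R : R)) `^ (3 / 8)
          < (gpf (tau (p ^ (2 * n))%N))%:R)%R]%classic)%E).
Proof.
(* From e^e on, ln ln p is at least 1. *)
pose P0 := (Num.truncn (expR (expR 1) : R)).+1.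
have lnln_ge1 p : (P0 <= p)%N -> 1 <= ln (ln (p%:R : R)).
  rewrite -(ler_nat R) => /(lt_le_trans (truncnS_gt _))/ltW le_p.
  have ep (z : R) : 0 < expR z by exact: expR_gt0.
  have p0 := lt_le_trans (ep _) le_p.
  move: le_p; rewrite -ler_ln ?posrE // expRK => le_l.
  have l0 := lt_le_trans (ep _) le_l.
  by move: le_l; rewrite -ler_ln ?posrE // expRK.
split=> [n n0|].
  apply: (density_one_gpf_tau (P0 := P0)) => // p /lnln_ge1 lx.
  by apply: threshold_le => //; lra.
exists 0%N => n n0 _.
have [|-> _ //] := @density_one_gpf_tau R n (fun p => (gpf (2 * n + 1)%N)%:R `^ (- eps)
  * ln p%:R `^ (1 / 8) * ln (ln p%:R) `^ (3 / 8)) P0 n0.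
move=> p /lnln_ge1 lx; apply: le_trans (threshold_le lx (lexx _)).
(* The base [gpf] is at least 1 and the exponent is negative, so the extra factor is at most 1. *)
rewrite ler_wpM2r ?powR_ge0 // ler_piMl ?powR_ge0 //.
rewrite -[leRHS](@powRr0 _ ((gpf (2 * n + 1)%N)%:R : R)) ler_powR ?oppr_le0 ?(ltW heps) //.
by rewrite ler1n /gpf max_pdiv_gt0.
Qed.
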